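(* Let $0<p<1$ and $d\geq 2$, and let $\mathcal{G}=(\mathcal{V},\mathcal{E})$ be the random graph on the open vertices of $\mathbb{Z}^d$ with parameter $p$ defined in the context. Fix integers $\nu\geq 0$ and $l\geq 1$. For $n\ge 1$ let $S_n$ be the number of vertices in $\mathcal{V}\cap[1,n]^d$ having degree $\nu+1$ in $\mathcal{G}$, and let $L_n$ be the number of edges of $\mathcal{G}$ of $L_1$-length $l$ having an end vertex in $\mathcal{V}\cap[1,n]^d$. Then, as $n\to\infty$: (a) $\dfrac{S_n-\mathbb{E}(S_n)}{n^{d/2}}$ converges weakly to a normal random variable; (b) $\dfrac{L_n-\mathbb{E}(L_n)}{n^{d/2}}$ converges weakly to a normal random variable.
   Context: Write $u=(u(1),\ldots,u(d))$ for $u\in\mathbb{Z}^d$. Let $\Omega=\{0,1\}^{\mathbb{Z}^d}$ with the product $\sigma$-algebra $\mathcal{F}$ and the product measure $P_p$ under which the coordinates $\omega(u)$, $u\in\mathbb{Z}^d$, are independent with $P_p(\omega(u)=1)=p=1-P_p(\omega(u)=0)$. Let $\{U_{u,v}: u,v\in\mathbb{Z}^d,\ v(d)=u(d)-1\}$ be i.i.d. uniform $(0,1]$ random variables on a probability space $(\Xi,\mathcal{S},\mu)$, and work on $(\Omega\times\Xi,\mathcal{F}\times\mathcal{S},\mathbb{P}:=P_p\times\mu)$, with expectation $\mathbb{E}$. A vertex $u$ is open if $\omega(u)=1$; $\mathcal{V}=\{u\in\mathbb{Z}^d:\omega(u)=1\}$ is the set of open vertices. For every $u\in\mathbb{Z}^d$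 (open or not) let $N_u$ be the set of those $v\in\mathcal{V}$ with $v(d)=u(d)-1$ that minimize $\sum_{i=1}^d|w(i)-u(i)|$ among all $w\in\mathcal{V}$ with $w(d)=u(d)-1$. For $p>0$, $N_u$ is almost surely nonempty; let $h(u)\in N_u$ be the (almost surely unique) element with $U_{u,h(u)}=\min\{U_{u,v}:v\in N_u\}$. Let $\mathcal{E}=\{\langle u,h(u)\rangle:u\in\mathcal{V}\}$ (undirected edges) and $\mathcal{G}=(\mathcal{V},\mathcal{E})$. The $L_1$-length of an edge $\langle u,v\rangle$ is $\sum_{i=1}^d|u(i)-v(i)|$. The degree of a vertex is its number of incident edges in $\mathcal{G}$ (the downward edge $\langle u,h(u)\rangle$ included). *)

(* Defs.v *)
From HB Require Import structures.
From mathcomp Require Import all_boot all_order all_algebra finmap.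
From mathcomp Require Import all_classical all_reals all_analysis.
Set Implicit Arguments.
Unset Strict Implicit.
Unset Printing Implicit Defensive.
Import Order.TTheory GRing.Theory Num.Theory.
Import numFieldNormedType.Exports.

Local Open Scope classical_set_scope.
Local Open Scope ring_scope.

(* Mutual independence of the subfamily of [X] indexed by [D]. *)
Definition mutually_independent (R : realType) d d' (T : measurableType d)
    (T' : measurableType d') (P : probability T R) (I : choiceType)
    (D : set I) (X : I -> T -> T') : Prop :=
  forall (J : {fset I}) (B : I -> set T'),
    [set` J] `<=` D -> (forall i, measurable (B i)) ->
    P (\bigcap_(i in [set` J]) (X i @^-1` B i)) =
    (\prod_(i <- J) P (X i @^-1` B i))%E.

(* Measurability is part of the definition since [\int] is also defined, with
   no probabilistic meaning, for functions that are not measurable. *)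
Definition converges_weakly (R : realType) d (T : measurableType d)
    (P : probability T R) (X : nat -> T -> R)
    (nu : set R -> \bar R) : Prop :=
  (forall n, measurable_fun setT (X n)) /\
  forall f : R -> R, continuous f -> (exists M : R, forall y, `|f y| <= M) ->
    (\int[P]_x (f (X n x))%:E)%E @[n --> \oo] --> (\int[nu]_y (f y)%:E)%E.

(* The degenerate case s = 0 is excluded: [normal_prob m 0] is by convention
   the uniform law on [0, 1]. *)
Definition asymptotically_normal (R : realType) d (T : measurableType d)
    (P : probability T R) (X : nat -> T -> R) : Prop :=
  exists m s : R, 0 < s /\ converges_weakly P X (normal_prob m s).

Definition lattice (d : nat) := d.-tuple int.

(* u(d), the last coordinate of u *)
Definition height d (u : lattice d) : int := last 0 u.

Definition l1dist d (u v : lattice d) : nat :=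
  (\sum_(i < d) `|tnth u i - tnth v i|)%N.

Definition cube d (n : nat) : set (lattice d) :=
  [set u | forall i, 1 <= tnth u i <= n%:Z].

(* {0, 1}^(Z^d) with the product sigma-algebra *)
Definition cylinders d : set (set (lattice d -> bool)) :=
  [set A | exists u (B : set bool), A = [set w | B (w u)]].

Definition config d := g_sigma_algebraType (@cylinders d).

Definition bernoulli_product (R : realType) d (p : R)
    (P : probability (config d) R) : Prop :=
  mutually_independent P setT (fun (u : lattice d) (w : config d) => w u) /\
  forall u : lattice d, P [set w | w u] = p%:E.

Definition arcs d : set (lattice d * lattice d) :=
  [set a | height a.2 = height a.1 - 1].

(* Members of [U] with an index outside [arcs d] are irrelevant. *)
Definition iid_uniform_arcs (R : realType) d d' (Xi : measurableType d')
    (mu : probability Xi R)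
    (U : lattice d * lattice d -> {RV mu >-> R}) : Prop :=
  mutually_independent mu (@arcs d) (fun a x => U a x) /\
  forall a, arcs a -> forall B : set R, measurable B ->
    distribution mu (U a) B = lebesgue_measure (B `&` `]0, 1]).

Section graph.
Context (R : realType) (d : nat).
Variables (w : lattice d -> bool) (U : lattice d * lattice d -> R).
Implicit Types (u v : lattice d) (e : {fset lattice d}).

Definition open_below u : set (lattice d) :=
  [set v | w v /\ height v = height u - 1].

(* N_u *)
Definition nearest u : set (lattice d) :=
  [set v | open_below u v /\
           forall v', open_below u v' -> (l1dist u v <= l1dist u v')%N].

(* h(u); the default value u is taken only when N_u is empty, and ties in U
   are broken by choice: both happen with probability 0. *)
Definition ancestor u : lattice d :=
  xget u [set v | nearest u v /\
                  forall v', nearest u v' -> U (u, v) <= U (u, v')].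

(* An undirected edge is the set of its end vertices. *)
Definition edges : set {fset lattice d} :=
  [set e | exists2 u, w u & e = [fset u; ancestor u]%fset].

Definition has_degree (k : nat) u : Prop :=
  ([set e | edges e /\ u \in e] #= `I_k)%card.

Definition has_length (l : nat) e : Prop :=
  exists u v, e = [fset u; v]%fset /\ l1dist u v = l.

Definition degree_count (k n : nat) : nat :=
  #|` fset_set [set u | [/\ w u, cube n u & has_degree k u]]|.

Definition length_count (l n : nat) : nat :=
  #|` fset_set [set e | [/\ edges e, has_length l e &
                         exists u, [/\ u \in e, w u & cube n u]]]|.

End graph.

(* Main.v *)
(* Up to null events and a boundary layer, both counts are sums over the sites
   u of a cube of variables X u that are translates of one function of the
   independent field (omega, U) and that, up to an L1 error decaying faster
   than any given power of r, depend only on the coordinates within distance r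
   of u: if every horizontal half-line from u contains an open site within
   distance m, then a vertex further away cannot choose u.

   For such sums, truncate X at range M and cut the cube into blocks separated
   by corridors of width 2M. The block sums are i.i.d., so that their smooth
   statistics are Gaussian up to a small error by Lindeberg replacement, while
   the discarded part has variance at most e(M) n^d with e(M) -> 0. Letting
   n -> oo and then M -> oo, the normalized standard deviations converge and
   the normalized sums converge to a normal law, provided that the limiting
   variance is positive.

   For positivity, prescribe the state of every vertex near z other than z in
   such a way that opening z increases the count by exactly one, and let A_z be
   this event. The functions g_z = 1_(A_z) (omega(z) - p) have a covariance
   with the count that is positive and independent of z, and the variance of
   the sum of the g_z is O(n^d), because these functions are local. By
   Cauchy-Schwarz the variance of the count is at least c n^d. *)

Require Import Defs.
From HB Require Import structures.
From mathcomp Require Import all_boot all_order all_algebra finmap.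
From mathcomp Require Import all_classical all_reals all_analysis.
From mathcomp Require Import measurable_realfun ring lra zify.
Set Implicit Arguments.
Unset Strict Implicit.
Unset Printing Implicit Defensive.
Import Order.TTheory GRing.Theory Num.Theory.
Import numFieldNormedType.Exports.
Local Open Scope classical_set_scope.
Local Open Scope ring_scope.

(** * Bounded random variables *)

(** The configuration and the labels are encoded as one field of real coordinates, and independence
    is used mostly in one form: resampling the coordinates outside a set ([mix]) preserves the law.
    The choice made by [ancestor] at ties does not commute with translations, so degrees are counted
    through strict minimizers ([child]), which are exactly translation covariant and agree with the
    graph off the null event of ties; lengths depend only on the distance to the set of nearest
    vertices, where ties do not matter. No Gaussian variable is added to the probability space:
    Gaussian averaging acts on the test function, and the class [taylor3] of test functions is
    stable under it with the same constant, which lets the replacement argument run by induction.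
    The limiting variance is never written as a series of covariances: for a fixed range the
    standard deviations converge, and closeness in L2 makes the whole sequence Cauchy. The decay
    exponent 4d is used twice: 2d powers sum covariances over the lattice, and 2d powers make the
    truncation error small. *)

Section bounded_measurable.
Context (R : realType) d (T : measurableType d).
Implicit Types f g : T -> R.

(** Nearly everything integrated below is of this kind: the class is an algebra and is integrable
    under every probability, so expectations carry no integrability conditions. Unbounded integrands
    are needed only for the Gaussian moments. *)
Definition bdm f := measurable_fun setT f /\ exists M, forall x, `|f x| <= M.

Lemma bdm_cst (c : R) : bdm (fun=> c).
Proof. by split; [exact: measurable_cst | exists `|c|]. Qed.

Lemma bdmD f g : bdm f -> bdm g -> bdm (fun x => f x + g x).
Proof.
move=> [mf [M fM]] [mg [N gN]]; split; first exact: measurable_funD.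
by exists (M + N) => x; apply: (le_trans (ler_normD _ _)); apply: lerD.
Qed.

Lemma bdmM f g : bdm f -> bdm g -> bdm (fun x => f x * g x).
Proof.
move=> [mf [M fM]] [mg [N gN]]; split; first exact: measurable_funM.
by exists (M * N) => x; rewrite normrM; apply: ler_pM.
Qed.

Lemma bdmN f : bdm f -> bdm (fun x => - f x).
Proof.
move=> [mf [M fM]]; split; first exact: measurableT_comp.
by exists M => x; rewrite normrN.
Qed.

Lemma bdmB f g : bdm f -> bdm g -> bdm (fun x => f x - g x).
Proof. by move=> bf bg; apply: bdmD => //; exact: bdmN. Qed.

Lemma bdmZ c f : bdm f -> bdm (fun x => c * f x).
Proof. by move=> bf; apply: bdmM => //; exact: bdm_cst. Qed.

Lemma bdmX n f : bdm f -> bdm (fun x => f x ^+ n).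
Proof.
move=> bf; elim: n => [|n IH]; first exact: bdm_cst.
by under eq_fun do rewrite exprS; exact: bdmM.
Qed.

Lemma bdm_norm f : bdm f -> bdm (fun x => `|f x|).
Proof.
move=> [mf [M fM]]; split; first exact: measurableT_comp.
by exists M => x; rewrite normr_id.
Qed.

Lemma bdm_sum (I : Type) (r : seq I) (P : pred I) (F : I -> T -> R) :
  (forall i, bdm (F i)) -> bdm (fun x => \sum_(i <- r | P i) F i x).
Proof.
move=> bF; elim: r => [|i r IH].
  by under eq_fun do rewrite big_nil; exact: bdm_cst.
under eq_fun do rewrite big_cons; case: (P i) => //.
exact: bdmD.
Qed.

Lemma bdm_bool (b : T -> bool) : measurable [set x | b x] ->
  bdm (fun x => (b x)%:R).
Proof.
move=> mb; have -> : (fun x => (b x)%:R) = \1_[set x | b x] :> (T -> R).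
  apply/funext => x; rewrite indicE.
  by case: (boolP (b x)) => bx; [rewrite mem_set | rewrite memNset//=; exact/negP].
split; first exact: measurable_indic.
by exists 1 => x; rewrite indicE; case: (_ \in _); rewrite ?normr1 ?normr0.
Qed.

End bounded_measurable.

Lemma bdm_comp (R : realType) d d' (T : measurableType d) (T' : measurableType d')
    (f : T' -> R) (phi : T -> T') :
  measurable_fun setT phi -> bdm f -> bdm (f \o phi).
Proof.
by move=> mphi [mf [M fM]]; split; [exact: measurableT_comp | exists M => x /=].
Qed.

(** * Expectation, covariance and the L2 norm *)

Section expectation.
Context (R : realType) d (T : measurableType d) (P : probability T R).
Implicit Types f g : T -> R.

Definition Ex f : R := \int[P]_x f x.

Lemma bdm_integrable f : bdm f -> P.-integrable setT (EFin \o f).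
Proof.
move=> [mf [M fM]]; apply: measurable_bounded_integrable => //.
  by rewrite [ltLHS](_ : _ = 1%E) ?ltry//; exact: probability_setT.
by exists M; split; rewrite ?num_real// => x Mx y _ /=; rewrite (le_trans (fM y))// ltW.
Qed.

Lemma Ex_fin f : bdm f -> (\int[P]_x (f x)%:E)%E = (Ex f)%:E.
Proof.
by move=> bf; rewrite fineK//; apply: integrable_fin_num => //; exact: bdm_integrable.
Qed.

Lemma eq_Ex f g : f =1 g -> Ex f = Ex g.
Proof. by move=> fg; congr Ex; apply/funext. Qed.

Lemma ExD f g : bdm f -> bdm g -> Ex (fun x => f x + g x) = Ex f + Ex g.
Proof. by move=> bf bg; apply: RintegralD => //; exact: bdm_integrable. Qed.

Lemma ExZ c f : bdm f -> Ex (fun x => c * f x) = c * Ex f.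
Proof. by move=> bf; apply: RintegralZl => //; exact: bdm_integrable. Qed.

Lemma ExB f g : bdm f -> bdm g -> Ex (fun x => f x - g x) = Ex f - Ex g.
Proof. by move=> bf bg; apply: RintegralB => //; exact: bdm_integrable. Qed.

Lemma Ex_cst c : Ex (fun=> c) = c.
Proof.
rewrite /Ex Rintegral_cst//.
rewrite [X in fine X](_ : _ = 1%E) ?mulr1//; exact: probability_setT.
Qed.

Lemma Ex_sum (I : Type) (r : seq I) (S : pred I) (F : I -> T -> R) :
  (forall i, bdm (F i)) ->
  Ex (fun x => \sum_(i <- r | S i) F i x) = \sum_(i <- r | S i) Ex (F i).
Proof.
move=> bF; elim: r => [|i r IH].
  by under eq_Ex do rewrite big_nil; rewrite Ex_cst big_nil.
under eq_Ex do rewrite big_cons; rewrite big_cons; case: (S i) => //.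
by rewrite ExD//; [rewrite IH | exact: bdm_sum].
Qed.

Lemma le_Ex f g : bdm f -> bdm g -> (forall x, f x <= g x) -> Ex f <= Ex g.
Proof. by move=> bf bg fg; apply: le_Rintegral => //; exact: bdm_integrable. Qed.

Lemma Ex_ge0 f : (forall x, 0 <= f x) -> 0 <= Ex f.
Proof. by move=> f0; apply: Rintegral_ge0. Qed.

Lemma norm_Ex f : bdm f -> `|Ex f| <= Ex (fun x => `|f x|).
Proof. by move=> bf; apply: le_normr_Rintegral => //; exact: bdm_integrable. Qed.

Lemma Ex_bound f M : bdm f -> (forall x, `|f x| <= M) -> `|Ex f| <= M.
Proof.
move=> bf fM; apply: (le_trans (norm_Ex bf)); rewrite -[leRHS]Ex_cst.
by apply: le_Ex => //; [exact: bdm_norm | exact: bdm_cst].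
Qed.

Lemma le_Ex_dist f g h : bdm f -> bdm g -> bdm h ->
  (forall x, `|f x - g x| <= h x) -> `|Ex f - Ex g| <= Ex h.
Proof.
move=> bf bg bh fgh; rewrite -ExB//; apply: (le_trans (norm_Ex (bdmB bf bg))).
by apply: le_Ex => //; apply: bdm_norm; exact: bdmB.
Qed.

Lemma Ex_bool (b : T -> bool) : measurable [set x | b x] ->
  Ex (fun x => (b x)%:R) = fine (P [set x | b x]).
Proof.
move=> mb; rewrite /Ex.
have -> : (fun x => (b x)%:R) = \1_[set x | b x] :> (T -> R).
  apply/funext => x; rewrite indicE.
  by case: (boolP (b x)) => bx; [rewrite mem_set | rewrite memNset//=; exact/negP].
by rewrite /Rintegral integral_indic// setIT.
Qed.

Lemma cauchy_schwarz f g : bdm f -> bdm g ->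
  Ex (fun x => f x * g x) ^+ 2 <= Ex (fun x => f x ^+ 2) * Ex (fun x => g x ^+ 2).
Proof.
move=> bf bg; set b := Ex _; set a := Ex _; set c := Ex _.
have a0 : 0 <= a by apply: Ex_ge0 => x; exact: sqr_ge0.
have c0 : 0 <= c by apply: Ex_ge0 => x; exact: sqr_ge0.
have q t : 0 <= a + 2 * t * b + t ^+ 2 * c.
  rewrite /a /b /c.
  have bfg := bdmM bf bg; have bf2 := bdmX 2 bf; have bg2 := bdmX 2 bg.
  rewrite -!ExZ// -!ExD//; try by do ?[apply: bdmD | apply: bdmZ].
  apply: Ex_ge0 => x.
  have -> : f x ^+ 2 + 2 * t * (f x * g x) + t ^+ 2 * g x ^+ 2 = (f x + t * g x) ^+ 2 by ring.
  exact: sqr_ge0.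
have [c00|cn0] := eqVneq c 0.
  rewrite c00 mulr0; have [->|bn0] := eqVneq b 0; first by rewrite expr0n.
  (* With c = 0 the quadratic is affine in t, and this t gives it the value -1. *)
  have := q (- (a + 1) / (2 * b)); rewrite c00 mulr0 addr0.
  have -> : a + 2 * (- (a + 1) / (2 * b)) * b = -1 by field.
  by rewrite ler0N1.
have cp : 0 < c by rewrite lt_def cn0.
have := q (- b / c); have -> : a + 2 * (- b / c) * b + (- b / c) ^+ 2 * c = (a * c - b ^+ 2) / c.
  by field.
by rewrite pmulr_lge0 ?invr_gt0// subr_ge0.
Qed.

Definition L2 f := Num.sqrt (Ex (fun x => f x ^+ 2)).

Lemma L2_ge0 f : 0 <= L2 f. Proof. exact: sqrtr_ge0. Qed.

Lemma L2_sqr f : L2 f ^+ 2 = Ex (fun x => f x ^+ 2).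
Proof. by rewrite sqr_sqrtr//; apply: Ex_ge0 => x; exact: sqr_ge0. Qed.

Lemma Ex_le_L2 f g : bdm f -> bdm g -> `|Ex (fun x => f x * g x)| <= L2 f * L2 g.
Proof.
move=> bf bg; rewrite -(@ler_pXn2r _ 2)// ?nnegrE ?mulr_ge0 ?L2_ge0//.
by rewrite exprMn !L2_sqr real_normK ?num_real// cauchy_schwarz.
Qed.

Lemma L1_le_L2 f : bdm f -> Ex (fun x => `|f x|) <= L2 f.
Proof.
move=> bf; have := Ex_le_L2 (bdm_norm bf) (@bdm_cst R _ T 1).
have -> : L2 (fun x => `|f x|) = L2 f.
  by congr Num.sqrt; apply: eq_Ex => x; rewrite real_normK// num_real.
have -> : L2 (fun=> 1) = 1.
  by rewrite /L2; under eq_Ex do rewrite expr1n; rewrite Ex_cst sqrtr1.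
rewrite mulr1; apply: le_trans.
under [X in `|X|]eq_Ex do rewrite mulr1.
exact: ler_norm.
Qed.

Lemma L2_triangle f g : bdm f -> bdm g -> L2 (fun x => f x + g x) <= L2 f + L2 g.
Proof.
move=> bf bg; rewrite -(@ler_pXn2r _ 2)// ?nnegrE ?addr_ge0 ?L2_ge0//.
rewrite sqrrD !L2_sqr.
have -> : Ex (fun x => (f x + g x) ^+ 2) =
    Ex (fun x => f x ^+ 2) + 2 * Ex (fun x => f x * g x) + Ex (fun x => g x ^+ 2).
  have bfg := bdmM bf bg; have bf2 := bdmX 2 bf; have bg2 := bdmX 2 bg.
  rewrite -ExZ// -!ExD//; try by do ?[apply: bdmD | apply: bdmZ].
  by apply: eq_Ex => x; ring.
have := le_trans (ler_norm _) (Ex_le_L2 bf bg).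
by lra.
Qed.

Lemma L2Z c f : bdm f -> L2 (fun x => c * f x) = `|c| * L2 f.
Proof.
move=> bf; rewrite /L2; under eq_Ex do rewrite exprMn.
rewrite ExZ; last exact: bdmX.
by rewrite sqrtrM ?sqr_ge0// sqrtr_sqr.
Qed.

Lemma L2_dist f g : bdm f -> bdm g -> `|L2 f - L2 g| <= L2 (fun x => f x - g x).
Proof.
move=> bf bg; rewrite ler_norml; apply/andP; split.
  have := L2_triangle bf (bdmB bg bf).
  have -> : L2 (fun x => f x + (g x - f x)) = L2 g.
    by congr Num.sqrt; apply: eq_Ex => x; rewrite addrC subrK.
  have -> : L2 (fun x => g x - f x) = L2 (fun x => f x - g x).
    by congr Num.sqrt; apply: eq_Ex => x; rewrite -opprB sqrrN.
  by lra.
have := L2_triangle bg (bdmB bf bg).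
have -> : L2 (fun x => g x + (f x - g x)) = L2 f.
  by congr Num.sqrt; apply: eq_Ex => x; rewrite addrC subrK.
by lra.
Qed.

Definition cov f g := Ex (fun x => f x * g x) - Ex f * Ex g.

Definition var f := cov f f.

Lemma varE f : bdm f -> var f = Ex (fun x => (f x - Ex f) ^+ 2).
Proof.
move=> bf; have bf2 := bdmX 2 bf; set m := Ex f.
have -> : Ex (fun x => (f x - m) ^+ 2) = Ex (fun x => f x ^+ 2 + (-2 * m * f x + m ^+ 2)).
  by apply: eq_Ex => x; ring.
have b1 := bdmZ (-2 * m) bf; have b2 := bdm_cst T (m ^+ 2).
rewrite (ExD bf2 (bdmD b1 b2)) (ExD b1 b2) (ExZ _ bf) Ex_cst.
by rewrite /var /cov -/m; under eq_Ex do rewrite -expr2; ring.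
Qed.

Lemma var_cst c : var (fun=> c) = 0.
Proof. by rewrite /var /cov !Ex_cst subrr. Qed.

Lemma var_ge0 f : bdm f -> 0 <= var f.
Proof. by move=> bf; rewrite varE//; apply: Ex_ge0 => x; exact: sqr_ge0. Qed.

Lemma bdm_center f : bdm f -> bdm (fun x => f x - Ex f).
Proof. by move=> bf; apply: bdmB => //; exact: bdm_cst. Qed.

Lemma cov_sum (I J : Type) (r : seq I) (s : seq J) (S : pred I) (S' : pred J)
    (F : I -> T -> R) (G : J -> T -> R) :
  (forall i, bdm (F i)) -> (forall j, bdm (G j)) ->
  cov (fun x => \sum_(i <- r | S i) F i x) (fun x => \sum_(j <- s | S' j) G j x) =
  \sum_(i <- r | S i) \sum_(j <- s | S' j) cov (F i) (G j).
Proof.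
move=> bF bG; rewrite /cov !Ex_sum//.
have -> : Ex (fun x => (\sum_(i <- r | S i) F i x) * (\sum_(j <- s | S' j) G j x)) =
    \sum_(i <- r | S i) \sum_(j <- s | S' j) Ex (fun x => F i x * G j x).
  under eq_Ex do rewrite big_distrl/=.
  rewrite Ex_sum//; last by move=> i; apply: bdmM => //; exact: bdm_sum.
  apply: eq_bigr => i _; under eq_Ex do rewrite big_distrr/=.
  by rewrite Ex_sum// => j; exact: bdmM.
rewrite big_distrl/= -sumrB; apply: eq_bigr => i _.
by rewrite big_distrr/= -sumrB.
Qed.

Lemma cov_center f g : bdm f -> bdm g ->
  cov f g = Ex (fun x => (f x - Ex f) * (g x - Ex g)).
Proof.
move=> bf bg; have bfg := bdmM bf bg; set m := Ex f; set n := Ex g.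
have -> : Ex (fun x => (f x - m) * (g x - n)) =
    Ex (fun x => f x * g x + (- n * f x + (- m * g x + m * n))).
  by apply: eq_Ex => x; ring.
have b1 := bdm_cst T (m * n).
have b2 := bdmZ (- m) bg; have b3 := bdmZ (- n) bf.
rewrite (ExD bfg (bdmD b3 (bdmD b2 b1))) (ExD b3 (bdmD b2 b1)) (ExD b2 b1).
by rewrite (ExZ _ bf) (ExZ _ bg) Ex_cst /cov -/m -/n; ring.
Qed.

Lemma cov_sqr_le f g : bdm f -> bdm g -> cov f g ^+ 2 <= var f * var g.
Proof.
move=> bf bg; rewrite cov_center// !varE//.
by apply: cauchy_schwarz; exact: bdm_center.
Qed.

Lemma ae_eq_Ex f g : bdm f -> bdm g ->
  P.-negligible [set x | f x <> g x] -> Ex f = Ex g.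
Proof.
move=> [mf _] [mg _] fg; congr fine; apply: ae_eq_integral => //.
- exact/measurable_EFinP.
- exact/measurable_EFinP.
- apply: negligibleS fg => x /=; apply: contra_not => fgx _; by rewrite fgx.
Qed.

End expectation.

Lemma Ex_transfer (R : realType) d d' (T : measurableType d) (T' : measurableType d')
    (P : probability T R) (P' : probability T' R) (phi : T -> T') (f : T' -> R) :
  measurable_fun setT phi ->
  (forall A, measurable A -> P (phi @^-1` A) = P' A) -> bdm f ->
  Ex P' f = Ex P (f \o phi).
Proof.
move=> mphi PP' bf; rewrite /Ex /Rintegral; congr fine.
transitivity (\int[pushforward P phi]_y (f y)%:E)%E.
  by apply: eq_measure_integral => A mA _; apply/esym; exact: PP'.
rewrite integral_pushforward//=.
- by apply/measurable_EFinP; case: bf.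
- rewrite preimage_setT; exact: (bdm_integrable P (bdm_comp mphi bf)).
Qed.

Lemma Ex_fubini (R : realType) d d' (T : measurableType d) (T' : measurableType d')
    (P : probability T R) (P' : probability T' R) (f : T * T' -> R) : bdm f ->
  bdm (fun y => Ex P (fun x => f (x, y))) /\
  Ex (P \x P')%E f = Ex P' (fun y => Ex P (fun x => f (x, y))).
Proof.
move=> bf; have [mf [M fM]] := bf.
have sec y : bdm (fun x => f (x, y)).
  by split; [exact: measurableT_comp mf (measurable_pair2 _) | exists M].
have intf := bdm_integrable (P \x P')%E bf.
have EE : (fun y => (Ex P (fun x => f (x, y)))%:E) =
    (fun y => \int[P]_x (f (x, y))%:E)%E.
  by apply/funext => y; rewrite Ex_fin.
split; last first.
  rewrite [LHS]/Ex /Rintegral; congr fine.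
  by have := integral21_prod_meas1 intf; rewrite /fubini_G /= -EE => ->.
split; last by exists M => y; apply: Ex_bound.
apply/measurable_EFinP; rewrite /comp EE.
exact: (measurable_fubini_G intf).
Qed.

(** * Fields of independent coordinates *)

Section product_space.
Context (R : realType) (I : choiceType).
Implicit Types (A : pred I) (J : {fset I}) (B : I -> set R).

Definition coordinate_sets : set (set (I -> R)) :=
  [set C | exists i (B : set R), measurable B /\ C = [set x | B (x i)]].

Definition field := g_sigma_algebraType coordinate_sets.

Definition box_event J B : set field :=
  \bigcap_(i in [set` J]) [set x : field | B i (x i)].

Lemma measurable_coord i : measurable_fun setT (fun x : field => x i).
Proof.
move=> _ B mB; rewrite setTI.
by apply: sub_sigma_algebra; exists i, B.
Qed.

Lemma measurable_to_field d (T : measurableType d) (phi : T -> field) :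
  (forall i, measurable_fun setT (fun t => phi t i)) -> measurable_fun setT phi.
Proof.
move=> mphi; apply: (@measurability _ _ _ _ setT phi coordinate_sets) => //.
move=> _ [_ [i [B [mB ->]] <-]].
by rewrite setTI; have := mphi i measurableT B mB; rewrite setTI.
Qed.

Lemma measurable_box_event J B : (forall i, measurable (B i)) ->
  measurable (box_event J B).
Proof.
move=> mB; apply: fin_bigcap_measurable => //= i _.
by have := @measurable_coord i measurableT (B i) (mB i); rewrite setTI.
Qed.

(** Box events are stable under intersection and generate the sigma-algebra. *)
Lemma field_measure_unique (P P' : probability field R) :
  (forall J B, (forall i, measurable (B i)) ->
    P (box_event J B) = P' (box_event J B)) ->
  forall C, measurable C -> P C = P' C.
Proof.
move=> PP' C mC.
pose G := [set C | exists J B, (forall i, measurable (B i)) /\ C = box_event J B].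
have Gset0 : G setT.
  exists fset0, (fun=> setT); split => //.
  by rewrite /box_event set_fset0 bigcap_set0.
apply: (measure_unique G (fun=> setT)) => //=.
- apply/seteqP; split.
    apply: smallest_sub; first exact: smallest_sigma_algebra.
    move=> _ [i [B [mB ->]]]; apply: sub_gen_smallest.
    exists [fset i]%fset, (fun=> B); split => //.
    by rewrite /box_event set_fset1 bigcap_set1.
  apply: smallest_sub; first exact: sigma_algebra_measurable.
  by move=> _ [J [B [mB ->]]]; exact: measurable_box_event.
- move=> _ _ [J [B [mB ->]]] [J' [B' [mB' ->]]].
  exists (J `|` J')%fset, (fun i => (if i \in J then B i else setT) `&`
    (if i \in J' then B' i else setT)); split.
    by move=> i; apply: measurableI; case: ifP.
  apply/seteqP; split => x /=.
    by move=> [xB xB'] i /= _; split; case: ifP => // iJ; [exact: xB | exact: xB'].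
  by move=> xBB; split => i /= iJ; have := xBB i; rewrite /= inE iJ ?orbT => -[].
- by rewrite bigcup_const//; exists 0%N.
- by move=> _ [J [B [mB ->]]]; exact: PP'.
- by move=> _; rewrite [ltLHS](_ : _ = 1%E) ?ltry//; exact: probability_setT.
Qed.

Definition independent_coordinates (Q : probability field R) :=
  forall J B, (forall i, measurable (B i)) ->
    Q (box_event J B) = (\prod_(i <- J) Q [set x | B i (x i)])%E.

Definition mix A (x y : I -> R) : I -> R := fun i => if A i then x i else y i.

Definition depends_on A (U : Type) (f : (I -> R) -> U) :=
  forall x y, (forall i, A i -> x i = y i) -> f x = f y.

Lemma measurable_mix A :
  measurable_fun setT (fun xy : field * field => mix A xy.1 xy.2 : field).
Proof.
apply: measurable_to_field => i; rewrite /mix; case: (A i).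
  exact: measurableT_comp (measurable_coord i) measurable_fst.
exact: measurableT_comp (measurable_coord i) measurable_snd.
Qed.

Lemma measurable_mixl A (y : I -> R) :
  measurable_fun setT (fun x : field => mix A x y : field).
Proof.
apply: measurable_to_field => i; rewrite /mix; case: (A i) => //.
exact: measurable_coord.
Qed.

(** On a box event each coordinate is drawn from exactly one of two independent copies of the field,
    so both sides are the same product. This resampling identity is the form in which independence
    and conditioning are used below. *)
Lemma field_mix (Q : probability field R) A : independent_coordinates Q ->
  forall C, measurable C ->
    (Q \x Q)%E ((fun xy : field * field => mix A xy.1 xy.2 : field) @^-1` C) = Q C.
Proof.
move=> iQ C mC; pose mm := isMeasurableFun.Build _ _ _ _ _ (measurable_mix A).
pose mfm : {mfun _ >-> _} := HB.pack (fun xy : field * field => mix A xy.1 xy.2 : field) mm.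
apply: (@field_measure_unique (distribution (Q \x Q)%E mfm) Q) => // J B mB.
rewrite /distribution /pushforward.
pose B1 i := if A i then B i else setT; pose B2 i := if A i then setT else B i.
have mB1 i : measurable (B1 i) by rewrite /B1; case: ifP.
have mB2 i : measurable (B2 i) by rewrite /B2; case: ifP.
transitivity ((Q \x Q)%E (box_event J B1 `*` box_event J B2)).
  congr ((Q \x Q)%E _).
  apply/seteqP; split => -[x y] /=.
    by move=> xyB; split => i iJ /=; have := xyB i iJ; rewrite /= /mix /B1 /B2; case: (A i).
  by move=> [xB yB] i iJ; have := xB i iJ; have := yB i iJ; rewrite /= /mix /B1 /B2; case: (A i).
transitivity (Q (box_event J B1) * Q (box_event J B2))%E.
  by apply: product_measure1E; exact: measurable_box_event.
rewrite (iQ J B1 mB1) (iQ J B2 mB2) (iQ J B mB) -big_split/=; apply: eq_bigr => i _.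
have QT : Q [set: field] = 1%E by exact: probability_setT.
rewrite /B1 /B2; case: (A i).
  by rewrite [X in (_ * Q X)%E](_ : _ = setT) ?QT ?mule1//; apply/seteqP; split.
by rewrite [X in (Q X * _)%E](_ : _ = setT) ?QT ?mul1e//; apply/seteqP; split.
Qed.

Lemma Ex_mix (Q : probability field R) A (f : field -> R) :
  independent_coordinates Q -> bdm f ->
  bdm (fun y : field => Ex Q (fun x : field => f (mix A x y))) /\
  Ex Q f = Ex Q (fun y : field => Ex Q (fun x : field => f (mix A x y))).
Proof.
move=> iQ bf.
have bfm := bdm_comp (measurable_mix A) bf.
have [b E] := Ex_fubini Q Q bfm; split => //.
rewrite -E; apply: Ex_transfer => //; first exact: measurable_mix.
exact: field_mix.
Qed.

(** After resampling, [f] sees only the first copy and [g] only the second, so the double integral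
    factors. *)
Lemma Ex_indep (Q : probability field R) A (f g : field -> R) :
  independent_coordinates Q -> bdm f -> bdm g ->
  depends_on A f -> depends_on (predC A) g ->
  Ex Q (fun x => f x * g x) = Ex Q f * Ex Q g.
Proof.
move=> iQ bf bg fA gA.
rewrite (Ex_mix A iQ (bdmM bf bg)).2 -ExZ//; apply: eq_Ex => y.
rewrite mulrC -ExZ//; apply: eq_Ex => x.
rewrite mulrC (fA _ x) ?(gA _ y)// => i; rewrite /= /mix; first by case: (A i).
by move=> ->.
Qed.

Lemma cov_indep (Q : probability field R) A (f g : field -> R) :
  independent_coordinates Q -> bdm f -> bdm g ->
  depends_on A f -> depends_on (predC A) g -> cov Q f g = 0.
Proof. by move=> iQ bf bg fA gA; rewrite /cov (Ex_indep iQ bf bg fA gA) subrr. Qed.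

Lemma Ex_reindex (Q : probability field R) (tau tau' : I -> I) (f : field -> R) :
  independent_coordinates Q -> cancel tau tau' -> 
  (forall i (B : set R), measurable B ->
    Q [set x | B (x (tau i))] = Q [set x | B (x i)]) ->
  bdm f -> Ex Q (fun x : field => f (x \o tau)) = Ex Q f.
Proof.
move=> iQ tK Qt bf.
have mt : measurable_fun setT (fun x : field => x \o tau : field).
  by apply: measurable_to_field => i; exact: measurable_coord.
symmetry; apply: (@Ex_transfer _ _ _ _ _ _ _ (fun x : field => x \o tau : field)) => //.
move=> C mC; pose mm := isMeasurableFun.Build _ _ _ _ _ mt.
pose mft : {mfun _ >-> _} := HB.pack (fun x : field => x \o tau : field) mm.
apply: (@field_measure_unique (distribution Q mft) Q) => // J B mB.
rewrite /distribution /pushforward.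
transitivity (Q (box_event [fset tau i | i in J]%fset (B \o tau'))).
  congr (Q _); apply/seteqP; split => x /= xB i /=.
    by case/imfsetP => j /= jJ ->; rewrite tK; exact: xB.
  move=> iJ; have := xB (tau i); rewrite /= tK; apply.
  by apply/imfsetP; exists i.
rewrite !iQ//; last by move=> i; exact: mB.
rewrite big_imfset/=; last by move=> i j _ _; exact: (can_inj tK).
by apply: eq_bigr => i _; rewrite tK Qt.
Qed.

End product_space.

(** * Variance of sums of nearly local variables *)

Section inverse_square_sums.
Context (R : realType).

(** The right side is 2 / ((k+1)(k+2)), and k + 2 <= 2 (k+1). *)
Lemma inv_sqr_telescope (k : nat) :
  (k.+1%:R ^+ 2)^-1 <= 2 / k.+1%:R - 2 / k.+2%:R :> R.
Proof.
have -> : 2 / k.+1%:R - 2 / k.+2%:R = 2 / (k.+1%:R * k.+2%:R) :> R.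
  have a0 : k.+1%:R != 0 :> R by rewrite pnatr_eq0.
  have b0 : k.+2%:R != 0 :> R by rewrite pnatr_eq0.
  move: b0; rewrite -[k.+2%:R]natr1; move: (k.+1%:R) a0 => a a0 b0.
  by field; rewrite a0 b0.
rewrite ler_pdivlMr ?mulr_gt0 ?ltr0n// mulrC ler_pdivrMr ?exprn_gt0 ?ltr0n//.
by rewrite -natrM -natrX -natrM ler_nat; nia.
Qed.

Lemma sum_inv_sqr_dist (a N : nat) :
  \sum_(j < N) (`|a%:Z - j%:Z|%N.+1%:R ^+ 2)^-1 <= 4 :> R.
Proof.
pose g k : R := (k.+1%:R ^+ 2)^-1.
have g0 k : 0 <= g k by rewrite invr_ge0 exprn_ge0// ler0n.
(* The terms on either side of [a] telescope separately, and each side contributes at most 2. *)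
have L M : \sum_(j < M) (if (j < a)%N then g (a - j)%N else 0) <= 2 / (a - M).+2%:R.
  elim: M => [|M IH]; first by rewrite big_ord0 divr_ge0// ler0n.
  rewrite big_ord_recr/=; case: ltnP => Ma; last first.
    by rewrite addr0; move: IH; have -> : (a - M.+1 = a - M)%N by lia.
  have := inv_sqr_telescope (a - M); rewrite -/(g (a - M)%N).
  have -> : ((a - M.+1).+2 = (a - M).+1)%N by lia.
  by move=> tel; apply: (le_trans (lerD IH tel)); rewrite addrC subrK.
have U M : \sum_(j < M) (if (a <= j)%N then g (j - a)%N else 0) <= 2 - 2 / (M - a).+1%:R.
  elim: M => [|M IH]; first by rewrite big_ord0 sub0n divr1 subrr.
  rewrite big_ord_recr/=; case: leqP => Ma; last first.
    by rewrite addr0; move: IH; have -> : (M.+1 - a = M - a)%N by lia.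
  have := inv_sqr_telescope (M - a); rewrite -/(g (M - a)%N).
  have -> : (M.+1 - a = (M - a).+1)%N by lia.
  move=> tel; apply: (le_trans (lerD IH tel)).
  by rewrite addrA subrK.
have -> : \sum_(j < N) (`|a%:Z - j%:Z|%N.+1%:R ^+ 2)^-1 =
    \sum_(j < N) (if (j < a)%N then g (a - j)%N else 0) +
    \sum_(j < N) (if (a <= j)%N then g (j - a)%N else 0) :> R.
  rewrite -big_split/=; apply: eq_bigr => j _; rewrite /g.
  by case: (ltnP j a) => ja; rewrite ?addr0 ?add0r; congr (_.+1%:R ^+ 2)^-1; lia.
have l2 : 2 / (a - N).+2%:R <= 2 :> R.
  by rewrite ler_pdivrMr ?ltr0n// ler_peMr// ler1n.
have u2 : 0 <= 2 / (N - a).+1%:R :> R by rewrite divr_ge0// ler0n.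
apply: (le_trans (lerD (L N) (U N))).
move: (2 / (a - N).+2%:R) (2 / (N - a).+1%:R) l2 u2 => x y.
lra.
Qed.

Lemma sum_prod_inv_sqr_dist (d N : nat) (f : {ffun 'I_d -> 'I_N}) :
  \sum_(g : {ffun 'I_d -> 'I_N})
     \prod_(i < d) (`|(f i)%:Z - (g i)%:Z|%N.+1%:R ^+ 2)^-1 <= 4 ^+ d :> R.
Proof.
rewrite -(bigA_distr_bigA (fun i j => (`|(f i)%:Z - (nat_of_ord j)%:Z|%N.+1%:R ^+ 2)^-1)).
rewrite -[leRHS](_ : \prod_(i < d) 4 = _); last by rewrite prodr_const card_ord.
apply: ler_prod => i _; rewrite sum_inv_sqr_dist andbT.
by apply: sumr_ge0 => j _; rewrite invr_ge0 exprn_ge0// ler0n.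
Qed.

End inverse_square_sums.

Section lattice.
Context (d : nat).
Implicit Types u v : lattice d.

(* [inl u] is the index of omega(u), [inr (u, v)] that of U_(u,v). *)
Definition index : choiceType := (lattice d + lattice d * lattice d)%type.

(** A label is located at the upper end of its arc, the vertex that makes the choice. *)
Definition site (i : index) : lattice d :=
  match i with inl u => u | inr a => a.1 end.

Definition near (r : nat) u v : bool :=
  [forall i, (`|tnth u i - tnth v i| <= r)%N].

Definition inball u (r : nat) : pred index := fun i => near r u (site i).

(** Instead of conditioning on the coordinates in [A], the others are frozen at 0, which for a site
    means closed; the truncated function is then measurable and depends on [A] by construction. *)
Definition trunc (R : realType) (A : pred index) (x : index -> R) : index -> R :=
  mix A x (fun=> 0).

Lemma depends_on_trunc (R : realType) (A : pred index) (U : Type)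
    (f : (index -> R) -> U) : depends_on A (fun x => f (trunc A x)).
Proof.
move=> x y xy /=; congr f; apply/funext => i; rewrite /trunc /mix.
by case: ifP => // /xy.
Qed.

Lemma nearP (r : nat) u v :
  reflect (forall i, `|tnth u i - tnth v i| <= r)%N (near r u v).
Proof. exact: forallP. Qed.

Definition pt (N : nat) (o : int) (f : {ffun 'I_d -> 'I_N}) : lattice d :=
  [tuple o + (f i)%:Z | i < d].

Lemma tnth_pt N o (f : {ffun 'I_d -> 'I_N}) i : tnth (pt o f) i = o + (f i)%:Z.
Proof. by rewrite tnth_mktuple. Qed.

Lemma pt_inj N o : injective (@pt N o).
Proof.
move=> f g /(congr1 (fun t => tnth t)) fg; apply/ffunP => i; apply: val_inj => /=.
by have := congr1 (fun F => F i) fg; rewrite /= !tnth_pt; lia.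
Qed.

End lattice.

Section covariances.
Context (R : realType) (d : nat).
Notation field := (field R (index d)).
Context (Q : probability field R) (iQ : independent_coordinates Q).

Lemma bdm_trunc (A : pred (index d)) (f : field -> R) : bdm f -> bdm (fun x : field => f (trunc A x)).
Proof.
move=> bf; apply: (bdm_comp (phi := fun x : field => trunc A x : field)) => //.
exact: measurable_mixl.
Qed.

Lemma cov_approx (f g f' g' : field -> R) (a b : R) :
  bdm f -> bdm g -> bdm f' -> bdm g' ->
  (forall x, `|f x| <= 1) -> (forall x, `|g x| <= 1) ->
  (forall x, `|f' x| <= 1) -> (forall x, `|g' x| <= 1) ->
  Ex Q (fun x => `|f x - f' x|) <= a -> Ex Q (fun x => `|g x - g' x|) <= b ->
  `|cov Q f g - cov Q f' g'| <= 2 * (a + b).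
Proof.
move=> bf bg bf' bg' f1 g1 f'1 g'1 fa gb.
have b1 := bdm_norm (bdmB bf bf'); have b2 := bdm_norm (bdmB bg bg').
have E1 : `|Ex Q (fun x => f x * g x) - Ex Q (fun x => f' x * g' x)| <= a + b.
  apply: le_trans (lerD fa gb); rewrite -ExD//.
  apply: le_Ex_dist; [exact: bdmM | exact: bdmM | exact: bdmD |] => x.
  have -> : f x * g x - f' x * g' x = (f x - f' x) * g x + f' x * (g x - g' x) by ring.
  apply: (le_trans (ler_normD _ _)); rewrite !normrM; apply: lerD.
    exact: ler_piMr.
  exact: ler_piMl.
have Ef' : `|Ex Q f'| <= 1 by exact: Ex_bound.
have Eg : `|Ex Q g| <= 1 by exact: Ex_bound.
have E2 : `|Ex Q f * Ex Q g - Ex Q f' * Ex Q g'| <= a + b.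
  have -> : Ex Q f * Ex Q g - Ex Q f' * Ex Q g' =
    (Ex Q f - Ex Q f') * Ex Q g + Ex Q f' * (Ex Q g - Ex Q g') by ring.
  apply: (le_trans (ler_normD _ _)); rewrite !normrM; apply: lerD.
    apply: le_trans fa; apply: (@le_trans _ _ `|Ex Q f - Ex Q f'|).
      exact: ler_piMr.
    by apply: le_Ex_dist.
  apply: le_trans gb; apply: (@le_trans _ _ `|Ex Q g - Ex Q g'|).
    exact: ler_piMl.
  by apply: le_Ex_dist.
rewrite /cov mulrDl mul1r -/(_ + _).
have -> : forall p q r s : R, p - q - (r - s) = (p - r) - (q - s) by move=> *; ring.
by apply: (le_trans (ler_normB _ _)); exact: lerD.
Qed.

Lemma cov_disjoint (A B : pred (index d)) (f g : field -> R) :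
  bdm f -> bdm g -> (forall i, ~~ (A i && B i)) ->
  depends_on A f -> depends_on B g -> cov Q f g = 0.
Proof.
move=> bf bg AB fA gB; apply: (cov_indep (A := A)) => // x y xy; apply: gB => i Bi.
by apply: xy; have := AB i; rewrite /= Bi andbT.
Qed.

(** Two truncated variables read disjoint balls once the radius is below half the distance of their
    sites, hence are uncorrelated; so covariances decay like the power -2d of the distance. The
    bound is linear in [a], which is why a small L1 error later gives a small variance. *)
Lemma var_sum_le (N : nat) (o : int) (P : pred {ffun 'I_d -> 'I_N})
    (D : {ffun 'I_d -> 'I_N} -> field -> R) (a : R) :
  (forall f, bdm (D f)) -> (forall f x, `|D f x| <= 1) ->
  (forall f, Ex Q (fun x => `|D f x|) <= a) ->
  (forall f r, Ex Q (fun x : field => `|D f x - D f (trunc (inball (pt o f) r) x)|)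
     <= a / r.+1%:R ^+ (2 * d)) ->
  var Q (fun x => \sum_(f | P f) D f x) <= 4 * 36 ^+ d * a * #|P|%:R.
Proof.
move=> bD D1 Da Dr.
have a0 (f : {ffun 'I_d -> 'I_N}) : 0 <= a.
  by apply: le_trans (Da f); exact: Ex_ge0.
have covfg f g : cov Q (D f) (D g) <=
    4 * 9 ^+ d * a * \prod_(i < d) (`|(f i)%:Z - (g i)%:Z|%N.+1%:R ^+ 2)^-1.
  (* The decay in the sup distance K is weakened to a product over coordinates, whose sum over the
     lattice factors into one-dimensional sums. *)
  pose K := \max_(i < d) `|(f i)%:Z - (g i)%:Z|%N.
  have fgK i : (`|(f i)%:Z - (g i)%:Z|%N <= K)%N by exact: leq_bigmax.
  have prodK : (K.+1%:R ^+ (2 * d))^-1 <=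
      \prod_(i < d) (`|(f i)%:Z - (g i)%:Z|%N.+1%:R ^+ 2)^-1 :> R.
    rewrite exprM -exprVn.
    rewrite [leLHS](_ : _ = \prod_(i < d) (K.+1%:R ^+ 2)^-1); last first.
      by rewrite prodr_const card_ord.
    apply: ler_prod => i _; rewrite invr_ge0 exprn_ge0 ?ler0n//=.
    rewrite lef_pV2 ?posrE ?exprn_gt0 ?ltr0n//.
    by rewrite ler_pXn2r ?nnegrE ?ler0n// ler_nat ltnS.
  apply: (@le_trans _ _ (4 * 9 ^+ d * a * (K.+1%:R ^+ (2 * d))^-1)); last first.
    by apply: ler_wpM2l => //; rewrite !mulr_ge0// ?exprn_ge0// (a0 f).
  have [K0|K0] := posnP K.
    rewrite K0 expr1n invr1 mulr1.
    apply: (@le_trans _ _ (2 * (a + a))).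
      have := @cov_approx (D f) (D g) (fun=> 0) (fun=> 0) a a (bD f) (bD g)
        (bdm_cst _ 0) (bdm_cst _ 0) (D1 f) (D1 g).
      have -> : cov Q (fun=> 0) (fun=> 0) = 0.
        by rewrite /cov; under eq_Ex do rewrite mulr0; rewrite !Ex_cst mulr0 subrr.
      rewrite subr0 => H; apply: le_trans (ler_norm _) _.
      apply: H => // [x|x||]; rewrite ?normr0//.
        by under eq_Ex do rewrite subr0.
      by under eq_Ex do rewrite subr0.
    have -> : 2 * (a + a) = 4 * 1 * a by ring.
    apply: ler_wpM2r; first exact: a0.
    by apply: ler_wpM2l => //; apply: exprn_ege1; rewrite ler1n.
  (* About K / 2: small enough for disjoint balls, yet 3 (r + 1) >= K + 1, whence the factor 9^d. *)
  have [r [rK rK']] : exists r, (K.+1 <= 3 * r.+1)%N /\ (2 * r < K)%N.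
    by exists K.-1./2; have := odd_double_half K.-1; case: odd; lia.
  have [i0 i0K] : exists i0, K = `|(f i0)%:Z - (g i0)%:Z|%N.
    have [d0|dpos] := posnP #|'I_d|.
      exfalso; move: K0; rewrite /K big1// => i.
      by have := card0_eq d0 i; rewrite inE.
    have [i0 E] := @bigop.eq_bigmax _ (fun i : 'I_d => `|(f i)%:Z - (g i)%:Z|%N) dpos.
    by exists i0.
  pose f' := fun x : field => D f (trunc (inball (pt o f) r) x).
  pose g' := fun x : field => D g (trunc (inball (pt o g) r) x).
  have c0 : cov Q f' g' = 0.
    apply: (cov_disjoint (A := inball (pt o f) r) (B := inball (pt o g) r)).
    - exact: bdm_trunc.
    - exact: bdm_trunc.
    - move=> i; apply/negP => /andP[/nearP/(_ i0) + /nearP/(_ i0)].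
      rewrite !tnth_pt; move: rK'; rewrite i0K.
      move: (tnth (site i) i0) (nat_of_ord (f i0)) (nat_of_ord (g i0)) => t a1 b1.
      by lia.
    - exact: depends_on_trunc.
    - exact: depends_on_trunc.
  have H := @cov_approx (D f) (D g) f' g' _ _ (bD f) (bD g) (bdm_trunc _ (bD f))
    (bdm_trunc _ (bD g)) (D1 f) (D1 g) (fun x => D1 f _) (fun x => D1 g _) (Dr f r) (Dr g r).
  rewrite c0 subr0 in H.
  apply: (le_trans (ler_norm _)); apply: (le_trans H).
  have -> : 2 * (a / r.+1%:R ^+ (2 * d) + a / r.+1%:R ^+ (2 * d)) =
    4 * a / r.+1%:R ^+ (2 * d) by ring.
  rewrite -mulrA -[leRHS]mulrA -[leRHS]mulrA ler_pM2l//.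
  rewrite mulrCA; apply: ler_wpM2l; first exact: a0.
  rewrite ler_pdivlMr ?exprn_gt0 ?ltr0n// mulrC ler_pdivrMr ?exprn_gt0 ?ltr0n//.
  rewrite !exprM -exprMn; apply: lerXn2r; rewrite ?nnegrE ?mulr_ge0 ?exprn_ge0 ?ler0n//.
  by rewrite -!natrX -natrM ler_nat; nia.
rewrite /var cov_sum//.
apply: (@le_trans _ _ (\sum_(f | P f) 4 * 36 ^+ d * a)); last first.
  by rewrite sumr_const [leRHS]mulr_natr.
apply: ler_sum => f _.
apply: (@le_trans _ _ (\sum_(g : {ffun 'I_d -> 'I_N})
    4 * 9 ^+ d * a * \prod_(i < d) (`|(f i)%:Z - (g i)%:Z|%N.+1%:R ^+ 2)^-1)).
  rewrite [leRHS](bigID P)/=.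
  apply: (@le_trans _ _ (\sum_(g | P g)
    4 * 9 ^+ d * a * \prod_(i < d) (`|(f i)%:Z - (g i)%:Z|%N.+1%:R ^+ 2)^-1)).
    by apply: ler_sum => g _; exact: covfg.
  rewrite lerDl; apply: sumr_ge0 => g _; rewrite !mulr_ge0 ?exprn_ge0 ?(a0 f)//.
  by apply: prodr_ge0 => i _; rewrite invr_ge0 exprn_ge0// ler0n.
rewrite -mulr_sumr.
have -> : 36 = 9 * 4 :> R by rewrite -natrM.
rewrite exprMn.
have -> : 4 * (9 ^+ d * 4 ^+ d) * a = 4 * 9 ^+ d * a * 4 ^+ d by ring.
apply: ler_wpM2l; first by rewrite !mulr_ge0 ?exprn_ge0 ?(a0 f).
exact: sum_prod_inv_sqr_dist.
Qed.

End covariances.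

(** * Gaussian averages *)

Section density.
Local Open Scope ereal_scope.
Context d (T : measurableType d) (R : realType).
Variables (mu nu : {measure set T -> \bar R}) (g : T -> R).
Hypotheses (mg : measurable_fun setT g) (g0 : forall x, (0 <= g x)%R).
Hypothesis nuE : forall A, measurable A -> nu A = \int[mu]_(x in A) (g x)%:E.

Import HBNNSimple.

(** Monotone approximation by simple functions reduces the claim to indicators, where it is
    [nuE]. *)
Lemma ge0_integral_density (f : T -> \bar R) :
  measurable_fun setT f -> (forall x, 0 <= f x) ->
  \int[nu]_x f x = \int[mu]_x (f x * (g x)%:E).
Proof.
move=> mf f0; pose f_ := nnsfun_approx measurableT mf.
have mgE : measurable_fun setT (EFin \o g) by exact/measurable_EFinP.
transitivity (limn (fun n => \int[nu]_x (f_ n x)%:E)).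
  rewrite -monotone_convergence//.
  - by apply: eq_integral => y _; apply/esym/cvg_lim => //; exact: cvg_nnsfun_approx.
  - by move=> n; exact/measurable_EFinP/measurable_funP.
  - by move=> n y _; rewrite lee_fin.
  - by move=> y _ m n mn; rewrite lee_fin; exact/lefP/nd_nnsfun_approx.
transitivity (limn (fun n => \int[mu]_x ((f_ n x)%:E * (g x)%:E))); last first.
  rewrite -monotone_convergence//.
  - apply: eq_integral => y _; apply/cvg_lim => //.
    under eq_fun do rewrite muleC; rewrite muleC; apply: cvgeZl => //.
    exact: cvg_nnsfun_approx.
  - by move=> n; apply: emeasurable_funM => //; exact/measurable_EFinP/measurable_funP.
  - by move=> n y _; rewrite mule_ge0// lee_fin.
  - move=> y _ m n mn; apply: lee_wpmul2r; rewrite lee_fin//.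
    exact/lefP/nd_nnsfun_approx.
congr (limn _); apply/funext => n.
under eq_integral do rewrite fimfunE -fsumEFin//.
rewrite ge0_integral_fsum//; last 2 first.
- by move=> r; exact/measurable_EFinP/measurable_funM.
- by move=> r x _; rewrite nnfun_muleindic_ge0.
under eq_fsbigr do rewrite integralZl_indic_nnsfun//.
transitivity (\int[mu]_x (\sum_(r \in range (f_ n))
    (r * \1_(f_ n @^-1` [set r]) x)%:E * (g x)%:E)); last first.
  apply: eq_integral => x _; rewrite fimfunE -fsumEFin//.
  rewrite ge0_mule_fsuml// => r; exact: nnfun_muleindic_ge0.
rewrite ge0_integral_fsum//; last 2 first.
- move=> r; apply: emeasurable_funM => //.
  exact/measurable_EFinP/measurable_funM.
- by move=> r x _; rewrite mule_ge0 ?lee_fin//; exact: nnfun_muleindic_ge0.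
apply: eq_fsbigr => r /set_mem -[y _ fy].
rewrite integral_indic// setIT nuE//.
transitivity (r%:E * \int[mu]_x ((\1_(f_ n @^-1` [set r]) x)%:E * (g x)%:E)).
  congr (_ * _); rewrite integral_mkcond; apply: eq_integral => x _.
  rewrite patchE indicE; case: (x \in _); first by rewrite mul1e.
  by rewrite mul0e.
rewrite -ge0_integralZl//.
- by apply: eq_integral => x _; rewrite muleA.
- apply: emeasurable_funM => //; exact/measurable_EFinP.
- by move=> x _; rewrite mule_ge0 ?lee_fin.
- by rewrite lee_fin -fy.
Qed.

End density.

Section normal_law.
Context (R : realType).
Local Notation leb := (@lebesgue_measure R).
Local Notation N01 := (normal_prob (0 : R) 1).

Lemma measurable_affine (m s : R) :
  measurable_fun setT (fun z : measurableTypeR R => m + s * z : measurableTypeR R).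
Proof. by apply: measurable_funD => //; exact: measurable_funM. Qed.

(** By uniqueness of Lebesgue measure: the rescaled image measure gives half-open intervals their
    length. *)
Lemma lebesgue_affine (m s : R) (A : set R) : 0 < s -> measurable A ->
  leb A = (s%:E * leb ((fun z => m + s * z)%R @^-1` A))%E.
Proof.
move=> s0 mA; have sn0 : 0 <= s by exact: ltW.
pose F := (fun z : measurableTypeR R => m + s * z : measurableTypeR R).
pose pm := measure_function_pushforward__canonical__measure_function_Measure
  (@lebesgue_measure R) (measurable_affine m s).
suff H : leb A = mscale (NngNum sn0) pm A by exact: H.
apply: lebesgue_measure_unique => // _ [[a b]] _ <-.
pose J : set R := `](a - m) / s, (b - m) / s]%classic.
transitivity (s%:E * leb J)%E; last first.
  congr (_ * leb _)%E.
  apply/seteqP; rewrite /J /F; split => z /=; rewrite !in_itv/= ltr_pdivrMr// ler_pdivlMr//.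
    by move=> /andP[h1 h2]; apply/andP; split; lra.
  by move=> /andP[h1 h2]; apply/andP; split; lra.
rewrite /J !lebesgue_measure_itv/= !lte_fin ltr_pM2r ?invr_gt0// ltrD2r.
case: ifP => ab; last by rewrite mule0.
by rewrite -!EFinD -EFinM; congr (_%:E); field; rewrite gt_eqF.
Qed.

Lemma normal_pdf_affine (m s z : R) : 0 < s ->
  s * normal_pdf m s (m + s * z) = normal_pdf 0 1 z.
Proof.
move=> s0; rewrite !normal_pdfE ?gt_eqF ?oner_neq0//.
rewrite mulrA; congr (_ * _).
  rewrite /normal_peak expr1n mul1r -mulrnAr sqrtrM ?sqr_ge0// sqrtr_sqr gtr0_norm//.
  by rewrite invfM mulrA divff ?mul1r// gt_eqF.
rewrite /normal_fun; congr expR; rewrite expr1n subr0.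
by field; rewrite gt_eqF.
Qed.

Lemma normal_prob_affine (m s : R) (A : set R) : 0 < s -> measurable A ->
  normal_prob m s A = N01 ((fun z => m + s * z) @^-1` A).
Proof.
move=> s0 mA; have sn0 : 0 <= s by exact: ltW.
have mF := measurable_affine m s.
pose F := (fun z : measurableTypeR R => m + s * z : measurableTypeR R).
pose pm := measure_function_pushforward__canonical__measure_function_Measure
  (@lebesgue_measure R) mF.
rewrite /normal_prob.
transitivity (\int[mscale (NngNum sn0) pm]_(x in A) (normal_pdf m s x)%:E)%E.
  apply: eq_measure_integral => B mB _.
  by rewrite /mscale/= /pushforward (lebesgue_affine m s0).
have mp := measurable_normal_pdf m s.
rewrite ge0_integral_mscale//=; last 2 first.
- by apply: measurable_funTS; exact/measurable_EFinP.
- by move=> x _; rewrite lee_fin normal_pdf_ge0.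
rewrite ge0_integral_pushforward//=; last 2 first.
- by apply: measurable_funTS; exact/measurable_EFinP.
- by move=> x _; rewrite lee_fin normal_pdf_ge0.
have mFA : measurable (F @^-1` A) by have := measurable_affine m s measurableT mA; rewrite setTI.
rewrite -ge0_integralZl//=.
- by apply: eq_integral => z _; rewrite -EFinM normal_pdf_affine.
- apply: measurable_funTS; apply/measurable_EFinP.
  exact: (measurableT_comp mp (measurable_affine m s)).
- by move=> x _; rewrite lee_fin normal_pdf_ge0.
Qed.

Lemma Ex_normal_affine (m s : R) (f : R -> R) : 0 < s -> bdm f ->
  Ex (normal_prob m s) f = Ex N01 (fun z => f (m + s * z)).
Proof.
move=> s0 bf; apply: (Ex_transfer (measurable_affine m s) _ bf) => A mA.
exact/esym/normal_prob_affine.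
Qed.

Lemma N01_sym (A : set R) : measurable A -> N01 (-%R @^-1` A) = N01 A.
Proof.
move=> mA; rewrite /normal_prob.
have mp := measurable_normal_pdf (0 : R) 1.
transitivity (\int[pushforward leb (-%R : _ -> measurableTypeR R)]_(x in A) (normal_pdf 0 1 x)%:E)%E; last first.
  by apply: eq_measure_integral => B mB _; exact: lebesgue_measureN.
rewrite ge0_integral_pushforward; last 4 first.
- by [].
- exact: mA.
- by apply: measurable_funTS; exact/measurable_EFinP.
- by move=> x _ /=; rewrite lee_fin normal_pdf_ge0.
apply: eq_integral => z _; congr (_%:E).
by rewrite !normal_pdfE ?oner_neq0// /normal_fun !subr0 sqrrN.
Qed.

(* Completing the square: the left side is the joint density of (Z, u) for
   u = s Z + t Z', the right side its disintegration over the law of u. *)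
Lemma normal_pdf_convolution (s t z u : R) : 0 < s -> 0 < t ->
  let r := Num.sqrt (s ^+ 2 + t ^+ 2) in
  normal_pdf (s * z) t u * normal_pdf 0 1 z =
  normal_pdf 0 r u * normal_pdf (s * u / r ^+ 2) (t / r) z.
Proof.
move=> s0 t0 r.
have st0 : 0 < s ^+ 2 + t ^+ 2 by rewrite addr_gt0// exprn_gt0.
have r0 : 0 < r by rewrite sqrtr_gt0.
have r2 : r ^+ 2 = s ^+ 2 + t ^+ 2 by rewrite sqr_sqrtr// ltW.
have rn0 : r != 0 by rewrite gt_eqF.
have tn0 : t != 0 by rewrite gt_eqF.
have trn0 : t / r != 0 by rewrite mulf_neq0// invr_eq0.
rewrite !normal_pdfE ?oner_neq0// -!mulrA.
have pk (a : R) : 0 < a -> normal_peak a = a^-1 * normal_peak 1.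
  move=> a0; rewrite /normal_peak expr1n mul1r -mulrnAr sqrtrM ?sqr_ge0//.
  by rewrite sqrtr_sqr gtr0_norm// invfM.
rewrite (pk t)// (pk r)// (pk (t / r)) ?divr_gt0//.
rewrite /normal_fun.
have key : expR (- (u - s * z) ^+ 2 / (t ^+ 2 *+ 2)) * expR (- (z - 0) ^+ 2 / (1 ^+ 2 *+ 2)) =
   expR (- (u - 0) ^+ 2 / (r ^+ 2 *+ 2)) * expR (- (z - s * (u / r ^+ 2)) ^+ 2 / ((t / r) ^+ 2 *+ 2)).
  rewrite -!expRD; congr expR.
  have -> : (t / r) ^+ 2 = t ^+ 2 / r ^+ 2 by rewrite exprMn exprVn.
  rewrite r2; field.
  by rewrite tn0 -r2 expf_neq0.
move: key; move: (expR _) (expR _) (expR _) (expR _) => e1 e2 e3 e4 key.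
transitivity (t^-1 * normal_peak 1 ^+ 2 * (e4 * e3)); first by ring.
by rewrite key; field; rewrite rn0 tn0.
Qed.

End normal_law.

Section gaussian_semigroup.
Context (R : realType).
Local Notation leb := (@lebesgue_measure R).
Local Notation N01 := (normal_prob (0 : R) 1).

(** The heat semigroup, parametrized by the standard deviation [a] rather than by time. *)
Definition gauss_avg (a : R) (h : R -> R) (x : R) : R := Ex N01 (fun z => h (x + a * z)).

Lemma measurable_affine_pair (a : R) :
  measurable_fun setT (fun zx : measurableTypeR R * measurableTypeR R => zx.2 + a * zx.1 : measurableTypeR R).
Proof. by apply: measurable_funD => //; apply: measurable_funM. Qed.

Lemma bdm_gauss_avg a h : bdm h -> bdm (gauss_avg a h).
Proof.
move=> bh; have bf := bdm_comp (measurable_affine_pair a) bh.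
by have [] := Ex_fubini N01 N01 bf.
Qed.

(** Tonelli on the joint density, then the disintegration [normal_pdf_convolution]: the inner
    integral in z becomes that of a normal density, which is 1. *)
Lemma normal_prob_convolution (s t : R) (A : set R) : 0 < s -> 0 < t -> measurable A ->
  (N01 \x N01)%E ((fun zz : measurableTypeR R * measurableTypeR R =>
     s * zz.1 + t * zz.2 : measurableTypeR R) @^-1` A) =
  normal_prob 0 (Num.sqrt (s ^+ 2 + t ^+ 2)) A.
Proof.
move=> s0 t0 mA; set r := Num.sqrt _.
have st0 : 0 < s ^+ 2 + t ^+ 2 by rewrite addr_gt0// exprn_gt0.
have r0 : 0 < r by rewrite sqrtr_gt0.
transitivity (\int[N01]_z normal_prob (s * z)%R t A)%E.
  rewrite /product_measure1/=; apply: eq_integral => z _.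
  rewrite (normal_prob_affine _ t0 mA); congr (N01 _).
  by apply/seteqP; split => z' /=; rewrite /xsection/= inE.
pose k (zu : measurableTypeR R * measurableTypeR R) : R :=
  normal_pdf (s * zu.1) t zu.2.
have planar : measurable_fun setT k.
  rewrite /k; under eq_fun do rewrite normal_pdfE ?gt_eqF//.
  apply: measurable_funM => //; apply: measurableT_comp => //.
  apply: measurable_funM => //; apply: measurableT_comp => //.
  apply: measurable_funX; apply: measurable_funB => //.
  by apply: measurable_funM.
pose k1 (zu : measurableTypeR R * measurableTypeR R) : \bar R :=
  ((\1_A zu.2 * k zu)%:E)%E.
have m1A : measurable_fun setT (fun zu : measurableTypeR R * measurableTypeR R => \1_A zu.2 : R).
  have m1 : measurable_fun setT (\1_A : measurableTypeR R -> R) by exact: measurable_indic.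
  exact: (measurableT_comp m1 measurable_snd).
have mk1 : measurable_fun setT k1.
  by apply/measurable_EFinP; apply: measurable_funM.
have k0 zu : 0 <= k zu by exact: normal_pdf_ge0.
have k10 zu : (0 <= k1 zu)%E by rewrite lee_fin mulr_ge0// indicE.
have E z : normal_prob (s * z) t A = (\int[leb]_u k1 (z, u))%E.
  rewrite /normal_prob integral_mkcond; apply: eq_integral => u _.
  rewrite patchE /k1/= indicE; case: (u \in A); first by rewrite mul1r.
  by rewrite mul0r.
transitivity (\int[N01]_z \int[leb]_u k1 (z, u))%E.
  by apply: eq_integral => z _; exact: E.
have mF := measurable_fun_fubini_tonelli_F (m2 := @lebesgue_measure R) _ mk1 k10.
have mp := measurable_normal_pdf (0 : R) 1.
have dens := @ge0_integral_density _ _ R leb (normal_prob (0 : R) 1) (normal_pdf 0 1) mp.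
rewrite dens//; last 2 first.
- by move=> z; exact: normal_pdf_ge0.
- by move=> z; apply: integral_ge0 => u _; exact: k10.
pose k2 (zu : measurableTypeR R * measurableTypeR R) : \bar R :=
  (k1 zu * (normal_pdf 0 1 zu.1)%:E)%E.
have mk2 : measurable_fun setT k2.
  apply: emeasurable_funM => //; apply/measurable_EFinP.
  exact: (measurableT_comp mp measurable_fst).
have k20 zu : (0 <= k2 zu)%E by rewrite mule_ge0// lee_fin normal_pdf_ge0.
transitivity (\int[leb]_z \int[leb]_u k2 (z, u))%E.
  apply: eq_integral => z _; rewrite -ge0_integralZr//.
  - exact: (measurableT_comp mk1 (measurable_pair1 z)).
  - by rewrite lee_fin normal_pdf_ge0.
rewrite (fubini_tonelli (m1 := @lebesgue_measure R) (m2 := @lebesgue_measure R) _ mk2 k20).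
rewrite /normal_prob [RHS]integral_mkcond; apply: eq_integral => u _.
transitivity (\int[leb]_z ((\1_A u * normal_pdf 0 r u)%:E *
    (normal_pdf (s * u / r ^+ 2) (t / r) z)%:E))%E.
  apply: eq_integral => z _; rewrite /k2 /k1 /k/= -!EFinM.
  congr (_%:E); rewrite -[LHS]mulrA -[RHS]mulrA; congr (_ * _).
  exact: normal_pdf_convolution.
rewrite ge0_integralZl//; last 3 first.
- by apply/measurable_EFinP; exact: measurable_normal_pdf.
- by move=> z _; rewrite lee_fin normal_pdf_ge0.
- by rewrite lee_fin mulr_ge0 ?normal_pdf_ge0// indicE.
rewrite integral_normal_pdf mule1 patchE indicE.
by case: (u \in A); rewrite ?mul1r ?mul0r.
Qed.

Lemma gauss_avg0 h x : gauss_avg 0 h x = h x.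
Proof.
by rewrite /gauss_avg; under eq_Ex do rewrite mul0r addr0; rewrite Ex_cst.
Qed.

Lemma gauss_avg_comp (s t : R) (h : R -> R) (x : R) : 0 <= s -> 0 <= t -> bdm h ->
  gauss_avg s (gauss_avg t h) x = gauss_avg (Num.sqrt (s ^+ 2 + t ^+ 2)) h x.
Proof.
(* Zero scales are treated apart, since the convolution identity covers positive ones:
   [normal_prob 0 0] is not a point mass. *)
rewrite !le_eqVlt => /predU1P[<-|s0] /predU1P[<-|t0] bh.
- by rewrite !gauss_avg0 expr0n addr0 sqrtr0 gauss_avg0.
- by rewrite gauss_avg0 expr0n add0r sqrtr_sqr gtr0_norm.
- rewrite [in RHS]expr0n addr0 sqrtr_sqr gtr0_norm//.
  by apply: eq_Ex => z; rewrite gauss_avg0.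
have st0 : 0 < s ^+ 2 + t ^+ 2 by rewrite addr_gt0// exprn_gt0.
have r0 : 0 < Num.sqrt (s ^+ 2 + t ^+ 2) by rewrite sqrtr_gt0.
pose phi (zz : measurableTypeR R * measurableTypeR R) : measurableTypeR R :=
  t * zz.1 + s * zz.2.
have mphi : measurable_fun setT phi.
  by apply: measurable_funD => //; apply: measurable_funM.
pose hx y := h (x + y).
have bhx : bdm hx.
  apply: (bdm_comp (phi := fun y : measurableTypeR R => x + y : measurableTypeR R)) => //.
  exact: measurable_funD.
rewrite [RHS](_ : _ = Ex N01 (fun z => hx (0 + Num.sqrt (s ^+ 2 + t ^+ 2) * z))); last first.
  by apply: eq_Ex => z; rewrite add0r.
rewrite -(Ex_normal_affine 0 r0 bhx).
rewrite (Ex_transfer (P := (N01 \x N01)%E) mphi _ bhx); last first.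
  by move=> A mA; rewrite addrC; exact: normal_prob_convolution.
have [_ ->] := Ex_fubini N01 N01 (bdm_comp mphi bhx).
apply: eq_Ex => y; apply: eq_Ex => z; rewrite /hx /phi/=; congr h; ring.
Qed.

End gaussian_semigroup.

(** From (a - 1)^2 (a + 1) >= 0. It makes a third moment control the lower ones. *)
Lemma exp_le_1cube (R : realFieldType) (a : R) (k : nat) : 0 <= a -> (k <= 3)%N ->
  a ^+ k <= 1 + a ^+ 3.
Proof.
move=> a0; have H : 0 <= (a - 1) ^+ 2 * (a + 1) by rewrite mulr_ge0 ?sqr_ge0 ?addr_ge0.
have a2 := sqr_ge0 a; have a3 : 0 <= a ^+ 3 by exact: exprn_ge0.
have E : (a - 1) ^+ 2 * (a + 1) = a ^+ 3 - a ^+ 2 - a + 1 by ring.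
by rewrite E in H; case: k => [|[|[|[|//]]]] _; rewrite ?expr0 ?expr1; lra.
Qed.

(** * Test functions with a third-order Taylor bound *)

Section taylor_class.
Context (R : realType).
Implicit Types h : R -> R.

(** [h1] and [h2] stand for the derivative and half the second derivative. Stating the expansion as
    an inequality makes the class stable under averaging without differentiating under an
    integral. *)
Definition taylor3 (C : R) h (h1 h2 : R -> R) :=
  [/\ bdm h, bdm h1, bdm h2 & forall x y,
      `|h (x + y) - h x - y * h1 x - y ^+ 2 * h2 x| <= C * `|y| ^+ 3].

Lemma bdm_translate d (T : measurableType d) (zeta : T -> R) h (x : R) :
  measurable_fun setT zeta -> bdm h -> bdm (fun t => h (x + zeta t)).
Proof.
move=> mz bh; apply: (bdm_comp (phi := fun t => x + zeta t : measurableTypeR R)) => //.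
exact: measurable_funD.
Qed.

(** The linear term integrates to 0, so up to third moments only the variance of [zeta] matters;
    this is what makes two laws of equal variance interchangeable. *)
Lemma taylor_expectation d (T : measurableType d) (P : probability T R)
    (zeta : T -> R) (C : R) h h1 h2 (x : R) :
  measurable_fun setT zeta ->
  P.-integrable setT (fun t => (`|zeta t| ^+ 3)%:E) ->
  \int[P]_t zeta t = 0 -> taylor3 C h h1 h2 ->
  `|Ex P (fun t => h (x + zeta t)) - h x - \int[P]_t (zeta t ^+ 2) * h2 x| <=
    C * \int[P]_t (`|zeta t| ^+ 3).
Proof.
move=> mz i3 z0 [bh bh1 bh2 hT].
have i1c : P.-integrable setT (EFin \o (fun t => 1 + `|zeta t| ^+ 3)).
  have -> : EFin \o (fun t => 1 + `|zeta t| ^+ 3) =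
      (EFin \o (fun=> 1)) \+ (fun t => (`|zeta t| ^+ 3)%:E).
    by apply/funext => t.
  by apply: integrableD => //; exact: bdm_integrable (bdm_cst _ 1).
have i1 : P.-integrable setT (EFin \o zeta).
  apply: le_integrable i1c => //; first exact/measurable_EFinP.
  move=> t _ /=; rewrite lee_fin [leRHS]ger0_norm ?addr_ge0 ?exprn_ge0//.
  have := @exp_le_1cube _ _ 1 (normr_ge0 (zeta t)) isT; rewrite expr1 => H1; exact: H1.
have i2 : P.-integrable setT (EFin \o (fun t => zeta t ^+ 2)).
  apply: le_integrable i1c => //.
    by apply/measurable_EFinP; exact: measurable_funX.
  move=> t _ /=; rewrite lee_fin [leRHS]ger0_norm ?addr_ge0 ?exprn_ge0//.
  by rewrite normrX; exact: exp_le_1cube.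
have b := bdm_translate x mz bh.
have ib := bdm_integrable P b.
have ic := bdm_integrable P (bdm_cst T (h x)).
have i1' : P.-integrable setT (EFin \o (fun t => zeta t * h1 x)).
  have -> : EFin \o (fun t => zeta t * h1 x) = (fun t => (zeta t)%:E * (h1 x)%:E)%E by [].
  exact: integrableZr.
have i2' : P.-integrable setT (EFin \o (fun t => zeta t ^+ 2 * h2 x)).
  have -> : EFin \o (fun t => zeta t ^+ 2 * h2 x) =
    (fun t => (zeta t ^+ 2)%:E * (h2 x)%:E)%E by [].
  exact: integrableZr.
have ibc : P.-integrable setT (EFin \o (fun t => h (x + zeta t) - h x))
  := integrableB measurableT ib ic.
have ibc1 : P.-integrable setT (EFin \o (fun t => h (x + zeta t) - h x - zeta t * h1 x))
  := integrableB measurableT ibc i1'.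
have ibc2 : P.-integrable setT (EFin \o (fun t => h (x + zeta t) - h x - zeta t * h1 x - zeta t ^+ 2 * h2 x))
  := integrableB measurableT ibc1 i2'.
have -> : Ex P (fun t => h (x + zeta t)) - h x - \int[P]_t (zeta t ^+ 2) * h2 x =
  \int[P]_t (h (x + zeta t) - h x - zeta t * h1 x - zeta t ^+ 2 * h2 x).
  rewrite RintegralB// RintegralB// RintegralB//.
  rewrite RintegralZr// RintegralZr// z0 mul0r subr0.
  by rewrite -/(Ex P (fun=> h x)) Ex_cst.
apply: (le_trans (le_normr_Rintegral _ ibc2)) => //.
rewrite -RintegralZl//; apply: le_Rintegral => //.
- exact: (integrable_abse ibc2).
- have -> : EFin \o (fun t => C * `|zeta t| ^+ 3) = (fun t => C%:E * (`|zeta t| ^+ 3)%:E)%E by [].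
  exact: integrableZl.
Qed.

End taylor_class.

(** * Moments of the Gaussian law *)

Section gaussian_moments.
Context (R : realType).
Local Notation leb := (@lebesgue_measure R).
Local Notation N01 := (normal_prob (0 : R) 1).

(** The exponent 3/8 = 1/2 - 1/8 is the gap between the Gaussian exponents of standard deviations 1
    and 2, so that the cube times the first density is dominated by a multiple of the second. *)
Lemma cube_expR_le (t : R) : 0 <= t -> t ^+ 3 <= 16 * expR (3 / 8 * t ^+ 2).
Proof.
(* Half of the exponent is used, then squared, to reach degree 4. *)
move=> t0; have e := expR_ge1Dx (3 / 16 * t ^+ 2).
have -> : 3 / 8 * t ^+ 2 = 3 / 16 * t ^+ 2 + 3 / 16 * t ^+ 2 by field.
rewrite expRD -expr2.
have p0 : 0 <= 1 + 3 / 16 * t ^+ 2 by rewrite addr_ge0// mulr_ge0 ?exprn_ge0.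
have : (1 + 3 / 16 * t ^+ 2) ^+ 2 <= expR (3 / 16 * t ^+ 2) ^+ 2.
  by rewrite ler_pXn2r ?nnegrE ?expR_ge0.
move: (expR _ ^+ 2) => E H; apply: (le_trans _ (ler_wpM2l _ H)) => //.
by nra.
Qed.

Lemma integrable_N01_cube : N01.-integrable setT (fun z => (`|z| ^+ 3)%:E).
Proof.
have mc : measurable_fun setT (fun z : R => `|z| ^+ 3).
  by apply: measurable_funX; exact: normr_measurable.
apply/integrableP; split; first exact/measurable_EFinP.
have -> : (\int[N01]_z `|(`|z| ^+ 3)%:E| = \int[N01]_z (`|z| ^+ 3)%:E)%E.
  by apply: eq_integral => z _; rewrite gee0_abs// lee_fin exprn_ge0.
have dens := @ge0_integral_density _ _ R leb (normal_prob (0 : R) 1)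
  (normal_pdf 0 1) (measurable_normal_pdf _ _) (normal_pdf_ge0 _ _).
have mcE : measurable_fun setT (fun z : R => (`|z| ^+ 3)%:E) by exact: measurableT_comp.
rewrite dens//.
pose K : R := 16 * normal_peak 1 / normal_peak 2.
have pk0 (a : R) : a != 0 -> 0 < normal_peak a by exact: normal_peak_gt0.
have two0 : (2 : R) != 0 by [].
apply: (@le_lt_trans _ _ (\int[leb]_z (K%:E * (normal_pdf 0 2 z)%:E))%E).
  apply: ge0_le_integral => //.
  - by move=> z _; rewrite mule_ge0 ?lee_fin ?exprn_ge0 ?normal_pdf_ge0.
  - by apply: emeasurable_funM => //; apply: measurableT_comp => //; exact: measurable_normal_pdf.
  - by apply: emeasurable_funM => //; apply: measurableT_comp => //; exact: measurable_normal_pdf.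
  - move=> z _; rewrite -!EFinM lee_fin !normal_pdfE// ?oner_neq0// /K.
    have -> : 16 * normal_peak 1 / normal_peak 2 * (normal_peak 2 * normal_fun 0 2 z) =
      16 * normal_peak 1 * normal_fun 0 2 z :> R.
      by field; rewrite gt_eqF// pk0.
    have := cube_expR_le (normr_ge0 z); rewrite real_normK ?num_real// => H.
    rewrite /normal_fun subr0.
    have -> : - z ^+ 2 / (2 ^+ 2 *+ 2) = 3 / 8 * z ^+ 2 + - z ^+ 2 / (1 ^+ 2 *+ 2) :> R by field.
    rewrite expRD.
    have pe0 := mulr_ge0 (normal_peak_ge0 (1 : R)) (expR_ge0 (- z ^+ 2 / (1 ^+ 2 *+ 2))).
    have := ler_wpM2l pe0 H; congr (_ <= _); ring.
rewrite integralZl//; last exact: integrable_normal_pdf.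
by rewrite integral_normal_pdf mule1 ltry.
Qed.

(* The limit theorem divides by the square root of [gauss_m2], so that its value
   1 need not be computed. *)
Definition gauss_m2 : R := \int[N01]_z (z ^+ 2).
Definition gauss_m3 : R := \int[N01]_z (`|z| ^+ 3).

Lemma integrable_N01_pow (k : nat) : (k <= 3)%N ->
  N01.-integrable setT (fun z => (z ^+ k)%:E).
Proof.
move=> k3.
have i1c : N01.-integrable setT (EFin \o (fun z => 1 + `|z| ^+ 3)).
  have -> : EFin \o (fun t => 1 + `|t| ^+ 3) =
      (EFin \o (fun=> 1)) \+ (fun t => (`|t : R| ^+ 3)%:E).
    by apply/funext => t.
  apply: integrableD => //; last exact: integrable_N01_cube.
  by exact: bdm_integrable (bdm_cst _ 1).
apply: le_integrable i1c => //.
  by apply/measurable_EFinP; exact: measurable_funX.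
move=> t _ /=; rewrite lee_fin [leRHS]ger0_norm ?addr_ge0 ?exprn_ge0//.
by rewrite normrX; exact: exp_le_1cube.
Qed.

Lemma N01_mean : \int[N01]_z z = 0.
Proof.
have i1 : N01.-integrable setT (EFin \o (fun z => z)) by exact: (integrable_N01_pow (k := 1)).
have mN : measurable_fun setT (-%R : measurableTypeR R -> measurableTypeR R).
  exact: oppr_measurable.
pose pm := measure_function_pushforward__canonical__measure_function_Measure
  N01 mN.
have E : \int[N01]_z z = \int[N01]_z (-1 * z).
  rewrite /Rintegral; congr fine.
  transitivity (\int[pm]_z z%:E)%E.
    by apply: eq_measure_integral => A mA _; apply/esym; exact: N01_sym.
  rewrite integral_pushforward//=.
  - by apply: eq_integral => z _; rewrite mulN1r.
  - rewrite preimage_setT.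
    have -> : ((fun z => z%:E) \o -%R : R -> \bar R) = (fun z => (-1)%:E * z%:E)%E.
      by apply/funext => z /=; rewrite -EFinM mulN1r.
    exact: integrableZl.
by move: E; rewrite RintegralZl//; lra.
Qed.

(** If the second moment vanished, the law would be carried by the point 0, which is null for
    Lebesgue measure and hence for the normal law. *)
Lemma gauss_m2_gt0 : 0 < gauss_m2.
Proof.
rewrite lt_def; apply/andP; split; last by apply: Rintegral_ge0 => z _; exact: sqr_ge0.
apply/eqP => m0.
have i2 := integrable_N01_pow (isT : 2 <= 3)%N.
have I0 : (\int[N01]_z `|(z ^+ 2)%:E| = 0)%E.
  have -> : (\int[N01]_z `|(z ^+ 2)%:E| = \int[N01]_z (z ^+ 2)%:E)%E.
    by apply: eq_integral => z _; rewrite gee0_abs// lee_fin sqr_ge0.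
  rewrite -(@fineK _ (\int[N01]_z (z ^+ 2)%:E)%E); last exact: integrable_fin_num.
  by rewrite -[fine _]/gauss_m2 m0.
have mi2 := measurable_int _ i2.
have /ae_eq_integral_abs := I0 => /(_ measurableT mi2) [A [mA A0 subA]].
have : N01 setT = 0%E.
  apply/eqP; rewrite eq_le measure_ge0 andbT.
  have -> : setT = [set (0 : R)] `|` A.
    apply/seteqP; split => // z _; have [->|z0] := eqVneq z 0; first by left.
    right; apply: subA => /= H; have := H I => -[] /eqP.
    by rewrite sqrf_eq0 (negbTE z0).
  apply: (le_trans (measureU2 _ _ _)) => //.
  rewrite [X in (_ + X <= _)%E](_ : _ = 0%E); last exact: A0.
  rewrite adde0 le_eqVlt; apply/orP; left; apply/eqP.
  have /null_content_dominatesP dom := @normal_prob_dominates R 0 1.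
  exact: (dom _ (measurable_set1 0) (lebesgue_measure_set1 0)).
by rewrite [LHS](_ : _ = 1%E); [move/eqP; rewrite onee_eq0 | exact: probability_setT].
Qed.

Lemma gauss_m3_ge0 : 0 <= gauss_m3.
Proof. by apply: Rintegral_ge0 => z _; rewrite exprn_ge0. Qed.

Lemma gauss_avg_taylor (a C : R) h h1 h2 (x : R) : 0 <= a -> taylor3 C h h1 h2 ->
  `|gauss_avg a h x - h x - a ^+ 2 * gauss_m2 * h2 x| <= C * (a ^+ 3 * gauss_m3).
Proof.
move=> a0 hT.
have i3 : N01.-integrable setT (fun z => (`|a * z| ^+ 3)%:E).
  have -> : (fun z => (`|a * z| ^+ 3)%:E) = (fun z => (a ^+ 3)%:E * (`|z| ^+ 3)%:E)%E.
    by apply/funext => z; rewrite -EFinM normrM exprMn ger0_norm.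
  by apply: integrableZl => //; exact: integrable_N01_cube.
have := @taylor_expectation R _ _ N01 (fun z => a * z) C h h1 h2 x _ i3 _ hT.
have -> : \int[N01]_z (a * z) = 0.
  by rewrite RintegralZl ?N01_mean ?mulr0//; exact: (integrable_N01_pow (k := 1)).
have -> : \int[N01]_z ((a * z) ^+ 2) = a ^+ 2 * gauss_m2.
  rewrite -RintegralZl//; last exact: (integrable_N01_pow (k := 2)).
  by apply: eq_Rintegral => z _; rewrite exprMn.
have -> : \int[N01]_z (`|a * z| ^+ 3) = a ^+ 3 * gauss_m3.
  rewrite -RintegralZl//; last exact: integrable_N01_cube.
  by apply: eq_Rintegral => z _; rewrite normrM exprMn ger0_norm.
by apply => //; exact: measurable_funM.
Qed.

(** The expansion is uniform in the base point, so averaging over translates keeps the constant [C].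
    The induction in [lindeberg] rests on this stability. *)
Lemma taylor3_gauss_avg (a C : R) h h1 h2 : 
  taylor3 C h h1 h2 -> taylor3 C (gauss_avg a h) (gauss_avg a h1) (gauss_avg a h2).
Proof.
move=> [bh bh1 bh2 hT]; split; [exact: bdm_gauss_avg..|] => x y.
have maz : measurable_fun setT (fun z : measurableTypeR R => a * z : R) by exact: measurable_funM.
have b (w : R) (g : R -> R) : bdm g -> bdm (fun z : measurableTypeR R => g (w + a * z)).
  by move=> bg; exact: (bdm_translate w maz bg).
rewrite /gauss_avg.
have b0 := b (x + y) h bh; have b1 := b x h bh; have b2 := bdmZ y (b x h1 bh1).
have b3 := bdmZ (y ^+ 2) (b x h2 bh2).
rewrite -(ExZ _ y (b x h1 bh1)) -(ExZ _ (y ^+ 2) (b x h2 bh2)).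
rewrite -(ExB _ b0 b1) -(ExB _ (bdmB b0 b1) b2) -(ExB _ (bdmB (bdmB b0 b1) b2) b3).
apply: Ex_bound; first by apply: bdmB => //; apply: bdmB => //; exact: bdmB.
by move=> z; have := hT (x + a * z) y; have -> : x + a * z + y = x + y + a * z by ring.
Qed.

(** The first absolute moment is bounded through |z| <= 1 + |z|^3. Continuity in the scale later
    allows the scale of a block sum to be replaced by its limit. *)
Lemma gauss_avg_lipschitz (K a b : R) (h : R -> R) (x : R) : bdm h ->
  (forall u v, `|h u - h v| <= K * `|u - v|) ->
  `|gauss_avg a h x - gauss_avg b h x| <= K * (1 + gauss_m3) * `|a - b|.
Proof.
move=> bh hK.
have K0 : 0 <= K by have := hK 1 0; rewrite subr0 normr1 mulr1; exact: le_trans.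
have maz w : measurable_fun setT (fun z : measurableTypeR R => w * z : R) by exact: measurable_funM.
have ba := bdm_translate x (maz a) bh; have bb := bdm_translate x (maz b) bh.
rewrite /gauss_avg -ExB//; apply: (le_trans (norm_Ex _ (bdmB ba bb))).
pose c := K * `|a - b|.
have i3 := integrable_N01_cube.
apply: (@le_trans _ _ (\int[N01]_z (c * 1 + c * `|z| ^+ 3))); last first.
  have i1 := bdm_integrable N01 (bdm_cst _ (c * 1)).
  rewrite RintegralD//.
    rewrite -/(Ex N01 (fun=> c * 1)) Ex_cst RintegralZl// -/gauss_m3 /c.
    by rewrite le_eqVlt; apply/orP; left; apply/eqP; ring.
  have -> : EFin \o (fun t : R => c * `|t| ^+ 3) = (fun t => c%:E * (`|t| ^+ 3)%:E)%E by [].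
  exact: integrableZl.
apply: le_Rintegral => //.
- exact: (bdm_integrable _ (bdm_norm (bdmB ba bb))).
- have -> : EFin \o (fun z : R => c * 1 + c * `|z| ^+ 3) =
    (EFin \o (fun=> c * 1)) \+ (fun t => c%:E * (`|t| ^+ 3)%:E)%E by [].
  apply: integrableD => //; last exact: integrableZl.
  exact: (bdm_integrable N01 (bdm_cst _ (c * 1))).
- move=> z _; apply: (le_trans (hK _ _)); rewrite -mulrDr /c -mulrA.
  apply: ler_wpM2l => //.
  have -> : x + a * z - (x + b * z) = (a - b) * z by ring.
  rewrite normrM; apply: ler_wpM2l => //.
  have := @exp_le_1cube _ _ 1 (normr_ge0 z) isT; rewrite expr1 => H1; exact: H1.
Qed.

End gaussian_moments.

(** * The Lindeberg replacement method *)

Lemma taylor3_ge0 (R : realType) (C : R) h h1 h2 : taylor3 C h h1 h2 -> 0 <= C.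
Proof.
move=> [_ _ _ hT]; have := hT 0 1; rewrite normr1 !expr1n mulr1.
by apply: le_trans; exact: normr_ge0.
Qed.

Section lindeberg.
Context (R : realType) (I : choiceType).
Notation field := (field R I).
Context (Q : probability field R) (iQ : independent_coordinates Q).
Context (B : eqType) (A : B -> pred I) (zeta : B -> field -> R) (a m3 : R).
Hypothesis a_ge0 : 0 <= a.
Hypothesis zeta_bdm : forall b, bdm (zeta b).
Hypothesis zeta_dep : forall b, depends_on (A b) (zeta b).
Hypothesis A_disj : forall b b', b != b' -> forall i, ~~ (A b i && A b' i).
Hypothesis zeta_mean : forall b, Ex Q (zeta b) = 0.
Hypothesis zeta_var : forall b, Ex Q (fun t => zeta b t ^+ 2) = a ^+ 2 * gauss_m2 R.
Hypothesis zeta_3 : forall b, Ex Q (fun t => `|zeta b t| ^+ 3) <= m3.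

(** The two expansions have the same second-order term by [zeta_var], and it cancels. *)
Lemma lindeberg_step C h h1 h2 b x : taylor3 C h h1 h2 ->
  `|Ex Q (fun t => h (x + zeta b t)) - gauss_avg a h x| <=
    C * (m3 + a ^+ 3 * gauss_m3 R).
Proof.
move=> hT; have C0 := taylor3_ge0 hT.
have b3 := bdmX 3 (bdm_norm (zeta_bdm b)).
have T1 := taylor_expectation x (zeta_bdm b).1 (bdm_integrable Q b3) (zeta_mean b) hT.
have T2 := gauss_avg_taylor x a_ge0 hT.
move: T1; rewrite -/(Ex Q (fun t => zeta b t ^+ 2)) zeta_var => T1.
have := ler_normB (Ex Q (fun t => h (x + zeta b t)) - h x - a ^+ 2 * gauss_m2 R * h2 x)
  (gauss_avg a h x - h x - a ^+ 2 * gauss_m2 R * h2 x).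
have -> : forall p q r s : R, p - q - r - (s - q - r) = p - s by move=> *; ring.
move/le_trans; apply; rewrite mulrDr; apply: lerD => //.
apply: (le_trans T1); apply: ler_wpM2l => //; exact: zeta_3.
Qed.

(** Integrating out the head variable with the others frozen replaces [h] by [gauss_avg a h] at the
    cost of one step; the induction hypothesis then applies to this new test function, and the
    semigroup law adds up the squared scales. *)
Lemma lindeberg C h h1 h2 (s : seq B) x : uniq s -> taylor3 C h h1 h2 ->
  `|Ex Q (fun t => h (x + \sum_(b <- s) zeta b t)) -
     gauss_avg (Num.sqrt (size s)%:R * a) h x| <=
    (size s)%:R * (C * (m3 + a ^+ 3 * gauss_m3 R)).
Proof.
elim: s h h1 h2 x => [|b s IH] h h1 h2 x /= us hT.
  rewrite sqrtr0 mul0r gauss_avg0; under eq_Ex do rewrite big_nil addr0.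
  by rewrite Ex_cst subrr normr0 mul0r.
move: us => /andP[bs us].
have [bh _ _ _] := hT.
pose S t := \sum_(b <- s) zeta b t.
have bS : bdm S by exact: bdm_sum.
have dS : depends_on (predC (A b)) S.
  move=> t t' tt'; rewrite /S; apply: eq_big_seq => b' b's.
  apply: zeta_dep => i Ai; apply: tt' => /=.
  have bb' : b' != b by apply: contraNneq bs => <-.
  by have := A_disj bb' i; rewrite Ai.
pose F t := h (x + (zeta b t + S t)).
have bF : bdm F by apply: bdm_translate => //; apply: measurable_funD; [exact: (zeta_bdm b).1 | exact: bS.1].
have E1 : Ex Q (fun t => h (x + \sum_(b <- b :: s) zeta b t)) =
    Ex Q (fun y : field => Ex Q (fun t : field => h ((x + S y) + zeta b t))).
  transitivity (Ex Q F); first by apply: eq_Ex => t; rewrite big_cons.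
  rewrite (Ex_mix (A b) iQ bF).2; apply: eq_Ex => y; apply: eq_Ex => t.
  rewrite /F (@zeta_dep b _ t); last by move=> i Ai; rewrite /mix Ai.
  rewrite (dS _ y); last by move=> i /=; rewrite /mix; case: (A b i).
  by congr h; ring.
have b1 : bdm (fun y : field => Ex Q (fun t : field => h ((x + S y) + zeta b t))).
  have := (Ex_mix (A b) iQ bF).1.
  congr bdm; apply/funext => y; apply: eq_Ex => t.
  rewrite /F (@zeta_dep b _ t); last by move=> i Ai; rewrite /mix Ai.
  rewrite (dS _ y); last by move=> i /=; rewrite /mix; case: (A b i).
  by congr h; ring.
have b2 : bdm (fun y => gauss_avg a h (x + S y)).
  by apply: bdm_translate; [exact: bS.1 | exact: bdm_gauss_avg].
have D1 := le_Ex_dist Q b1 b2 (bdm_cst _ _) (fun y => lindeberg_step b (x + S y) hT).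
rewrite Ex_cst -E1 in D1.
have D2 := IH _ _ _ x us (taylor3_gauss_avg a hT).
rewrite gauss_avg_comp// in D2; last by rewrite mulr_ge0 ?sqrtr_ge0.
have sq : Num.sqrt ((Num.sqrt (size s)%:R * a) ^+ 2 + a ^+ 2) = Num.sqrt (size s).+1%:R * a.
  rewrite exprMn sqr_sqrtr ?ler0n// -[X in _ + X]mul1r -mulrDl natr1.
  by rewrite sqrtrM ?ler0n// sqrtr_sqr ger0_norm.
rewrite sq in D2.
have -> : (size s).+1%:R * (C * (m3 + a ^+ 3 * gauss_m3 R)) =
    C * (m3 + a ^+ 3 * gauss_m3 R) + (size s)%:R * (C * (m3 + a ^+ 3 * gauss_m3 R)).
  by rewrite -natr1; ring.
apply: (le_trans _ (lerD D1 D2)); apply: le_trans (ler_normD _ _).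
rewrite le_eqVlt; apply/orP; left; apply/eqP.
by congr (`| _ |); rewrite /S; ring.
Qed.

End lindeberg.

(** * Smoothing of test functions *)

Section smoothing.
Context (R : realType).
Local Notation leb := (@lebesgue_measure R).
Implicit Types f g h : R -> R.

Definition supported_in (K : R) f := forall x, K < `|x| -> f x = 0.

Lemma is_derive_continuous f (f' : R -> R) :
  (forall x : R, is_derive x (1 : R) f (f' x)) -> continuous f.
Proof.
by move=> df x; apply: differentiable_continuous; apply/derivable1_diffP; exact: (@ex_derive _ _ _ _ _ _ _ (df x)).
Qed.

Lemma mean_value f (f' : R -> R) (a b : R) : (forall x : R, is_derive x (1 : R) f (f' x)) ->
  exists2 c, Num.min a b <= c <= Num.max a b & f b - f a = f' c * (b - a).
Proof.
move=> df.
have cf : continuous f by exact: is_derive_continuous df.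
have seg x y : x <= y -> exists2 c, x <= c <= y & f y - f x = f' c * (y - x).
  move=> xy; have [|c cxy E] := @MVT_segment _ f f' x y xy (fun z _ => df z).
    exact: continuous_subspaceT.
  by exists c => //; move: cxy; rewrite in_itv.
have [ab|/ltW ba] := leP a b.
  exact: seg.
have [c cba E] := seg _ _ ba; exists c => //.
by rewrite -opprB E; ring.
Qed.

Lemma compact_support_integrable K f : continuous f -> supported_in K f ->
  leb.-integrable setT (EFin \o f).
Proof.
move=> cf sf.
have -> : EFin \o f = (EFin \o f) \_ `[- K, K].
  apply/funext => x; rewrite patchE; case: ifPn => // /negP xK.
  rewrite /= sf//; rewrite ltNge; apply/negP => xK'; apply: xK.
  by rewrite inE/= in_itv/= -ler_norml.
rewrite -integrable_mkcond//; apply: continuous_compact_integrable.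
  exact: segment_compact.
exact: continuous_subspaceT.
Qed.

(** Compact support makes [f] integrable, so that integrating from -oo gives a primitive on the
    whole line. *)
Lemma antiderivative K f : continuous f -> supported_in K f ->
  exists F : R -> R, forall x : R, is_derive x (1 : R) F (f x).
Proof.
move=> cf sf; have intf := compact_support_integrable cf sf.
exists (fun x => \int[leb]_(t in [set` `]-oo, x]]) f t) => x.
have [|||dF F'] := @continuous_FTC1 R f -oo%O x (x + 1) _ _ _ (cf x).
- by rewrite ltrDl.
- by apply: integrableS intf.
- by rewrite ltNyr.
- apply: DeriveDef; first exact: dF.
  by rewrite -F' derive1E.
Qed.

Lemma is_derive_shift f (f' : R -> R) (c : R) : (forall x : R, is_derive x (1 : R) f (f' x)) ->
  forall x : R, is_derive x (1 : R) (fun x => f (x + c)) (f' (x + c)).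
Proof.
move=> df x.
have d1 : is_derive x 1 (fun x : R => x + c) 1.
  by have := @is_deriveD R R^o R^o (fun x : R => x) (fun=> c) x 1 1 0 _ _; rewrite addr0; apply; exact: is_derive_cst.
have := @is_derive1_comp R f (fun x : R => x + c) x (f' (x + c)) 1 (df (x + c)) d1.
by rewrite mulr1.
Qed.

Definition difference_quotient (d : R) f x := (f (x + d) - f x) / d.

Lemma is_derive_difference_quotient (d : R) f (f' : R -> R) :
  (forall x : R, is_derive x (1 : R) f (f' x)) ->
  forall x : R, is_derive x (1 : R) (difference_quotient d f) (difference_quotient d f' x).
Proof.
move=> df x; have d1 := is_derive_shift d df x.
have d2 := @is_deriveB R R^o R^o _ _ x 1 _ _ d1 (df x).
have := @is_deriveZ R R^o R^o _ d^-1 x 1 _ d2.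
rewrite /difference_quotient mulrC; congr is_derive.
by apply/funext => y; rewrite mulrC.
Qed.

Lemma difference_quotient_bound (d M : R) f : 0 < d -> (forall x, `|f x| <= M) ->
  forall x, `|difference_quotient d f x| <= 2 / d * M.
Proof.
move=> d0 fM x; rewrite normrM normfV (gtr0_norm d0) mulrAC ler_pM2r ?invr_gt0//.
apply: (le_trans (ler_normB _ _)); rewrite mulr_natl mulr2n.
exact: lerD.
Qed.

(** The average of [f] over [x, x + d] is the difference quotient of a primitive, so its derivative
    is the difference quotient of [f]: each average gains one derivative. The last clause, from the
    mean value theorem, transfers both bounds and closeness. *)
Lemma moving_average (d K : R) f : 0 < d -> continuous f -> supported_in K f ->
  exists g, [/\ forall x : R, is_derive x (1 : R) g (difference_quotient d f x),
    supported_in (K + d) g & forall x, exists2 y, x <= y <= x + d & g x = f y].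
Proof.
move=> d0 cf sf; have [F dF] := antiderivative cf sf.
have mv x : exists2 y, x <= y <= x + d & difference_quotient d F x = f y.
  have [c cx E] := mean_value x (x + d) dF.
  exists c; last by rewrite /difference_quotient E; field; rewrite gt_eqF.
  have xd : x <= x + d by rewrite lerDl ltW.
  by move: cx; rewrite min_l ?max_r.
exists (difference_quotient d F); split => //.
  exact: is_derive_difference_quotient.
move=> x Kx; have [y /andP[xy yx] ->] := mv x; apply: sf.
by move: Kx; rewrite ![_ < `|_|]ltNge !ler_norml; apply: contra => /andP[h1 h2]; apply/andP; split; lra.
Qed.

(** The mean value theorem is used in place of an integration; it loses the factor 1/(k+1), but only
    the power matters. *)
Lemma derive_power_bound (C : R) (k : nat) g (g' : R -> R) :
  (forall t : R, is_derive t (1 : R) g (g' t)) -> g 0 = 0 ->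
  (forall t, `|g' t| <= C * `|t| ^+ k) -> forall t, `|g t| <= C * `|t| ^+ k.+1.
Proof.
move=> dg g0 g'C t.
have C0 : 0 <= C.
  by have := g'C 1; rewrite normr1 expr1n mulr1; apply: le_trans; exact: normr_ge0.
have [c ct] := mean_value 0 t dg; rewrite g0 !subr0 => ->.
rewrite normrM exprSr mulrA; apply: ler_wpM2r => //.
apply: (le_trans (g'C c)); apply: ler_wpM2l => //; apply: lerXn2r; rewrite ?nnegrE//.
move: ct; rewrite ler_norml; have [t0|t0] := leP 0 t.
  by rewrite ger0_norm// => /andP[h1 h2]; apply/andP; split; lra.
by rewrite ltr0_norm// => /andP[h1 h2]; apply/andP; split; lra.
Qed.

Lemma taylor_of_derivatives (C : R) (p0 p1 p2 p3 : R -> R) :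
  (forall x : R, is_derive x (1 : R) p0 (p1 x)) -> (forall x : R, is_derive x (1 : R) p1 (p2 x)) ->
  (forall x : R, is_derive x (1 : R) p2 (p3 x)) -> (forall x, `|p3 x| <= C) ->
  forall x y, `|p0 (x + y) - p0 x - y * p1 x - y ^+ 2 * (p2 x / 2)| <= C * `|y| ^+ 3.
Proof.
move=> d0 d1 d2 p3C x.
have sh (p q : R -> R) : (forall x : R, is_derive x (1 : R) p (q x)) ->
    forall y : R, is_derive y (1 : R) (fun y => p (x + y)) (q (x + y)).
  move=> dp y; have := is_derive_shift x dp y.
  by rewrite addrC; congr is_derive; apply/funext => z; rewrite addrC.
have B2 t : `|p2 (x + t) - p2 x| <= C * `|t| ^+ 1.
  apply: (@derive_power_bound C 0 (fun t => p2 (x + t) - p2 x) (fun t => p3 (x + t))).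
  - move=> y; rewrite -[p3 _]subr0.
    have s1 := sh _ _ d2 y; have s2 := is_derive_cst (p2 x) y (1 : R).
    exact: (@is_deriveB R R^o R^o _ _ y 1 _ _ s1 s2).
  - by rewrite addr0 subrr.
  - by move=> y; rewrite expr0 mulr1.
have B1 t : `|p1 (x + t) - p1 x - t * p2 x| <= C * `|t| ^+ 2.
  apply: (@derive_power_bound C 1 (fun t => p1 (x + t) - p1 x - t * p2 x)
    (fun t => p2 (x + t) - p2 x)) => //.
  - move=> y; have s1 := sh _ _ d1 y.
    have s2 := is_derive_cst (p1 x) y 1.
    have s3 : is_derive y 1 (fun t : R => t * p2 x) (p2 x).
      have := @is_deriveZ R R^o R^o (fun t : R => t) (p2 x) y 1 1 _.
      have -> : (p2 x *: (1 : R^o)) = p2 x by rewrite /GRing.scale/= mulr1.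
      have -> : (p2 x \*: (fun t : R => t)) = (fun t : R => t * p2 x) :> (R -> R).
        by apply/funext => t'; exact: mulrC.
      by apply.
    have := @is_deriveB R R^o R^o _ _ y 1 _ _ (@is_deriveB R R^o R^o _ _ y 1 _ _ s1 s2) s3.
    by rewrite subr0.
  - by rewrite addr0 mul0r !subrr.
apply: (@derive_power_bound C 2 (fun y => p0 (x + y) - p0 x - y * p1 x - y ^+ 2 * (p2 x / 2))
   (fun t => p1 (x + t) - p1 x - t * p2 x)) => //.
- move=> y; have s1 := sh _ _ d0 y.
  have s2 := is_derive_cst (p0 x) y 1.
  have s3 : is_derive y 1 (fun t : R => t * p1 x) (p1 x).
    have := @is_deriveZ R R^o R^o (fun t : R => t) (p1 x) y 1 1 _.
    have -> : (p1 x *: (1 : R^o)) = p1 x by rewrite /GRing.scale/= mulr1.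
    have -> : (p1 x \*: (fun t : R => t)) = (fun t : R => t * p1 x) :> (R -> R).
      by apply/funext => t'; exact: mulrC.
    by apply.
  have s4 : is_derive y 1 (fun t : R => t ^+ 2 * (p2 x / 2)) (y * p2 x).
    have := @is_deriveZ R R^o R^o (fun t : R => t ^+ 2) (p2 x / 2) y 1 (2 * y) _.
    have -> : (p2 x / 2 *: (2 * y : R^o)) = y * p2 x by rewrite /GRing.scale/=; field.
    have -> : (p2 x / 2 \*: (fun t : R => t ^+ 2)) = (fun t : R => t ^+ 2 * (p2 x / 2)) :> (R -> R).
      by apply/funext => t'; exact: mulrC.
    apply; have H := @is_deriveX R R^o (fun t : R => t) 2 y 1 1 (is_derive_id y (1 : R^o)).
    by rewrite /GRing.scale/= expr1 mulr1 in H.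
  have := @is_deriveB R R^o R^o _ _ y 1 _ _ (@is_deriveB R R^o R^o _ _ y 1 _ _
    (@is_deriveB R R^o R^o _ _ y 1 _ _ s1 s2) s3) s4.
  by rewrite subr0.
- by rewrite addr0 expr0n !mul0r !subrr.
Qed.

End smoothing.

Section smooth_approximation.
Context (R : realType).
Implicit Types f g h : R -> R.

(** [x] is confined to the segment but [y] may leave it, as happens to points moved by the
    averages. *)
Lemma uniformly_continuous_segment f (a b e : R) : continuous f -> 0 < e ->
  exists2 d, 0 < d & forall x y, a <= x <= b -> `|y - x| <= d -> `|f y - f x| <= e.
Proof.
move=> cf e0.
have cK := @segment_compact R a b.
move/compact_near_coveringP : cK => ncK.
have /= := ncK R^o (0^'+ : set_system R^o) (fun d x => forall y, `|y - x| <= d -> `|f y - f x| <= e) _.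
move=> H; have {H}: \forall d \near 0^'+, `[a, b]%classic `<=`
    (fun x => forall y, `|y - x| <= d -> `|f y - f x| <= e).
  apply: H => x _.
  have /cvgrPdist_lt/(_ (e / 2)) := cf x; rewrite divr_gt0// => /(_ isT).
  move=> /nbhs_ballP[eta /= eta0 He].
  have He' y : `|y - x| < eta -> `|f y - f x| < e / 2.
    by move=> yx; rewrite distrC; apply: He; rewrite /ball/= distrC.
  exists (ball x (eta / 2), [set d : R | d < eta / 2]).
    split => /=; first by apply: nbhsx_ballx; rewrite divr_gt0.
    by apply: nbhs_right_lt; rewrite divr_gt0.
  move=> [x' d] [/= xx' dl] y yx'.
  have h1 : `|x' - x| < eta / 2 by rewrite distrC.
  have h2 : `|x' - x| < eta by apply: (lt_le_trans h1); lra.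
  have h3 : `|y - x| < eta.
    have -> : y - x = (y - x') + (x' - x) by ring.
    apply: (le_lt_trans (ler_normD _ _)); lra.
  have -> : f y - f x' = (f y - f x) - (f x' - f x) by ring.
  apply: (le_trans (ler_normB _ _)); have := He' _ h2; have := He' _ h3; lra.
move=> H; have [d /= dH] := filter_ex (filterI (nbhs_right_gt (0 : R)) H).
move: dH => [d0 dH]; exists d => // x y xab yx.
by apply: (dH x) => //=; rewrite in_itv.
Qed.

Lemma continuous_bdm f M : continuous f -> (forall x, `|f x| <= M) -> bdm f.
Proof. by move=> cf fM; split; [exact: continuous_measurable_fun | exists M]. Qed.

Lemma continuous_difference_quotient d f : continuous f -> continuous (difference_quotient d f).
Proof.
move=> cf x; apply: cvgMl; apply: cvgB; last exact: cf.
apply: (cvg_comp (fun x => x + d) f); last exact: cf.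
by apply: cvgD; [exact: cvg_id | exact: cvg_cst].
Qed.

(** Cut [f] off far from [-A, A] and average three times, once for each derivative in the Taylor
    bound; the third derivative is then an iterated difference quotient of a bounded function. *)
Lemma smooth_approx f (M A e : R) : continuous f -> (forall x, `|f x| <= M) -> 0 < e -> 0 <= A ->
  exists h h1 h2 C K, [/\ taylor3 C h h1 h2,
    forall u v, `|h u - h v| <= K * `|u - v|,
    forall x, `|h x| <= M & forall x, `|x| <= A -> `|h x - f x| <= e].
Proof.
move=> cf fM e0 A0.
(* Equal to 1 for |x| <= A + 1 and to 0 for |x| >= A + 2: the unit margin leaves room for the
   averages. *)
pose cut (x : R) : R := Num.max 0 (Num.min 1 (A + 2 - `|x|)).
have cut01 x : 0 <= cut x <= 1.
  rewrite /cut le_max lexx /= ge_max ler01 /=.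
  by rewrite ge_min lexx.
have ccut : continuous cut.
  move=> x; apply: (@continuous_max R R (fun=> 0) (fun x => Num.min 1 (A + 2 - `|x|))).
    exact: cvg_cst.
  apply: (@continuous_min R R (fun=> 1) (fun x => A + 2 - `|x|)); first exact: cvg_cst.
  apply: cvgB; first exact: cvg_cst.
  exact: norm_continuous.
pose g x := f x * cut x.
have cg : continuous g by move=> x; apply: cvgM; [exact: cf | exact: ccut].
have sg : supported_in (A + 2) g.
  move=> x Ax; rewrite /g /cut max_l ?mulr0//.
  by rewrite ge_min; apply/orP; right; rewrite subr_le0 ltW.
have gf x : `|x| <= A + 1 -> g x = f x.
  move=> xA; rewrite /g /cut min_l; last by lra.
  by rewrite max_r ?mulr1.
have gM x : `|g x| <= M.
  rewrite normrM; have /andP[c0 c1] := cut01 x; apply: le_trans (fM x).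
  by rewrite ler_piMr// ger0_norm.
have M0 : 0 <= M by exact: le_trans (fM 0).
have [d' d'0 ucf] := uniformly_continuous_segment (- A) A cf e0.
(* Three averages move a point by at most 3 d, which has to stay within the modulus of continuity
   [d'] and within the unit margin of the cut-off. *)
pose d := Num.min d' 1 / 3.
have d0 : 0 < d by rewrite divr_gt0// lt_min d'0 ltr01.
have m1' : Num.min d' 1 <= 1 by rewrite ge_min lexx orbT.
have m2' : Num.min d' 1 <= d' by rewrite ge_min lexx.
have d3 : 3 * d = Num.min d' 1 by rewrite /d; field.
have d1 : 3 * d <= 1 by rewrite d3.
have dd' : 3 * d <= d' by rewrite d3.
have [a1 [da1 s1 m1]] := moving_average d0 cg sg.
have c1 := is_derive_continuous da1.
have [a2 [da2 s2 m2]] := moving_average d0 c1 s1.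
have c2 := is_derive_continuous da2.
have [a3 [da3 s3 m3]] := moving_average d0 c2 s2.
have c3 := is_derive_continuous da3.
have a3g x : exists2 y, x <= y <= x + 3 * d & a3 x = g y.
  have [y3 /andP[h1 h2] ->] := m3 x; have [y2 /andP[h3 h4] ->] := m2 y3.
  have [y1 /andP[h5 h6] ->] := m1 y2; exists y1 => //.
  by apply/andP; split; lra.
have a1M x : `|a1 x| <= M by have [y _ ->] := m1 x.
have a2M x : `|a2 x| <= M by have [y _ ->] := m2 x.
have a3M x : `|a3 x| <= M by have [y _ ->] := m3 x.
pose DQ := difference_quotient d.
have dp1 := is_derive_difference_quotient d da2.
have dp2 := is_derive_difference_quotient d (is_derive_difference_quotient d da1).
have B1 := difference_quotient_bound d0 a2M.
have B2 := difference_quotient_bound d0 (difference_quotient_bound d0 a1M).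
have B3 := difference_quotient_bound d0 (difference_quotient_bound d0 (difference_quotient_bound d0 gM)).
have T := taylor_of_derivatives da3 dp1 dp2 B3.
exists a3, (DQ a2), (fun x => DQ (DQ a1) x / 2), (2 / d * (2 / d * (2 / d * M))), (2 / d * M).
split => //.
- split => //.
  + exact: continuous_bdm c3 a3M.
  + exact: continuous_bdm (continuous_difference_quotient c2) B1.
  + have b := continuous_bdm (continuous_difference_quotient
      (continuous_difference_quotient c1)) B2.
    by have := bdmM b (bdm_cst _ 2^-1).
- move=> u v; have [c _ ->] := mean_value v u da3.
  by rewrite normrM; apply: ler_wpM2r.
- move=> x xA; have [y /andP[xy yx] ->] := a3g x.
  have yxd : `|y - x| <= d' by rewrite ger0_norm; lra.
  rewrite gf; first by apply: ucf => //; rewrite -ler_norml.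
  have -> : y = (y - x) + x by ring.
  apply: (le_trans (ler_normD _ _)).
  have : `|y - x| <= 1 by rewrite ger0_norm; lra.
  lra.
Qed.

End smooth_approximation.

(** * Big blocks *)

Section shifts.
Context (R : realType) (d : nat).
Implicit Types (u a : lattice d) (x : index d -> R).

Definition shift_site a u : lattice d := [tuple tnth u i + tnth a i | i < d].

Lemma tnth_shift_site a u i : tnth (shift_site a u) i = tnth u i + tnth a i.
Proof. by rewrite tnth_mktuple. Qed.

Definition shift_index a (i : index d) : index d :=
  match i with
  | inl u => inl (shift_site a u)
  | inr e => inr (shift_site a e.1, shift_site a e.2)
  end.

Definition shift_field a x : index d -> R := fun i => x (shift_index a i).

Definition neg_site a : lattice d := [tuple - tnth a i | i < d].

Lemma shift_siteK a : cancel (shift_site a) (shift_site (neg_site a)).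
Proof.
move=> u; apply: eq_from_tnth => i; rewrite !tnth_shift_site tnth_mktuple.
by rewrite addrK.
Qed.

Lemma shift_indexK a : cancel (shift_index a) (shift_index (neg_site a)).
Proof. by case=> [u|[u v]] /=; rewrite !shift_siteK. Qed.

Lemma site_shift a i : site (shift_index a i) = shift_site a (site i).
Proof. by case: i => [u|[u v]]. Qed.

Lemma near_shift a r u v : near r (shift_site a u) (shift_site a v) = near r u v.
Proof.
apply/nearP/nearP => H i; have := H i; rewrite !tnth_shift_site.
  by have -> : tnth u i + tnth a i - (tnth v i + tnth a i) = tnth u i - tnth v i by ring.
by have -> : tnth u i + tnth a i - (tnth v i + tnth a i) = tnth u i - tnth v i by ring.
Qed.

Lemma trunc_shift a u r x : shift_field a (trunc (inball (shift_site a u) r) x) =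
  trunc (inball u r) (shift_field a x).
Proof.
apply/funext => i; rewrite /shift_field /trunc /mix /inball site_shift near_shift.
by case: ifP.
Qed.

Definition origin : lattice d := [tuple 0 | i < d].

Lemma shift_origin a : shift_site a origin = a.
Proof. by apply: eq_from_tnth => i; rewrite tnth_shift_site tnth_mktuple add0r. Qed.

Lemma shift_site_comp a b u : shift_site a (shift_site b u) = shift_site (shift_site a b) u.
Proof. by apply: eq_from_tnth => i; rewrite !tnth_shift_site addrA [_ + tnth a i]addrC addrA addrAC. Qed.

End shifts.

Section block_decomposition.
Context (R : realType) (d : nat).
Notation field := (field R (index d)).
Context (Q : probability field R) (iQ : independent_coordinates Q).
Hypothesis Q_shift : forall a i (B : set R), measurable B ->
  Q [set x | B (x (shift_index a i))] = Q [set x | B (x i)].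
Context (X : lattice d -> field -> R) (C : R).
Hypothesis d_gt0 : (0 < d)%N.
Hypothesis X_bdm : forall u, bdm (X u).
Hypothesis X01 : forall u x, 0 <= X u x <= 1.
Hypothesis X_shift : forall a u x, X (shift_site a u) x = X u (shift_field a x).
Hypothesis C_ge1 : 1 <= C.
Hypothesis X_local : forall u r,
  Ex Q (fun x : field => `|X u x - X u (trunc (inball u r) x)|) <= C / r.+1%:R ^+ (4 * d).

Lemma Ex_shift a (f : field -> R) : bdm f -> Ex Q (fun x : field => f (shift_field a x)) = Ex Q f.
Proof.
move=> bf; apply: (Ex_reindex (tau' := shift_index (neg_site a))) => //.
- exact: shift_indexK.
- by move=> i B mB; exact: Q_shift.
Qed.

Definition local_version (M : nat) u (x : field) : R := X u (trunc (inball u M) x).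

Lemma bdm_local_version M u : bdm (local_version M u).
Proof. exact: bdm_trunc. Qed.

Lemma local_version01 M u x : 0 <= local_version M u x <= 1.
Proof. exact: X01. Qed.

Lemma local_version_trunc M u r x :
  local_version M u (trunc (inball u r) x) = X u (trunc (inball u (minn M r)) x).
Proof.
rewrite /local_version; congr X; apply/funext => i; rewrite /trunc /mix /inball.
have E : near (minn M r) u (site i) = near M u (site i) && near r u (site i).
  apply/nearP/andP => [H|[/nearP H1 /nearP H2] k].
    by split; apply/nearP => k; have := H k; rewrite leq_min => /andP[].
  by rewrite leq_min H1 H2.
by rewrite E; case: (near M _ _); case: (near r _ _).
Qed.

Lemma norm01 (y z : R) : 0 <= y <= 1 -> 0 <= z <= 1 -> `|y - z| <= 1.
Proof. by move=> /andP[y0 y1] /andP[z0 z1]; rewrite ler_norml; apply/andP; split; lra. Qed.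

Lemma X_norm1 u x : `|X u x| <= 1.
Proof. by have /andP[y0 y1] := X01 u x; rewrite ger0_norm. Qed.

Lemma inv_pow_le (r s k : nat) : (r <= s)%N -> (s.+1%:R ^+ k)^-1 <= (r.+1%:R ^+ k)^-1 :> R.
Proof.
move=> rs; rewrite lef_pV2 ?posrE ?exprn_gt0 ?ltr0n//.
by apply: lerXn2r; rewrite ?nnegrE ?ler0n// ler_nat.
Qed.

(** The error of truncation at M has L1 size at most C / (M+1)^(4d), and truncating this error at
    radius r changes it by at most the error at radius max(M, r). Half of the exponent provides the
    decay in r that [var_sum_le] asks for, the other half a factor that vanishes as M grows. *)
Lemma var_local_error (M N : nat) (o : int) (P : pred {ffun 'I_d -> 'I_N}) :
  var Q (fun x => \sum_(f | P f) (X (pt o f) x - local_version M (pt o f) x)) <=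
  4 * 36 ^+ d * (C / M.+1%:R ^+ (2 * d)) * #|P|%:R.
Proof.
have e4 (r : nat) : r.+1%:R ^+ (4 * d) = r.+1%:R ^+ (2 * d) * r.+1%:R ^+ (2 * d) :> R.
  by rewrite -exprD; congr (_ ^+ _); lia.
have C0 : 0 <= C by exact: le_trans ler01 C_ge1.
have split4 (r s : nat) : (s <= r)%N -> (M <= r)%N ->
    C / r.+1%:R ^+ (4 * d) <= C / M.+1%:R ^+ (2 * d) / s.+1%:R ^+ (2 * d).
  move=> sr Mr; rewrite e4 invfM mulrA.
  have i0 k : 0 <= (k.+1%:R ^+ (2 * d))^-1 :> R by rewrite invr_ge0 exprn_ge0 ?ler0n.
  apply: ler_pM => //; first by rewrite mulr_ge0.
    by apply: ler_wpM2l => //; exact: inv_pow_le.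
  exact: inv_pow_le.
apply: (@var_sum_le R d Q iQ N o P
  (fun f x => X (pt o f) x - local_version M (pt o f) x)).
- by move=> f; apply: bdmB => //; exact: bdm_local_version.
- by move=> f x; apply: norm01; [exact: X01 | exact: local_version01].
- move=> f; apply: (le_trans (X_local _ M)).
  have := split4 M 0%N (leq0n _) (leqnn _).
  by rewrite expr1n invr1 mulr1.
move=> f r; set u := pt o f.
have [Mr|rM] := leqP M r.
  apply: (@le_trans _ _ (C / r.+1%:R ^+ (4 * d))); last exact: split4.
  apply: le_trans (X_local u r); apply: le_Ex.
  - apply: bdm_norm; apply: bdmB; first by apply: bdmB => //; exact: bdm_local_version.
    exact: (bdm_trunc (inball u r) (bdmB (X_bdm u) (bdm_local_version M u))).
  - by apply: bdm_norm; apply: bdmB => //; exact: bdm_trunc.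
  move=> x; rewrite local_version_trunc (minn_idPl Mr) -/(local_version M u x).
  by rewrite le_eqVlt; apply/orP; left; apply/eqP; congr (`| _ |); ring.
apply: (@le_trans _ _ (C / M.+1%:R ^+ (4 * d))); last by apply: split4 => //; exact: ltnW.
apply: le_trans (X_local u M); apply: le_Ex.
- apply: bdm_norm; apply: bdmB; first by apply: bdmB => //; exact: bdm_local_version.
  exact: (bdm_trunc (inball u r) (bdmB (X_bdm u) (bdm_local_version M u))).
- by apply: bdm_norm; apply: bdmB => //; exact: bdm_trunc.
move=> x; rewrite local_version_trunc (minn_idPr (ltnW rM)) subrr subr0.
by rewrite /local_version.
Qed.

(** The bound is uniform in [M], so discarding a small proportion of the sites costs little at every
    range. *)
Lemma var_local_version (M N : nat) (o : int) (P : pred {ffun 'I_d -> 'I_N}) :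
  var Q (fun x => \sum_(f | P f) local_version M (pt o f) x) <=
  4 * 36 ^+ d * (2 * C) * #|P|%:R.
Proof.
apply: (@var_sum_le R d Q iQ N o P (fun f => local_version M (pt o f))).
- by move=> f; exact: bdm_local_version.
- by move=> f x; exact: X_norm1.
- move=> f; apply: (@le_trans _ _ 1); last by have := C_ge1; lra.
  rewrite -[leRHS](Ex_cst Q); apply: le_Ex; [exact: bdm_norm (bdm_local_version _ _) | exact: bdm_cst |].
  by move=> x; exact: X_norm1.
move=> f r; set u := pt o f.
have rd (s : nat) : (r <= s)%N -> C / s.+1%:R ^+ (4 * d) <= C / r.+1%:R ^+ (2 * d).
  move=> rs; apply: ler_wpM2l; first exact: le_trans ler01 C_ge1.
  apply: (@le_trans _ _ (r.+1%:R ^+ (4 * d))^-1); first exact: inv_pow_le.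
  rewrite lef_pV2 ?posrE ?exprn_gt0 ?ltr0n//.
  by apply: ler_weXn2l; rewrite ?ler1n//; lia.
have [Mr|rM] := leqP M r.
  rewrite [leLHS](_ : _ = 0); first by rewrite !mulr_ge0 ?invr_ge0 ?exprn_ge0 ?ler0n//; exact: le_trans ler01 C_ge1.
  under eq_Ex do rewrite local_version_trunc (minn_idPl Mr) -/(local_version M u _) subrr normr0.
  exact: Ex_cst.
apply: (@le_trans _ _ (C / M.+1%:R ^+ (4 * d) + C / r.+1%:R ^+ (4 * d))); last first.
  have := rd M (ltnW rM); have := rd r (leqnn _).
  by rewrite -mulrA mulr_natl mulr2n => h1 h2; exact: lerD.
have bM : bdm (fun x : field => `|X u x - X u (trunc (inball u M) x)|).
  by apply: bdm_norm; apply: bdmB => //; exact: bdm_trunc.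
have br : bdm (fun x : field => `|X u x - X u (trunc (inball u r) x)|).
  by apply: bdm_norm; apply: bdmB => //; exact: bdm_trunc.
apply: le_trans (lerD (X_local u M) (X_local u r)); rewrite -ExD//.
apply: le_Ex.
- apply: bdm_norm; apply: bdmB; first exact: bdm_local_version.
  exact: (bdm_trunc (inball u r) (bdm_local_version M u)).
- exact: bdmD.
move=> x; rewrite local_version_trunc (minn_idPr (ltnW rM)) /local_version.
rewrite -normrN.
have -> : - (X u (trunc (inball u M) x) - X u (trunc (inball u r) x)) =
  (X u x - X u (trunc (inball u M) x)) - (X u x - X u (trunc (inball u r) x)) by ring.
exact: ler_normB.
Qed.

End block_decomposition.

Section standard_deviation.
Context (R : realType) d (T : measurableType d) (P : probability T R).
Implicit Types f g : T -> R.

Definition sd f := L2 P (fun x => f x - Ex P f).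

Lemma sd_sqrt f : bdm f -> sd f = Num.sqrt (var P f).
Proof. by move=> bf; rewrite /sd /L2 varE. Qed.

Lemma sdD f g : bdm f -> bdm g -> sd (fun x => f x + g x) <= sd f + sd g.
Proof.
move=> bf bg; have := L2_triangle P (bdm_center P bf) (bdm_center P bg).
congr (_ <= _); rewrite /sd; congr (L2 _ _); apply/funext => x.
by rewrite ExD//; ring.
Qed.

Lemma sdZ c f : bdm f -> sd (fun x => c * f x) = `|c| * sd f.
Proof.
move=> bf; rewrite /sd -L2Z; last exact: bdm_center.
by congr (L2 _ _); apply/funext => x; rewrite ExZ//; ring.
Qed.

Lemma sd_le f (v : R) : bdm f -> var P f <= v -> sd f <= Num.sqrt v.
Proof. by move=> bf fv; rewrite sd_sqrt// ler_wsqrtr. Qed.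

End standard_deviation.

(** From (M+1)^2 = (M^2 + 1) + 2M: the corridors of width 2M take up a proportion of order 1/M of
    each side. *)
Definition block_side (M : nat) : nat := (M.+1 ^ 2)%N.
Definition core_side (M : nat) : nat := (M ^ 2).+1.

Lemma block_sideE M : block_side M = (core_side M + 2 * M)%N.
Proof. by rewrite /block_side /core_side !expnS !expn0; nia. Qed.

Lemma core_near_in_block (c y M p : nat) (s : int) : (y < p)%N ->
  (`|(y%:Z + (1 + (c + M)%N%:Z) - s)%R| <= M)%N ->
  (1 + c%:Z <= s) && (s <= (c + (p + 2 * M))%N%:Z).
Proof. by move=> yp H; apply/andP; split; lia. Qed.

Lemma block_index_unique (r c c' : nat) (s : int) : (0 < r)%N ->
  1 + (r * c)%N%:Z <= s -> s <= (r * c + r)%N%:Z ->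
  1 + (r * c')%N%:Z <= s -> s <= (r * c' + r)%N%:Z -> c = c'.
Proof.
move=> r0 h1 h2 h3 h4; apply/eqP; rewrite eqn_leq; apply/andP; split.
  rewrite leqNgt; apply/negP => cc'.
  have : (r * c'.+1 <= r * c)%N by rewrite leq_mul2l cc' orbT.
  by rewrite mulnS; lia.
rewrite leqNgt; apply/negP => cc'.
have : (r * c.+1 <= r * c')%N by rewrite leq_mul2l cc' orbT.
by rewrite mulnS; lia.
Qed.

(** * Independent block sums *)

Section blocks.
Context (R : realType) (d : nat).
Notation field := (field R (index d)).
Context (Q : probability field R) (iQ : independent_coordinates Q).
Hypothesis Q_shift : forall a i (B : set R), measurable B ->
  Q [set x | B (x (shift_index a i))] = Q [set x | B (x i)].
Context (X : lattice d -> field -> R) (C : R).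
Hypothesis d_gt0 : (0 < d)%N.
Hypothesis X_bdm : forall u, bdm (X u).
Hypothesis X01 : forall u x, 0 <= X u x <= 1.
Hypothesis X_shift : forall a u x, X (shift_site a u) x = X u (shift_field a x).
Hypothesis C_ge1 : 1 <= C.
Hypothesis X_local : forall u r,
  Ex Q (fun x : field => `|X u x - X u (trunc (inball u r) x)|) <= C / r.+1%:R ^+ (4 * d).
Notation local_version := (local_version X).

Lemma local_version_shift M a u x :
  local_version M (shift_site a u) x = local_version M u (shift_field a x).
Proof. by rewrite /local_version X_shift trunc_shift. Qed.

Section fixed_scale.
Context (M : nat).

Notation q := (block_side M).
Notation p := (core_side M).

(** First site of the core. The summand [M] centers the core in its block, at distance M from the
    outside, so that truncated variables of distinct blocks read disjoint coordinates. *)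
Definition corner t (b : {ffun 'I_d -> 'I_t}) : lattice d :=
  [tuple 1 + (q * b i + M)%N%:Z | i < d].

Definition core_sum (x : field) : R :=
  \sum_(y : {ffun 'I_d -> 'I_p}) local_version M (pt 0 y) x.

Definition block_sum t (b : {ffun 'I_d -> 'I_t}) (x : field) : R :=
  core_sum (shift_field (corner b) x).

Lemma bdm_core_sum : bdm core_sum.
Proof. by apply: bdm_sum => y; exact: bdm_local_version. Qed.

Lemma bdm_shift a (f : field -> R) : bdm f -> bdm (fun x : field => f (shift_field a x)).
Proof.
move=> bf; apply: (bdm_comp (phi := fun x : field => shift_field a x : field)) => //.
by apply: measurable_to_field => i; exact: measurable_coord.
Qed.

Lemma bdm_block_sum t (b : {ffun 'I_d -> 'I_t}) : bdm (block_sum b).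
Proof. exact: bdm_shift bdm_core_sum. Qed.

Lemma block_sumE t (b : {ffun 'I_d -> 'I_t}) x : block_sum b x =
  \sum_(y : {ffun 'I_d -> 'I_p}) local_version M (shift_site (corner b) (pt 0 y)) x.
Proof. by apply: eq_bigr => y _; rewrite local_version_shift. Qed.

Definition block_region t (b : {ffun 'I_d -> 'I_t}) : pred (index d) := fun i =>
  [forall k, (1 + (q * b k)%N%:Z <= tnth (site i) k) &&
             (tnth (site i) k <= (q * b k + q)%N%:Z)].

Lemma block_sum_dep t (b : {ffun 'I_d -> 'I_t}) : depends_on (block_region b) (block_sum b).
Proof.
move=> x x' xx'; rewrite !block_sumE; apply: eq_bigr => y _.
apply: (depends_on_trunc (X _)) => i /nearP near_i; apply: xx'.
apply/forallP => k; have := near_i k.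
rewrite tnth_shift_site !tnth_mktuple add0r.
by move/(core_near_in_block (ltn_ord (y k))); rewrite -block_sideE.
Qed.

Lemma block_region_disjoint t (b b' : {ffun 'I_d -> 'I_t}) : b != b' ->
  forall i, ~~ (block_region b i && block_region b' i).
Proof.
move=> bb' i; apply: contra bb' => /andP[/forallP H /forallP H'].
apply/eqP/ffunP => k; apply: val_inj => /=.
have /andP[h1 h2] := H k; have /andP[h3 h4] := H' k.
exact: block_index_unique h1 h2 h3 h4.
Qed.

Section embedding.
Context (n' t : nat).
Hypothesis qtn : (q * t <= n'.+1)%N.

Definition embed (by_ : {ffun 'I_d -> 'I_t} * {ffun 'I_d -> 'I_p}) : {ffun 'I_d -> 'I_n'.+1} :=
  [ffun i => inord (q * by_.1 i + M + by_.2 i)].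

Lemma embedE by_ i : embed by_ i = (q * by_.1 i + M + by_.2 i)%N :> nat.
Proof.
rewrite ffunE inordK//; apply: leq_trans qtn.
have : (q * (by_.1 i).+1 <= q * t)%N by rewrite leq_mul2l (ltn_ord (by_.1 i)) orbT.
apply: leq_trans; rewrite mulnS.
by have := ltn_ord (by_.2 i); rewrite [X in (_ < X + _)%N]block_sideE; lia.
Qed.

Lemma embed_inj : injective embed.
Proof.
have q0 : (0 < q)%N by rewrite block_sideE /core_side.
(* Euclidean division by the block side recovers the block and the position inside it. *)
have dm (by_ : {ffun 'I_d -> 'I_t} * {ffun 'I_d -> 'I_p}) i :
    (embed by_ i %/ q = by_.1 i)%N /\ (embed by_ i %% q = M + by_.2 i)%N.
  have sq : (M + by_.2 i < q)%N.
    by have := ltn_ord (by_.2 i); rewrite [block_side M]block_sideE; lia.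
  rewrite embedE -addnA mulnC; split; first by rewrite divnMDl// divn_small ?addn0.
  by rewrite modnMDl modn_small.
move=> [b y] [b' y'] E; congr (_, _); apply/ffunP => i; apply: val_inj => /=.
  by have := (dm (b, y) i).1; rewrite E (dm (b', y') i).1.
by have := (dm (b, y) i).2; rewrite E (dm (b', y') i).2 /=; lia.
Qed.

Lemma pt_embed by_ : pt 1 (embed by_) = shift_site (corner by_.1) (pt 0 by_.2).
Proof.
apply: eq_from_tnth => i; rewrite tnth_shift_site !tnth_mktuple embedE.
by rewrite !PoszD add0r; ring.
Qed.

Definition kept : {set {ffun 'I_d -> 'I_n'.+1}} :=
  embed @: {: {ffun 'I_d -> 'I_t} * {ffun 'I_d -> 'I_p}}.

Lemma sum_block_sum x : \sum_(b : {ffun 'I_d -> 'I_t}) block_sum b x =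
  \sum_(f in kept) local_version M (pt 1 f) x.
Proof.
under eq_bigr do rewrite block_sumE.
rewrite pair_big/= /kept big_imset/=; last by move=> ? ? _ _; exact: embed_inj.
by apply: eq_big => [by_|by_ _]; [rewrite inE | rewrite pt_embed].
Qed.

Definition site_sum n (x : field) : R := \sum_(f : {ffun 'I_d -> 'I_n}) X (pt 1 f) x.

Lemma bdm_site_sum n : bdm (site_sum n).
Proof. exact: bdm_sum. Qed.

(** Two errors are added: truncating the variable at every site, and dropping the truncated
    variables at the sites outside the cores. *)
Lemma sd_block_error :
  sd Q (fun x => site_sum n'.+1 x - \sum_(b : {ffun 'I_d -> 'I_t}) block_sum b x) <=
  Num.sqrt (4 * 36 ^+ d * (C / M.+1%:R ^+ (2 * d)) * n'.+1%:R ^+ d) +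
  Num.sqrt (4 * 36 ^+ d * (2 * C) * (n'.+1%:R ^+ d - (t * p)%:R ^+ d)).
Proof.
pose G := kept.
pose D1 x := \sum_(f : {ffun 'I_d -> 'I_n'.+1}) (X (pt 1 f) x - local_version M (pt 1 f) x).
pose D2 x := \sum_(f | f \notin G) local_version M (pt 1 f) x.
have E x : site_sum n'.+1 x - \sum_(b : {ffun 'I_d -> 'I_t}) block_sum b x = D1 x + D2 x.
  rewrite sum_block_sum /D1 /D2 sumrB /site_sum.
  rewrite [X in _ = _ - X + _](bigID (fun f => f \in G))/=; ring.
have -> : (fun x => site_sum n'.+1 x - \sum_(b : {ffun 'I_d -> 'I_t}) block_sum b x) =
   (fun x => D1 x + D2 x) by apply/funext => x; exact: E.
have b1 : bdm D1 by apply: bdm_sum => f; apply: bdmB => //; exact: bdm_local_version.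
have b2 : bdm D2 by apply: bdm_sum => f; exact: bdm_local_version.
apply: (le_trans (sdD Q b1 b2)); apply: lerD.
  apply: (sd_le b1).
  have := var_local_error iQ d_gt0 X_bdm X01 C_ge1 X_local M 1 (xpredT : pred {ffun 'I_d -> 'I_n'.+1}).
  by rewrite card_ffun !card_ord natrX.
apply: (sd_le b2).
have := var_local_version iQ d_gt0 X_bdm X01 C_ge1 X_local M 1 (fun f : {ffun 'I_d -> 'I_n'.+1} => f \notin G).
have -> : #|(fun f : {ffun 'I_d -> 'I_n'.+1} => f \notin G)| = #|~: G|.
  by apply: eq_card => f; rewrite !inE.
rewrite cardsCs finset.setCK card_imset; last exact: embed_inj.
rewrite card_prod !card_ffun !card_ord.
rewrite natrB; last first.
  rewrite -expnMn leq_exp2r//; apply: leq_trans qtn.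
  by rewrite mulnC leq_mul2r block_sideE leq_addr orbT.
by rewrite -expnMn !natrX.
Qed.

End embedding.

Section block_gaussian.
Context (n' t : nat).
Hypothesis tn : (t <= n'.+1)%N.
Notation n := n'.+1.
Notation rt := (Num.sqrt (n%:R ^+ d : R)).

Let rt_gt0 : 0 < rt.
Proof. by rewrite sqrtr_gt0 exprn_gt0// ltr0n. Qed.

Definition block_fluct (b : {ffun 'I_d -> 'I_t}) (x : field) : R :=
  rt^-1 * (block_sum b x - Ex Q core_sum).

Definition core_bound : R := #|{ffun 'I_d -> 'I_p}|%:R.

Lemma Ex_block_sum (b : {ffun 'I_d -> 'I_t}) : Ex Q (block_sum b) = Ex Q core_sum.
Proof. exact: Ex_shift bdm_core_sum. Qed.

Lemma bdm_block_fluct b : bdm (block_fluct b).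
Proof. by apply: bdmZ; apply: bdmB; [exact: bdm_block_sum | exact: bdm_cst]. Qed.

Lemma block_fluct_mean b : Ex Q (block_fluct b) = 0.
Proof.
have bb := bdm_block_sum b; have bc := bdm_cst (field : measurableType _) (Ex Q core_sum).
by rewrite /block_fluct (ExZ _ _ (bdmB bb bc)) (ExB _ bb bc) Ex_cst Ex_block_sum subrr mulr0.
Qed.

Lemma core_sum_fluct_bound x : `|core_sum x - Ex Q core_sum| <= core_bound.
Proof.
have c01 y : 0 <= core_sum y <= core_bound.
  rewrite /core_bound -sum1_card natr_sum /core_sum; apply/andP; split.
    by apply: sumr_ge0 => z _; have /andP[] := local_version01 X01 M (pt 0 z) y.
  by apply: ler_sum => z _; have /andP[] := local_version01 X01 M (pt 0 z) y.
have e0 : 0 <= Ex Q core_sum by apply: Ex_ge0 => y; have /andP[] := c01 y.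
have e1 : Ex Q core_sum <= core_bound.
  rewrite -[leRHS](Ex_cst Q); apply: le_Ex; [exact: bdm_core_sum | exact: bdm_cst |].
  by move=> y; have /andP[] := c01 y.
have /andP[h0 h1] := c01 x; rewrite ler_norml; apply/andP; split; lra.
Qed.

Lemma block_fluct_var b : Ex Q (fun x => block_fluct b x ^+ 2) = var Q core_sum / n%:R ^+ d.
Proof.
have bc := bdm_center Q bdm_core_sum.
have -> : Ex Q (fun x => block_fluct b x ^+ 2) =
    Ex Q (fun x : field => (n%:R ^+ d)^-1 * ((core_sum (shift_field (corner b) x) - Ex Q core_sum) ^+ 2)).
  by apply: eq_Ex => x; rewrite /block_fluct exprMn exprVn sqr_sqrtr// exprn_ge0// ler0n.
rewrite ExZ; last exact: (bdm_shift (corner b) (bdmX 2 bc)).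
by rewrite (Ex_shift iQ Q_shift (corner b) (bdmX 2 bc)) -(varE Q bdm_core_sum) mulrC.
Qed.

Lemma block_fluct_3 b : Ex Q (fun x => `|block_fluct b x| ^+ 3) <= core_bound ^+ 3 / rt ^+ 3.
Proof.
rewrite -[leRHS](Ex_cst Q); apply: le_Ex; [exact: bdmX (bdm_norm (bdm_block_fluct b)) | exact: bdm_cst |].
move=> x; rewrite /block_fluct normrM exprMn normfV (ger0_norm (ltW rt_gt0)) exprVn mulrC.
apply: ler_wpM2r; first by rewrite invr_ge0 exprn_ge0// ltW.
by apply: lerXn2r; rewrite ?nnegrE ?ler0n//; exact: core_sum_fluct_bound.
Qed.

Lemma block_fluct_dep b : depends_on (block_region b) (block_fluct b).
Proof. by move=> x y xy; rewrite /block_fluct (block_sum_dep xy). Qed.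

Definition block_total (x : field) : R := \sum_(b : {ffun 'I_d -> 'I_t}) block_fluct b x.

Lemma bdm_block_total : bdm block_total.
Proof. by apply: bdm_sum => b; exact: bdm_block_fluct. Qed.

Lemma block_total_var : Ex Q (fun x => block_total x ^+ 2) = t%:R ^+ d * (var Q core_sum / n%:R ^+ d).
Proof.
have E0 : Ex Q block_total = 0.
  rewrite Ex_sum; last by move=> b; exact: bdm_block_fluct.
  by rewrite big1// => b _; exact: block_fluct_mean.
have := cov_sum Q (index_enum {ffun 'I_d -> 'I_t}) (index_enum {ffun 'I_d -> 'I_t}) xpredT xpredT
  bdm_block_fluct bdm_block_fluct.
rewrite -/block_total {1}/cov E0 mulr0 subr0.
under eq_Ex do rewrite -expr2.
move=> ->; under eq_bigr => b _.
  rewrite (bigD1 b)//= big1 ?addr0; last first.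
    move=> b' b'b; apply: (cov_disjoint iQ (A := block_region b) (B := block_region b')).
    - exact: bdm_block_fluct.
    - exact: bdm_block_fluct.
    - by apply: block_region_disjoint; rewrite eq_sym.
    - exact: block_fluct_dep.
    - exact: block_fluct_dep.
  rewrite /cov block_fluct_mean mulr0 subr0.
  under eq_Ex do rewrite -expr2.
  rewrite block_fluct_var; over.
by rewrite sumr_const card_ffun !card_ord -[LHS]mulr_natl natrX.
Qed.

(** For a fixed range, each of the t^d blocks costs a third moment of order n^(-3d/2); as t <= n,
    the total is of order n^(-d/2). *)
Lemma block_total_gaussian K h h1 h2 : taylor3 K h h1 h2 ->
  `|Ex Q (fun x => h (block_total x)) -
    gauss_avg (L2 Q block_total / Num.sqrt (gauss_m2 R)) h 0| <=
  K * ((core_bound ^+ 3 + Num.sqrt (var Q core_sum / gauss_m2 R) ^+ 3 * gauss_m3 R) / rt).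
Proof.
move=> hT; have K0 := taylor3_ge0 hT.
have g0 := gauss_m2_gt0 R.
have v0 : 0 <= var Q core_sum by apply: var_ge0; exact: bdm_core_sum.
(* Chosen so that a^2 times [gauss_m2] is the variance of one normalized block sum. *)
pose s := Num.sqrt (var Q core_sum / gauss_m2 R); pose a := s / rt.
have s0 : 0 <= s by exact: sqrtr_ge0.
have a0 : 0 <= a by rewrite divr_ge0// ltW.
have rt2 : rt ^+ 2 = n%:R ^+ d by rewrite sqr_sqrtr// exprn_ge0// ler0n.
have s2 : s ^+ 2 = var Q core_sum / gauss_m2 R by rewrite sqr_sqrtr// divr_ge0// ltW.
have va b : Ex Q (fun x => block_fluct b x ^+ 2) = a ^+ 2 * gauss_m2 R.
  rewrite block_fluct_var /a exprMn exprVn rt2 s2.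
  by rewrite mulrAC divfK// gt_eqF.
have := lindeberg iQ a0 bdm_block_fluct block_fluct_dep (@block_region_disjoint t)
  block_fluct_mean va block_fluct_3 0 (index_enum_uniq {ffun 'I_d -> 'I_t}) hT.
have -> : size (index_enum {ffun 'I_d -> 'I_t}) = (t ^ d)%N.
  by rewrite -sum1_size sum1_card card_ffun !card_ord.
have -> : Num.sqrt (t ^ d)%:R * a = L2 Q block_total / Num.sqrt (gauss_m2 R).
  rewrite /L2 block_total_var -sqrtrV ?ltW// -sqrtrM; last first.
    by rewrite mulr_ge0 ?exprn_ge0 ?divr_ge0 ?ler0n ?exprn_ge0 ?ler0n.
  have -> : a = Num.sqrt (a ^+ 2) by rewrite sqrtr_sqr ger0_norm.
  rewrite -sqrtrM ?ler0n//; congr Num.sqrt; rewrite /a exprMn exprVn rt2 s2 natrX.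
  by rewrite mulrA mulrAC !mulrA mulrAC.
under eq_Ex do rewrite add0r.
move=> H; apply: (le_trans H); rewrite mulrCA; apply: ler_wpM2l => //.
have -> : core_bound ^+ 3 / rt ^+ 3 + a ^+ 3 * gauss_m3 R =
    (core_bound ^+ 3 + s ^+ 3 * gauss_m3 R) / rt / rt ^+ 2.
  by rewrite /a; field; rewrite gt_eqF.
have -> : forall y z w : R, y * (z / w) = z * (y / w) by move=> *; rewrite mulrCA.
rewrite ler_piMr//.
  apply: divr_ge0; last exact: ltW.
  by rewrite addr_ge0 ?exprn_ge0 ?ler0n// mulr_ge0 ?exprn_ge0 ?gauss_m3_ge0.
rewrite rt2 ler_pdivrMr ?exprn_gt0 ?ltr0n// mul1r natrX.
by apply: lerXn2r; rewrite ?nnegrE ?ler0n// ler_nat.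
Qed.

End block_gaussian.

End fixed_scale.
End blocks.

Lemma exists_div_le (R : realType) (x e : R) : 0 < e ->
  exists N : nat, forall n, (N <= n)%N -> x / n.+1%:R <= e.
Proof.
move=> e0; exists (Num.trunc (Num.max 0 (x / e))).+1 => n Nn.
rewrite ler_pdivrMr ?ltr0n// -ler_pdivrMl// mulrC.
apply: (@le_trans _ _ (Num.max 0 (x / e))); first by rewrite le_max lexx orbT.
apply: ltW; apply: (lt_le_trans (truncnS_gt _)); rewrite ler_nat.
exact: leqW.
Qed.

Lemma bernoulli_le (R : realType) (x : R) (n : nat) : 0 <= x <= 1 -> 1 - x ^+ n <= n%:R * (1 - x).
Proof.
move=> /andP[x0 x1]; elim: n => [|n IH]; first by rewrite expr0 subrr mul0r.
rewrite exprS -natr1.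
have -> : 1 - x * x ^+ n = (1 - x) + x * (1 - x ^+ n) by ring.
have : x * (1 - x ^+ n) <= 1 - x ^+ n by rewrite ler_piMl// subr_ge0 exprn_ile1.
by rewrite mulrDl mul1r; lra.
Qed.

Lemma sqrtr_subadd (R : realType) (a b : R) : 0 <= a -> 0 <= b ->
  Num.sqrt (a + b) <= Num.sqrt a + Num.sqrt b.
Proof.
move=> a0 b0; have sa := sqrtr_ge0 a; have sb := sqrtr_ge0 b.
rewrite -(@ler_pXn2r _ 2)// ?nnegrE ?sqrtr_ge0 ?addr_ge0//.
rewrite sqrrD !sqr_sqrtr ?addr_ge0// lerD2r lerDl.
by rewrite mulrn_wge0// mulr_ge0.
Qed.

Lemma sqrtr_div (R : realType) (a b : R) : 0 <= a ->
  (Num.sqrt a)^-1 * Num.sqrt b = Num.sqrt (b / a).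
Proof. by move=> a0; rewrite [b / a]mulrC sqrtrM ?invr_ge0// sqrtrV. Qed.

(** * Block approximation of the normalized sums *)

Section central_limit.
Context (R : realType) (d : nat).
Notation field := (field R (index d)).
Context (Q : probability field R) (iQ : independent_coordinates Q).
Hypothesis Q_shift : forall a i (B : set R), measurable B ->
  Q [set x | B (x (shift_index a i))] = Q [set x | B (x i)].
Context (X : lattice d -> field -> R) (C : R).
Hypothesis d_gt0 : (0 < d)%N.
Hypothesis X_bdm : forall u, bdm (X u).
Hypothesis X01 : forall u x, 0 <= X u x <= 1.
Hypothesis X_shift : forall a u x, X (shift_site a u) x = X u (shift_field a x).
Hypothesis C_ge1 : 1 <= C.
Hypothesis X_local : forall u r,
  Ex Q (fun x : field => `|X u x - X u (trunc (inball u r) x)|) <= C / r.+1%:R ^+ (4 * d).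
Context (Y : nat -> field -> R) (C' : R).
Hypothesis Y_bdm : forall n, bdm (Y n).
Hypothesis Y_var : forall n, (0 < n)%N -> var Q (Y n) <= C' * n%:R ^+ d.-1.
Hypothesis C'_ge0 : 0 <= C'.

Notation rt n := (Num.sqrt (n%:R ^+ d : R)).

(** [Y] carries the boundary layer, whose variance of order n^(d-1) becomes negligible after
    normalization. *)
Definition total n (x : field) : R := site_sum X n x + Y n x.
Definition normalized n (x : field) : R := (rt n)^-1 * (total n x - Ex Q (total n)).

Lemma bdm_total n : bdm (total n).
Proof. by apply: bdmD => //; exact: bdm_site_sum. Qed.

Lemma bdm_normalized n : bdm (normalized n).
Proof. by apply: bdmZ; apply: bdm_center; exact: bdm_total. Qed.

Lemma rt_gt0 n : 0 < rt n.+1.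
Proof. by rewrite sqrtr_gt0 exprn_gt0// ltr0n. Qed.

Lemma sd_remainder n : (rt n.+1)^-1 * sd Q (Y n.+1) <= Num.sqrt (C' / n.+1%:R).
Proof.
have n0 : 0 < n.+1%:R :> R by rewrite ltr0n.
apply: (@le_trans _ _ ((rt n.+1)^-1 * Num.sqrt (C' * n.+1%:R ^+ d.-1))).
  by apply: ler_wpM2l; [rewrite invr_ge0 sqrtr_ge0 | apply: sd_le => //; exact: Y_var].
rewrite sqrtr_div ?exprn_ge0 ?ler0n//.
rewrite ler_wsqrtr// le_eqVlt; apply/orP; left; apply/eqP.
case: d d_gt0 => // k _; rewrite exprS; field.
by rewrite expf_neq0 gt_eqF.
Qed.

Let K1 : R := 4 * 36 ^+ d * C.
Let K2 : R := 4 * 36 ^+ d * (2 * C).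

Lemma block_error M n t : (block_side M * t <= n.+1)%N -> 
  L2 Q (fun x => normalized n.+1 x - block_total Q X M n t x) <=
  Num.sqrt (K1 / M.+1%:R) +
  Num.sqrt (K2 * (1 - (t * core_side M)%:R ^+ d / n.+1%:R ^+ d)) +
  Num.sqrt (C' / n.+1%:R).
Proof.
move=> qtn; have n0 : 0 < n.+1%:R :> R by rewrite ltr0n.
have nd0 : 0 < n.+1%:R ^+ d :> R by rewrite exprn_gt0.
have C0 : 0 <= C by exact: le_trans ler01 C_ge1.
pose D (x : field) := site_sum X n.+1 x - \sum_(b : {ffun 'I_d -> 'I_t}) block_sum X M b x.
have bS := bdm_site_sum X_bdm n.+1.
have bB : bdm (fun x => \sum_(b : {ffun 'I_d -> 'I_t}) block_sum X M b x).
  by apply: bdm_sum => b; exact: bdm_block_sum.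
have bD : bdm D by exact: bdmB.
have bDY : bdm (fun x => D x + Y n.+1 x) by exact: bdmD.
have E x : normalized n.+1 x - block_total Q X M n t x =
    (rt n.+1)^-1 * ((D x + Y n.+1 x) - Ex Q (fun x => D x + Y n.+1 x)).
  rewrite (ExD _ bD (Y_bdm _)) (ExB _ bS bB) /normalized /total (ExD _ bS (Y_bdm _)).
  have -> : Ex Q (fun x => \sum_(b : {ffun 'I_d -> 'I_t}) block_sum X M b x) =
      \sum_(b : {ffun 'I_d -> 'I_t}) Ex Q (core_sum X M).
    rewrite Ex_sum; last by move=> b; exact: bdm_block_sum.
    by apply: eq_bigr => b _; exact: Ex_block_sum.
  rewrite /block_total /block_fluct -mulr_sumr sumrB /D; ring.
have -> : L2 Q (fun x => normalized n.+1 x - block_total Q X M n t x) =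
    (rt n.+1)^-1 * sd Q (fun x => D x + Y n.+1 x).
  rewrite -[X in X * _]ger0_norm ?invr_ge0 ?sqrtr_ge0// -L2Z; last exact: bdm_center.
  by congr (L2 _ _); apply/funext => x; exact: E.
apply: (@le_trans _ _ ((rt n.+1)^-1 * (sd Q D + sd Q (Y n.+1)))).
  by apply: ler_wpM2l; [rewrite invr_ge0 sqrtr_ge0 | exact: sdD].
rewrite mulrDr; apply: lerD; last exact: sd_remainder.
have := sd_block_error iQ d_gt0 X_bdm X01 X_shift C_ge1 X_local qtn.
move=> H; apply: (@le_trans _ _ ((rt n.+1)^-1 * (_ + _))).
  by apply: ler_wpM2l; [rewrite invr_ge0 sqrtr_ge0 | exact: H].
have tpn : (t * core_side M)%:R ^+ d <= n.+1%:R ^+ d :> R.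
  apply: lerXn2r; rewrite ?nnegrE ?ler0n// ler_nat; apply: leq_trans qtn.
  by rewrite mulnC leq_mul2r block_sideE leq_addr orbT.
rewrite mulrDr; apply: lerD.
  rewrite sqrtr_div ?(ltW nd0)//; apply: ler_wsqrtr.
  rewrite mulfK ?gt_eqF// /K1 mulrA.
  apply: ler_wpM2l; first by rewrite !mulr_ge0 ?exprn_ge0.
  rewrite lef_pV2 ?posrE ?exprn_gt0 ?ltr0n//.
  by apply: ler_eXnr; rewrite ?ler1n//; lia.
rewrite sqrtr_div ?(ltW nd0)//; apply: ler_wsqrtr.
rewrite -mulrA le_eqVlt; apply/orP; left; apply/eqP; rewrite -/K2; congr (_ * _).
by field; rewrite gt_eqF.
Qed.

(** The first term accounts for the incomplete block left by the division, the second for the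
    corridors; Bernoulli's inequality passes from proportions of lengths to proportions of
    volumes. *)
Lemma block_loss M n (t := (n.+1 %/ block_side M)%N) :
  1 - (t * core_side M)%:R ^+ d / n.+1%:R ^+ d <=
  d%:R * (block_side M)%:R / n.+1%:R + 2 * d%:R / M.+1%:R :> R.
Proof.
have n0 : 0 < n.+1%:R :> R by rewrite ltr0n.
have q0 : 0 < (block_side M)%:R :> R by rewrite ltr0n block_sideE.
have M0 : 0 < M.+1%:R :> R by rewrite ltr0n.
have tq : (t * block_side M <= n.+1)%N by exact: leq_divM.
have ntq : (n.+1 < t * block_side M + block_side M)%N.
  by rewrite addnC -mulSn ltn_ceil// block_sideE.
have tp : (t * core_side M <= n.+1)%N.
  by apply: leq_trans tq; rewrite leq_mul2l block_sideE leq_addr orbT.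
rewrite -expr_div_n.
have z01 : 0 <= ((t * core_side M)%:R / n.+1%:R : R) <= 1.
  apply/andP; split; first by rewrite divr_ge0 ?ler0n.
  by rewrite ler_pdivrMr// mul1r ler_nat.
apply: (le_trans (bernoulli_le d z01)).
have -> : d%:R * (block_side M)%:R / n.+1%:R + 2 * d%:R / M.+1%:R =
  d%:R * ((block_side M)%:R / n.+1%:R + 2 / M.+1%:R) :> R by ring.
apply: ler_wpM2l; first exact: ler0n.
rewrite lerBlDr.
have t_le : t%:R <= n.+1%:R / (block_side M)%:R :> R.
  by rewrite ler_pdivlMr// -natrM ler_nat.
apply: (@le_trans _ _ (n.+1%:R / n.+1%:R : R)); first by rewrite divff// gt_eqF.
have h1 : n.+1%:R <= (block_side M)%:R + (2 * M * t)%:R + (t * core_side M)%:R :> R.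
  by rewrite -!natrD ler_nat; move: ntq; rewrite block_sideE; nia.
apply: (@le_trans _ _ (((block_side M)%:R + (2 * M * t)%:R + (t * core_side M)%:R) / n.+1%:R)).
  by apply: ler_wpM2r => //; rewrite invr_ge0 ltW.
have -> : forall a b c w : R, (a + b + c) / w = a / w + b / w + c / w.
  by move=> *; rewrite 2!mulrDl.
rewrite lerD2r lerD2l ler_pdivrMr// natrM.
apply: (@le_trans _ _ ((2 * M)%:R * (n.+1%:R / (block_side M)%:R))).
  by apply: ler_wpM2l => //; exact: ler0n.
rewrite mulrA ler_pdivrMr//.
have -> : 2 / M.+1%:R * n.+1%:R * (block_side M)%:R = 2 * M.+1%:R * n.+1%:R :> R.
  by rewrite /block_side natrX; field; rewrite gt_eqF.
by apply: ler_wpM2r; [exact: ltW | rewrite -natrM ler_nat leq_mul2l leqnSn orbT].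
Qed.

(** Limit, for a fixed range and growing n, of the standard deviation of the block approximation. *)
Definition scale_limit M : R := Num.sqrt (var Q (core_sum X M) / (block_side M)%:R ^+ d).

Lemma block_total_L2 M n (t := (n.+1 %/ block_side M)%N) :
  `|L2 Q (block_total Q X M n t) - scale_limit M| <=
  scale_limit M * (d%:R * (block_side M)%:R / n.+1%:R).
Proof.
have n0 : 0 < n.+1%:R :> R by rewrite ltr0n.
have q0 : 0 < (block_side M)%:R :> R by rewrite ltr0n block_sideE.
have tq : (t * block_side M <= n.+1)%N by exact: leq_divM.
have ntq : (n.+1 < t * block_side M + block_side M)%N.
  by rewrite addnC -mulSn ltn_ceil// block_sideE.
have v0 : 0 <= var Q (core_sum X M) by apply: var_ge0; exact: bdm_core_sum.
pose y : R := (t * block_side M)%:R / n.+1%:R.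
have y01 : 0 <= y <= 1.
  apply/andP; split; first by rewrite divr_ge0 ?ler0n.
  by rewrite ler_pdivrMr// mul1r ler_nat.
have yd01 : 0 <= y ^+ d <= 1.
  by move: y01 => /andP[y0 y1]; rewrite exprn_ge0// exprn_ile1.
have -> : L2 Q (block_total Q X M n t) = scale_limit M * Num.sqrt (y ^+ d).
  rewrite /L2 block_total_var//.
  rewrite /scale_limit -sqrtrM ?divr_ge0 ?exprn_ge0 ?ler0n//; congr Num.sqrt.
  rewrite /y expr_div_n natrM exprMn; field.
  by rewrite !expf_neq0 ?gt_eqF.
have s0 : 0 <= scale_limit M by exact: sqrtr_ge0.
rewrite -[X in _ - X]mulr1 -mulrBr normrM ger0_norm//; apply: ler_wpM2l => //.
rewrite distrC.
have sy : y ^+ d <= Num.sqrt (y ^+ d) <= 1.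
  move: yd01 => /andP[yd0 yd1]; apply/andP; split; last by rewrite -[leRHS]sqrtr1 ler_wsqrtr.
  by rewrite -{1}(sqr_sqrtr yd0) expr2 ler_piMr ?sqrtr_ge0// -[leRHS]sqrtr1 ler_wsqrtr.
rewrite ger0_norm; last by rewrite subr_ge0; case/andP: sy.
apply: (@le_trans _ _ (1 - y ^+ d)); first by rewrite lerD2l lerN2; case/andP: sy.
apply: (le_trans (bernoulli_le d y01)); rewrite -mulrA; apply: ler_wpM2l; first exact: ler0n.
rewrite lerBlDr /y -mulrDl ler_pdivlMr// mul1r -natrD ler_nat addnC.
exact: ltnW.
Qed.

(** Packages the block construction so that the range disappears from the statement. The number [v]
    is chosen before n, which makes the L2 norms of the normalized sums a Cauchy sequence. *)
Lemma block_approximation e : 0 < e -> exists v N, forall n, (N <= n)%N ->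
  exists V : field -> R, [/\ bdm V, L2 Q (fun x => normalized n.+1 x - V x) <= e,
    `|L2 Q V - v| <= e &
    forall K h h1 h2, taylor3 K h h1 h2 ->
      `|Ex Q (fun x => h (V x)) - gauss_avg (L2 Q V / Num.sqrt (gauss_m2 R)) h 0| <= K * e].
Proof.
(* Four errors share [e], each the square root of something below [e1]: truncation, incomplete
   blocks, corridors and boundary layer. *)
move=> e0; pose e1 := (e / 4) ^+ 2.
have e10 : 0 < e1 by rewrite exprn_gt0// divr_gt0.
have se1 : Num.sqrt e1 = e / 4 by rewrite sqrtr_sqr ger0_norm// ltW// divr_gt0.
have C0 : 0 <= C by exact: le_trans ler01 C_ge1.
have [M1 H1] := exists_div_le K1 e10.
have [M2 H2] := exists_div_le (K2 * (2 * d%:R)) e10.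
(* The range is fixed before the thresholds on n, which depend on it. *)
pose M := maxn M1 M2; pose q := block_side M.
have [N1 H3] := exists_div_le (K2 * (d%:R * q%:R)) e10.
have [N2 H4] := exists_div_le C' e10.
have [N3 H5] := exists_div_le (scale_limit M * (d%:R * q%:R)) e0.
pose K3 := core_bound R d M ^+ 3 + Num.sqrt (var Q (core_sum X M) / gauss_m2 R) ^+ 3 * gauss_m3 R.
have K30 : 0 <= K3.
  rewrite addr_ge0 ?exprn_ge0 ?ler0n// mulr_ge0 ?exprn_ge0 ?sqrtr_ge0//.
  exact: gauss_m3_ge0.
have [N4 H6] := exists_div_le (K3 ^+ 2) (exprn_gt0 2 e0).
exists (scale_limit M), (maxn (maxn N1 N2) (maxn N3 N4)) => n.
rewrite !geq_max => /andP[/andP[n1 n2] /andP[n3 n4]].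
pose t := (n.+1 %/ q)%N.
have tq : (t * q <= n.+1)%N by exact: leq_divM.
have tn : (t <= n.+1)%N by exact: leq_trans (leq_pmulr _ _) tq.
have K20 : 0 <= K2 by rewrite !mulr_ge0 ?exprn_ge0.
exists (block_total Q X M n t); split.
- exact: bdm_block_total.
- apply: (le_trans (block_error _)); first by rewrite mulnC.
  have -> : e = e / 4 + (e / 4 + e / 4) + e / 4 by field.
  apply: lerD; last by rewrite -se1; apply: ler_wsqrtr; exact: H4.
  apply: lerD.
    by rewrite -se1; apply: ler_wsqrtr; apply: H1; exact: leq_maxl.
  apply: (@le_trans _ _ (Num.sqrt (K2 * (d%:R * q%:R) / n.+1%:R + K2 * (2 * d%:R) / M.+1%:R))).
    apply: ler_wsqrtr.
    have -> : K2 * (d%:R * q%:R) / n.+1%:R + K2 * (2 * d%:R) / M.+1%:R =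
      K2 * (d%:R * q%:R / n.+1%:R + 2 * d%:R / M.+1%:R) by ring.
    by apply: ler_wpM2l => //; exact: block_loss.
  apply: (le_trans (sqrtr_subadd _ _)).
  + by rewrite !mulr_ge0 ?invr_ge0 ?ler0n.
  + by rewrite !mulr_ge0 ?invr_ge0 ?ler0n.
  apply: lerD; rewrite -se1; apply: ler_wsqrtr; first exact: H3.
  by apply: H2; exact: leq_maxr.
- apply: (le_trans (block_total_L2 M n)).
  by rewrite mulrA; exact: H5.
- move=> K h h1 h2 hT; have K0 := taylor3_ge0 hT.
  apply: (le_trans (block_total_gaussian iQ Q_shift X_bdm X01 X_shift M tn hT)).
  apply: ler_wpM2l => //; rewrite -/K3 ler_pdivrMr ?rt_gt0//.
  rewrite -(@ler_pXn2r _ 2)// ?nnegrE ?mulr_ge0 ?sqrtr_ge0// ?(ltW e0)//.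
  rewrite exprMn sqr_sqrtr ?exprn_ge0 ?ler0n//.
  have := H6 n n4; rewrite ler_pdivrMr ?ltr0n// => H; apply: (le_trans H).
  apply: ler_wpM2l; first by rewrite exprn_ge0// ltW.
  by apply: ler_eXnr; rewrite ?ler1n.
Qed.

End central_limit.

(** * The central limit theorem for nearly local sums *)

Lemma dist_le_quarters (R : realFieldType) (a b c g e : R) : 0 <= e ->
  `|a - c| <= e / 4 -> `|b - g| <= e / 4 -> `|c - g| <= e / 4 -> `|a - b| <= e.
Proof.
move=> e0 ac bg cg; have -> : a - b = (a - c) + ((c - g) - (b - g)) by ring.
have h3 := ler_normD (a - c) ((c - g) - (b - g)).
have h4 := ler_normB (c - g) (b - g); lra.
Qed.

Lemma le_eighths (R : realFieldType) (y z e : R) : y <= z -> z <= e / 8 -> e / 8 + y <= e / 4.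
Proof. by move=> yz ze; lra. Qed.

(** * From L2 approximation to weak convergence *)

Section gaussian_limit.
Context (R : realType) d (T : measurableType d) (P : probability T R).
Context (W : nat -> T -> R).
Hypothesis W_bdm : forall n, bdm (W n).
Hypothesis W_approx : forall e : R, 0 < e -> exists v N, forall n, (N <= n)%N ->
  exists V : T -> R, [/\ bdm V, L2 P (fun x => W n x - V x) <= e,
    `|L2 P V - v| <= e &
    forall K h h1 h2, taylor3 K h h1 h2 ->
      `|Ex P (fun x => h (V x)) - gauss_avg (L2 P V / Num.sqrt (gauss_m2 R)) h 0| <= K * e].

(** Each precision confines a tail of the sequence to a ball around [v]; completeness gives the
    limit without a formula for it. *)
Lemma L2_limit : exists s, forall e, 0 < e -> exists N, forall n, (N <= n)%N ->
  `|L2 P (W n) - s| <= e.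
Proof.
pose u n : R^o := L2 P (W n).
have cauchy_u : cauchy_ex (u @ \oo).
  move=> e e0; have e3 : 0 < e / 3 by rewrite divr_gt0.
  have [v [N H]] := W_approx e3; exists v; exists N => //= n /H[V [bV d1 d2 _]].
  rewrite /ball/= distrC.
  have h := le_trans (L2_dist P (W_bdm n) bV) d1.
  have -> : u n - v = (L2 P (W n) - L2 P V) + (L2 P V - v) by rewrite /u; ring.
  by apply: (le_lt_trans (ler_normD _ _)); lra.
have cu : cauchy (u @ \oo) by exact: cauchy_exP.
have : cvg (u @ \oo) by apply: R_complete cu.
move=> /cvg_ex[s cs].
exists s => e e0; have /cvgrPdist_le/(_ _ e0)[N _ H] := cs.
by exists N => n Nn; rewrite distrC; exact: H.
Qed.

Lemma bdm_compose (f : R -> R) (Z : T -> R) : bdm f -> bdm Z -> bdm (fun x => f (Z x)).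
Proof. by move=> bf [mZ _]; exact: (bdm_comp mZ bf). Qed.

Lemma lipschitz_ge0 (K : R) (h : R -> R) : (forall u v, `|h u - h v| <= K * `|u - v|) -> 0 <= K.
Proof. by move=> hK; have := hK 1 0; rewrite subr0 normr1 mulr1; exact: le_trans. Qed.

(** Three replacements: [W n] by its approximation [V] (Lipschitz bound), [V] by a Gaussian of the
    same second moment, and this Gaussian by the one of limiting scale. *)
Lemma smooth_limit s K C h h1 h2 : 
  (forall e, 0 < e -> exists N, forall n, (N <= n)%N -> `|L2 P (W n) - s| <= e) ->
  taylor3 C h h1 h2 -> (forall u v, `|h u - h v| <= K * `|u - v|) ->
  forall e, 0 < e -> exists N, forall n, (N <= n)%N ->
    `|Ex P (fun x => h (W n x)) - gauss_avg (s / Num.sqrt (gauss_m2 R)) h 0| <= e.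
Proof.
move=> cs hT hK e e0; have C0 := taylor3_ge0 hT; have K0 := lipschitz_ge0 hK.
have [bh _ _ _] := hT.
have g0 : 0 < Num.sqrt (gauss_m2 R) by rewrite sqrtr_gt0 gauss_m2_gt0.
have g3 := gauss_m3_ge0 R.
pose L := K * (1 + gauss_m3 R) / Num.sqrt (gauss_m2 R).
have L0 : 0 <= L by rewrite divr_ge0 ?(ltW g0)// mulr_ge0 ?addr_ge0.
(* Collects the constants of the three replacements, so that the total error is (D - 1) e / D; the
   factor 2 is there because [L2 P V] is within 2 e / D of [s]. *)
pose D := K + C + L * 2 + 1.
have D0 : 0 < D by rewrite /D; lra.
have ed : 0 < e / D by rewrite divr_gt0.
have [v [N1 H1]] := W_approx ed; have [N2 H2] := cs _ ed.
exists (maxn N1 N2) => n; rewrite geq_max => /andP[n1 n2].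
have [V [bV d1 d2 d3]] := H1 n n1; have {}d3 := d3 _ _ _ _ hT; have {}H2 := H2 n n2.
have bWV := bdmB (W_bdm n) bV.
have E1 : `|Ex P (fun x => h (W n x)) - Ex P (fun x => h (V x))| <= K * (e / D).
  apply: (@le_trans _ _ (Ex P (fun x => K * `|W n x - V x|))).
    apply: le_Ex_dist; [exact: bdm_compose | exact: bdm_compose | exact: (bdmZ K (bdm_norm bWV)) |].
    by move=> x; exact: hK.
  rewrite ExZ; last exact: bdm_norm.
  by apply: ler_wpM2l => //; apply: (le_trans (L1_le_L2 P bWV)).
have E2 : `|gauss_avg (L2 P V / Num.sqrt (gauss_m2 R)) h 0 -
    gauss_avg (s / Num.sqrt (gauss_m2 R)) h 0| <= L * (2 * (e / D)).
  apply: (le_trans (gauss_avg_lipschitz _ _ _ bh hK)).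
  rewrite -mulrBl normrM normfV (gtr0_norm g0) /L.
  have -> : K * (1 + gauss_m3 R) * (`|L2 P V - s| / Num.sqrt (gauss_m2 R)) =
    K * (1 + gauss_m3 R) / Num.sqrt (gauss_m2 R) * `|L2 P V - s| by ring.
  apply: ler_wpM2l => //.
  have -> : L2 P V - s = (L2 P (W n) - s) - (L2 P (W n) - L2 P V) by ring.
  apply: (le_trans (ler_normB _ _)).
  have := le_trans (L2_dist P (W_bdm n) bV) d1; lra.
move: E1 E2 d3; set a := Ex P (fun x => h (W n x)); set c := Ex P (fun x => h (V x)).
set g := gauss_avg (L2 P V / _) h 0; set b := gauss_avg (s / _) h 0 => E1 E2 d3.
have -> : a - b = (a - c) + ((c - g) + (g - b)) by ring.
apply: (le_trans (ler_normD _ _)); apply: (@le_trans _ _ (K * (e / D) + (C * (e / D) + L * (2 * (e / D))))).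
  by apply: lerD => //; apply: (le_trans (ler_normD _ _)); exact: lerD.
have -> : K * (e / D) + (C * (e / D) + L * (2 * (e / D))) = (D - 1) * (e / D).
  by rewrite /D; ring.
rewrite mulrBl mul1r mulrCA divff ?gt_eqF// mulr1.
by rewrite gerBl ltW.
Qed.

(** A bounded majorant of the indicator of |w| >= 1 that is itself at most w^2: it carries
    Chebyshev's inequality within [bdm] functions. *)
Definition clip (w : R) : R := Num.min 1 (w ^+ 2).

Lemma clip01 w : 0 <= clip w <= 1.
Proof. by rewrite /clip le_min ler01 sqr_ge0 ge_min lexx. Qed.

Lemma bdm_clip : bdm clip.
Proof.
split; last first.
  by exists 1 => w; have /andP[h0 h1] := clip01 w; rewrite ger0_norm.
apply: continuous_measurable_fun => x.
apply: (@continuous_min R R (fun=> 1) (fun w => w ^+ 2)); first exact: cvg_cst.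
exact: sqr_continuous.
Qed.

Lemma approx_tail (f h : R -> R) (M A e : R) : 0 < A ->
  (forall x, `|f x| <= M) -> (forall x, `|h x| <= M) ->
  (forall x, `|x| <= A -> `|h x - f x| <= e) ->
  forall w, `|f w - h w| <= `|e| + 2 * M * clip (w / A).
Proof.
move=> A0 fM hM hf w; have /andP[c0 c1] := clip01 (w / A).
have M0 : 0 <= M by exact: le_trans (fM 0).
have [wA|wA] := leP `|w| A.
  rewrite distrC; apply: (le_trans (hf _ wA)); apply: (le_trans (ler_norm _)).
  by rewrite lerDl !mulr_ge0.
have -> : clip (w / A) = 1.
  rewrite /clip min_l// -real_normK ?num_real//; apply: exprn_ege1.
  by rewrite normrM normfV (gtr0_norm A0) ler_pdivlMr// mul1r ltW.
rewrite mulr1; apply: (le_trans (ler_normB _ _)).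
have := fM w; have := hM w; have := normr_ge0 e; lra.
Qed.

(** Outside [-A, A] the smooth approximation is only known to be bounded, but the second moments of
    both laws are at most S, so the tails cost at most 2 M S / A^2. *)
Theorem gaussian_limit s : 0 < s ->
  (forall e, 0 < e -> exists N, forall n, (N <= n)%N -> `|L2 P (W n) - s| <= e) ->
  forall f : R -> R, continuous f -> (exists M : R, forall y, `|f y| <= M) ->
  forall e, 0 < e -> exists N, forall n, (N <= n)%N ->
  `|Ex P (fun x => f (W n x)) - Ex (normal_prob 0 (s / Num.sqrt (gauss_m2 R))) f| <= e.
Proof.
move=> s0 cs f cf [M0 fM0] e e0.
pose M := `|M0| + 1.
have fM y : `|f y| <= M.
  by apply: (le_trans (fM0 y)); apply: (le_trans (ler_norm _)); rewrite /M lerDl.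
have M1 : 1 <= M by rewrite /M lerDr.
have M_gt0 : 0 < M by lra.
(* Bounds the second moment of [W n] for large n, its L2 norm being within 1 of [s], and that of the
   limit, which is s^2. *)
pose S := (s + 1) ^+ 2.
have S0 : 0 < S by rewrite exprn_gt0// addr_gt0.
(* As A >= 1, this gives 2 M S / A^2 <= 2 M S / A <= e / 8. *)
pose A := 1 + 16 * M * S / e.
have B0 : 0 < 16 * M * S / e by apply: divr_gt0 => //; do 2! apply: mulr_gt0 => //.
have A1 : 1 <= A by rewrite /A lerDl ltW.
have A0 : 0 < A by exact: lt_le_trans A1.
have A2 : 2 * M * (S / A ^+ 2) <= e / 8.
  rewrite mulrA ler_pdivrMr ?exprn_gt0//.
  have AA : A <= A ^+ 2 by rewrite expr2 ler_peMr// ltW.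
  apply: (@le_trans _ _ (e / 8 * A)); last by apply: ler_wpM2l => //; rewrite divr_ge0 ?(ltW e0).
  have -> : e / 8 * A = e / 8 + 2 * M * S by rewrite /A; field; rewrite gt_eqF.
  by rewrite lerDr divr_ge0// ltW.
have e8 : 0 < e / 8 by rewrite divr_gt0.
have [h [h1 [h2 [C [K [hT hK hM hf]]]]]] := smooth_approx cf fM e8 (ltW A0).
have [bh _ _ _] := hT.
have bf : bdm f := continuous_bdm cf fM.
have e4 : 0 < e / 4 by rewrite divr_gt0.
have [N1 H1] := smooth_limit cs hT hK e4.
have [N2 H2] := cs 1 ltr01.
exists (maxn N1 N2) => n; rewrite geq_max => /andP[n1 n2].
have tail := approx_tail A0 fM hM hf.
rewrite (gtr0_norm e8) in tail.
have bclip d' (T' : measurableType d') (P' : probability T' R) (Z : T' -> R) :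
    measurable_fun setT Z -> bdm (fun x => clip (Z x / A)).
  move=> mZ; apply: (bdm_comp (phi := fun x => Z x / A : measurableTypeR R)); last exact: bdm_clip.
  exact: measurable_funM.
have tailE d' (T' : measurableType d') (P' : probability T' R) (Z : T' -> R) :
    measurable_fun setT Z ->
    `|Ex P' (fun x => f (Z x)) - Ex P' (fun x => h (Z x))| <=
      e / 8 + 2 * M * Ex P' (fun x => clip (Z x / A)).
  move=> mZ; have bc := bclip _ _ P' _ mZ.
  have -> : e / 8 + 2 * M * Ex P' (fun x => clip (Z x / A)) =
      Ex P' (fun x => e / 8 + 2 * M * clip (Z x / A)).
    by rewrite (ExD _ (bdm_cst _ _) (bdmZ _ bc)) Ex_cst (ExZ _ _ bc).
  apply: le_Ex_dist; [exact: (bdm_comp mZ bf)|exact: (bdm_comp mZ bh)| |] => //.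
  by apply: bdmD; [exact: bdm_cst | exact: bdmZ].
have T1 := tailE _ _ P (W n) (W_bdm n).1.
have clipW : Ex P (fun x => clip (W n x / A)) <= S / A ^+ 2.
  apply: (@le_trans _ _ (Ex P (fun x => (A ^+ 2)^-1 * W n x ^+ 2))).
    apply: le_Ex; [exact: (bclip _ _ P _ (W_bdm n).1) | exact: (bdmZ _ (bdmX 2 (W_bdm n))) |].
    by move=> x; rewrite /clip ge_min exprMn exprVn mulrC lexx orbT.
  rewrite (ExZ _ _ (bdmX 2 (W_bdm n))) -L2_sqr mulrC; apply: ler_wpM2r.
    by rewrite invr_ge0 exprn_ge0// ltW.
  rewrite /S ler_pXn2r ?nnegrE ?L2_ge0 ?addr_ge0 ?(ltW s0)//.
  by have := H2 n n2; rewrite ler_norml => /andP[_]; lra.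
have g0 : 0 < gauss_m2 R := gauss_m2_gt0 R.
have sg0 : 0 < Num.sqrt (gauss_m2 R) by rewrite sqrtr_gt0.
pose r := s / Num.sqrt (gauss_m2 R).
have r0 : 0 < r by rewrite divr_gt0.
have mr : measurable_fun setT (fun z : measurableTypeR R => 0 + r * z : R) by exact: measurable_affine.
have T2 := tailE _ _ (normal_prob (0 : R) 1) (fun z => 0 + r * z) mr.
have clipZ : Ex (normal_prob (0 : R) 1) (fun z => clip ((0 + r * z) / A)) <= S / A ^+ 2.
  apply: (@le_trans _ _ (\int[normal_prob (0 : R) 1]_z (r ^+ 2 / A ^+ 2 * z ^+ 2))).
    apply: le_Rintegral => //.
    - exact: (bdm_integrable _ (bclip _ _ (normal_prob (0 : R) 1) _ mr)).
    - have -> : EFin \o (fun z : R => r ^+ 2 / A ^+ 2 * z ^+ 2) =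
        (fun z => (r ^+ 2 / A ^+ 2)%:E * (z ^+ 2)%:E)%E by [].
      by apply: integrableZl => //; exact: (@integrable_N01_pow R 2).
    - move=> z _; rewrite /clip ge_min; apply/orP; right; rewrite add0r.
      by rewrite le_eqVlt; apply/orP; left; apply/eqP; field; rewrite gt_eqF.
  rewrite RintegralZl//; last exact: (@integrable_N01_pow R 2).
  rewrite -/(gauss_m2 R) /r exprMn exprVn sqr_sqrtr ?(ltW g0)//.
  have -> : s ^+ 2 / gauss_m2 R / A ^+ 2 * gauss_m2 R = s ^+ 2 / A ^+ 2.
    by field; rewrite !gt_eqF.
  apply: ler_wpM2r; first by rewrite invr_ge0 exprn_ge0// ltW.
  by rewrite /S ler_pXn2r ?nnegrE ?addr_ge0 ?(ltW s0)// lerDl.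
rewrite (Ex_normal_affine 0 r0 bf).
have {}H1 := H1 n n1; rewrite -/r /gauss_avg in H1.
have M2 : 0 <= 2 * M by rewrite mulr_ge0 ?(ltW M_gt0).
have half (y z : R) : y <= e / 8 + 2 * M * z -> z <= S / A ^+ 2 -> y <= e / 4.
  by move=> yz zS; apply: (le_trans yz); exact: (le_eighths (ler_wpM2l M2 zS) A2).
exact: (dist_le_quarters (ltW e0) (half _ _ T1 clipW) (half _ _ T2 clipZ) H1).
Qed.

End gaussian_limit.

Lemma card_inner (d k N : nat) : ((N - 2 * k) ^ d <=
  #|[pred f : {ffun 'I_d -> 'I_N} | [forall i, (k <= f i < N - k)%N]]|)%N.
Proof.
case: N => [|N].
  case: d => [|e]; last by rewrite sub0n exp0n.
  rewrite expn0; apply/card_gt0P.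
  by exists (ffun0 (card_ord 0)); rewrite inE; apply/forallP => -[].
pose F (y : {ffun 'I_d -> 'I_(N.+1 - 2 * k)}) : {ffun 'I_d -> 'I_N.+1} := [ffun i => inord (k + y i)].
have FE y i : F y i = (k + y i)%N :> nat.
  by rewrite ffunE inordK//; have := ltn_ord (y i); lia.
have Finj : injective F.
  move=> y y' E; apply/ffunP => i; apply: val_inj => /=.
  by have := FE y i; rewrite E FE; lia.
have -> : ((N.+1 - 2 * k) ^ d = #|F @: {: {ffun 'I_d -> 'I_(N.+1 - 2 * k)}}|)%N.
  by rewrite card_imset// card_ffun !card_ord.
apply: subset_leq_card; apply/fintype.subsetP => f /imsetP[y _ ->].
rewrite inE; apply/forallP => i; rewrite FE leq_addr; have := ltn_ord (y i).
by move: (nat_of_ord (y i)) => m; lia.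
Qed.

(** * Lower bound on the variance *)

Section variance_lower_bound.
Context (R : realType) (d : nat).
Notation field := (field R (index d)).
Context (Q : probability field R) (X : lattice d -> field -> R) (g : lattice d -> field -> R).
Context (K kappa : R) (k : nat).
Hypothesis X_bdm : forall u, bdm (X u).
Hypothesis g_bdm : forall u, bdm (g u).
Hypothesis K_gt0 : 0 < K.
Hypothesis kappa_gt0 : 0 < kappa.
Hypothesis g_var : forall N (P : pred {ffun 'I_d -> 'I_N}),
  var Q (fun x => \sum_(f | P f) g (pt 1 f) x) <= K * #|P|%:R.
Hypothesis g_cov : forall n z, (forall i, k%:Z < tnth z i <= n%:Z - k%:Z) ->
  kappa <= cov Q (site_sum X n) (g z).

(** For n >= 4k at least (n/2)^d sites keep the distance k from the boundary of the cube, whence the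
    factor 2^d. *)
Lemma var_site_sum_ge n : (4 * k <= n)%N -> (0 < n)%N ->
  kappa ^+ 2 / K / 2 ^+ d * n%:R ^+ d <= var Q (site_sum X n).
Proof.
move=> kn n0.
pose P := [pred f : {ffun 'I_d -> 'I_n} | [forall i, (k <= f i < n - k)%N]].
have P0 : (0 < #|P|)%N.
  by apply: leq_trans (card_inner d k n); rewrite expn_gt0; apply/orP; left; lia.
have P0R : 0 < #|P|%:R :> R by rewrite ltr0n.
pose G x := \sum_(f | P f) g (pt 1 f) x.
have bG : bdm G by exact: bdm_sum.
have bS := bdm_site_sum X_bdm n.
have covG : kappa * #|P|%:R <= cov Q (site_sum X n) G.
  have -> : cov Q (site_sum X n) G = \sum_(f | P f) cov Q (site_sum X n) (g (pt 1 f)).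
    have := cov_sum Q (index_enum 'I_1) (index_enum {ffun 'I_d -> 'I_n}) xpredT P
      (fun _ => bS) (fun f => g_bdm (pt 1 f)).
    rewrite big_ord1 => <-; congr cov.
    by apply/funext => x; rewrite big_ord1.
  rewrite mulr_natr -sumr_const; apply: ler_sum => f Pf; apply: g_cov => i.
  by move: Pf; rewrite inE => /forallP/(_ i); rewrite tnth_pt; lia.
have c0 : 0 <= kappa * #|P|%:R by rewrite mulr_ge0 ?ltW.
have H : (kappa * #|P|%:R) ^+ 2 <= var Q (site_sum X n) * (K * #|P|%:R).
  apply: (@le_trans _ _ (cov Q (site_sum X n) G ^+ 2)).
    by rewrite ler_pXn2r ?nnegrE// (le_trans c0).
  apply: (le_trans (cov_sqr_le Q bS bG)); apply: ler_wpM2l; first exact: var_ge0.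
  exact: g_var.
have H2 : kappa ^+ 2 / K * #|P|%:R <= var Q (site_sum X n).
  rewrite -(ler_pM2r (mulr_gt0 K_gt0 P0R)); apply: le_trans H.
  by rewrite le_eqVlt; apply/orP; left; apply/eqP; field; rewrite gt_eqF.
apply: le_trans H2; rewrite -mulrA; apply: ler_wpM2l.
  by rewrite divr_ge0 ?exprn_ge0 ?ltW.
apply: (@le_trans _ _ ((n - 2 * k) ^ d)%:R); last by rewrite ler_nat card_inner.
rewrite mulrC ler_pdivrMr ?exprn_gt0// natrX -exprMn.
apply: lerXn2r; rewrite ?nnegrE ?mulr_ge0 ?ler0n//.
by rewrite -natrM ler_nat; lia.
Qed.

End variance_lower_bound.

Lemma pos_of_close (R : realFieldType) (a b c s : R) :
  0 < c -> a - s <= c / 4 -> b <= c / 4 -> c - b <= a -> 0 < s.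
Proof. by move=> c0 h1 h2 h3; lra. Qed.

Section central_limit_theorem.
Context (R : realType) (d : nat).
Notation field := (field R (index d)).
Context (Q : probability field R) (iQ : independent_coordinates Q).
Hypothesis Q_shift : forall a i (B : set R), measurable B ->
  Q [set x | B (x (shift_index a i))] = Q [set x | B (x i)].
Context (X : lattice d -> field -> R) (C : R).
Hypothesis d_gt0 : (0 < d)%N.
Hypothesis X_bdm : forall u, bdm (X u).
Hypothesis X01 : forall u x, 0 <= X u x <= 1.
Hypothesis X_shift : forall a u x, X (shift_site a u) x = X u (shift_field a x).
Hypothesis C_ge1 : 1 <= C.
Hypothesis X_local : forall u r,
  Ex Q (fun x : field => `|X u x - X u (trunc (inball u r) x)|) <= C / r.+1%:R ^+ (4 * d).
Context (Y : nat -> field -> R) (C' : R).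
Hypothesis Y_bdm : forall n, bdm (Y n).
Hypothesis Y_var : forall n, (0 < n)%N -> var Q (Y n) <= C' * n%:R ^+ d.-1.
Hypothesis C'_ge0 : 0 <= C'.
Context (c0 : R) (N0 : nat).
Hypothesis c0_gt0 : 0 < c0.
Hypothesis X_nondegenerate : forall n, (N0 <= n)%N -> c0 * n%:R ^+ d <= var Q (site_sum X n).

Notation rt n := (Num.sqrt (n%:R ^+ d : R)).

Lemma normalized_L2_ge n : (N0 <= n.+1)%N ->
  Num.sqrt c0 - Num.sqrt (C' / n.+1%:R) <= L2 Q (normalized Q X Y n.+1).
Proof.
move=> Nn; have bS := bdm_site_sum X_bdm n.+1; have rt0 := rt_gt0 R d n.
have nd0 : 0 < n.+1%:R ^+ d :> R by rewrite exprn_gt0// ltr0n.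
have bT : bdm (total X Y n.+1) by exact: bdmD.
have -> : L2 Q (normalized Q X Y n.+1) = (rt n.+1)^-1 * sd Q (total X Y n.+1).
  rewrite -[X in X * _]ger0_norm ?invr_ge0 ?sqrtr_ge0// -L2Z//; exact: bdm_center.
rewrite lerBlDr.
have r1 := sd_remainder d_gt0 Y_bdm Y_var n.
apply: (@le_trans _ _ ((rt n.+1)^-1 * sd Q (site_sum X n.+1))).
  rewrite sd_sqrt// sqrtr_div ?(ltW nd0)//; apply: ler_wsqrtr.
  by rewrite ler_pdivlMr//; exact: X_nondegenerate.
apply: (le_trans _ (lerD (lexx _) r1)); rewrite -mulrDr; apply: ler_wpM2l.
  by rewrite invr_ge0 ltW.
have EN : sd Q (fun x => - Y n.+1 x) = sd Q (Y n.+1).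
  have := sdZ Q (-1) (Y_bdm n.+1); rewrite normrN1 mul1r => <-.
  by congr sd; apply/funext => x; rewrite mulN1r.
have ES : (fun x => total X Y n.+1 x + - Y n.+1 x) = site_sum X n.+1.
  by apply/funext => x; rewrite /total addrK.
have := sdD Q bT (bdmN (Y_bdm n.+1)); rewrite EN ES; exact.
Qed.

Theorem central_limit_theorem : exists2 s : R, 0 < s &
  forall f : R -> R, continuous f -> (exists M : R, forall y, `|f y| <= M) ->
  forall e, 0 < e -> exists N, forall n, (N <= n)%N ->
  `|Ex Q (fun x => f (normalized Q X Y n.+1 x)) - Ex (normal_prob 0 s) f| <= e.
Proof.
have bW n : bdm (normalized Q X Y n.+1) by exact: bdm_normalized.
have approx := block_approximation iQ Q_shift d_gt0 X_bdm X01 X_shift C_ge1 X_local Y_bdm Y_var C'_ge0.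
have [s cs] := L2_limit bW approx.
have sc0 : 0 < Num.sqrt c0 by rewrite sqrtr_gt0.
have e0 : 0 < Num.sqrt c0 / 4 by rewrite divr_gt0.
have [N1 H1] := cs _ e0.
have [N2 H2] := exists_div_le C' (exprn_gt0 2 e0).
have s0 : 0 < s.
  pose n := maxn N0 (maxn N1 N2).
  have {}H1 : `|L2 Q (normalized Q X Y n.+1) - s| <= Num.sqrt c0 / 4.
    by apply: H1; rewrite /n; lia.
  have {}H2 : Num.sqrt (C' / n.+1%:R) <= Num.sqrt c0 / 4.
    rewrite -[leRHS]ger0_norm ?(ltW e0)// -sqrtr_sqr; apply: ler_wsqrtr.
    by apply: H2; rewrite /n; lia.
  have H3 : Num.sqrt c0 - Num.sqrt (C' / n.+1%:R) <= L2 Q (normalized Q X Y n.+1).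
    by apply: normalized_L2_ge; rewrite /n; lia.
  move: H1; rewrite ler_norml => /andP[_ H1].
  exact: pos_of_close sc0 H1 H2 H3.
exists (s / Num.sqrt (gauss_m2 R)); first by rewrite divr_gt0// sqrtr_gt0 gauss_m2_gt0.
move=> f cf bf e he.
have [N H] := gaussian_limit bW approx s0 cs cf bf he.
exists N => n Nn; exact: H.
Qed.

End central_limit_theorem.

(** * The graph as a function of the field *)

Section lattice_geometry.
Context (d : nat).
Implicit Types (u v a : lattice d) (w : lattice d -> bool).

Lemma heightE u (i : 'I_d) : i.+1 = d :> nat -> height u = tnth u i.
Proof.
move=> id; rewrite /height (tnth_nth 0) -nth_last size_tuple.
by congr nth; rewrite -[in LHS]id.
Qed.

Lemma height_shift a u : height (shift_site a u) = height u + height a.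
Proof.
case: (posnP d) => [d0|dpos].
  by move: a u; rewrite d0 => a u; rewrite !(tuple0 (shift_site _ _)) (tuple0 a) (tuple0 u).
have di : (d.-1 < d)%N by rewrite prednK.
have H : (Ordinal di).+1 = d :> nat by rewrite /= prednK.
by rewrite !(heightE _ H) tnth_shift_site.
Qed.

Lemma l1dist_shift a u v : l1dist (shift_site a u) (shift_site a v) = l1dist u v.
Proof.
apply: eq_bigr => i _; rewrite !tnth_shift_site; congr absz.
by rewrite opprD addrACA subrr addr0.
Qed.

Lemma l1distC u v : l1dist u v = l1dist v u.
Proof. by apply: eq_bigr => i _; lia. Qed.

Lemma l1dist0 u : l1dist u u = 0%N.
Proof. by apply: big1 => i _; rewrite subrr. Qed.

Lemma l1dist_coord u v i : (`|(tnth u i - tnth v i)%R| <= l1dist u v)%N.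
Proof. by rewrite /l1dist (bigD1 i)//= leq_addr. Qed.

Lemma near_l1dist u v (r : nat) : (l1dist u v <= r)%N -> near r u v.
Proof. by move=> uv; apply/nearP => i; exact: leq_trans (l1dist_coord u v i) uv. Qed.

Lemma l1dist_near u v (r : nat) : near r u v -> (l1dist u v <= d * r)%N.
Proof.
move=> /nearP uv; apply: (@leq_trans (\sum_(i < d) r)%N); first exact: leq_sum.
by rewrite sum_nat_const card_ord.
Qed.

Lemma nearest_height w u v : nearest w u v -> height v = height u - 1.
Proof. by case=> -[]. Qed.

Lemma nearest_open w u v : nearest w u v -> w v.
Proof. by case=> -[]. Qed.

(** An open site at distance at most r below [u] screens everything beyond distance r. *)
Lemma nearest_local w w' u v (r : nat) :
  (forall v', (l1dist u v' <= r)%N -> w v' = w' v') ->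
  open_below w u v -> (l1dist u v <= r)%N ->
  nearest w u = nearest w' u.
Proof.
move=> ww' [wv hv] uv.
have sub (w1 w2 : lattice d -> bool) : (forall v', (l1dist u v' <= r)%N -> w1 v' = w2 v') ->
    w1 v -> forall v', nearest w1 u v' -> nearest w2 u v'.
  move=> w12 w1v v' [[w1v' hv'] m].
  have uv' : (l1dist u v' <= r)%N by apply: leq_trans uv; exact: m.
  split; first by split; rewrite -?w12.
  move=> v'' [w2v'' hv'']; case: (leqP (l1dist u v'') r) => [ur|/ltnW]; last exact: leq_trans.
  by apply: m; split; rewrite ?w12.
apply/seteqP; split; apply: sub => //.
- by move=> v' /ww' ->.
- by rewrite -ww'.
Qed.

Lemma nearest_shift w a u v :
  nearest (fun v => w (shift_site a v)) u v <-> nearest w (shift_site a u) (shift_site a v).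
Proof.
have sK v' : shift_site a (shift_site (neg_site a) v') = v'.
  by apply: eq_from_tnth => i; rewrite !tnth_shift_site tnth_mktuple subrK.
have hE v' : height (shift_site a v') = height (shift_site a u) - 1 <-> height v' = height u - 1.
  by rewrite !height_shift; split; lia.
split=> -[[wv hv] m]; split; try by split => //; apply/hE.
- move=> v' [wv' hv']; rewrite -(sK v') !l1dist_shift; apply: m; split; rewrite ?sK//.
  by apply/hE; rewrite sK.
- by move=> v' [wv' hv']; rewrite -(l1dist_shift a) -(l1dist_shift a u v'); apply: m; split=> //; apply/hE.
Qed.

End lattice_geometry.

Section field_graph.
Context (R : realType) (d : nat).
Notation field := (field R (index d)).
Implicit Types (x : field) (u v a : lattice d).

Definition opn x u : bool := x (inl u) != 0.

(** A strict inequality between labels stands in for the choice made by [ancestor]: if the minimum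
    is attained twice, [v] is nobody's child. The relation thereby commutes with translations. *)
Definition child x u v : Prop := [/\ opn x v, nearest (opn x) v u &
  forall v', nearest (opn x) v v' -> v' <> u -> x (inr (v, u)) < x (inr (v, v'))].

(** The count is phrased through a finite set because there are only countably many of them, which
    gives measurability by a countable union. *)
Definition has_children (k : nat) x u : Prop :=
  exists F : {fset lattice d}, #|` F| = k /\ forall v, v \in F <-> child x u v.

Definition degree_ind (k : nat) u x : R := (`[< opn x u /\ has_children k x u >])%:R.

(** All nearest vertices are equidistant from [u], so the length of the edge below [u] is known
    without knowing which of them is chosen. *)
Definition length_ind (l : nat) u x : R :=
  (`[< opn x u /\ exists v, nearest (opn x) u v /\ l1dist u v = l >])%:R.

Lemma natr_bool01 (b : bool) : 0 <= (b%:R : R) <= 1.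
Proof. by case: b; rewrite ?lexx ?ler01. Qed.

Lemma opn_shift a x : opn (shift_field a x) = (fun v => opn x (shift_site a v)).
Proof. by []. Qed.

Lemma child_shift a x u v :
  child (shift_field a x) u v <-> child x (shift_site a u) (shift_site a v).
Proof.
have sK v' : shift_site a (shift_site (neg_site a) v') = v'.
  by apply: eq_from_tnth => i; rewrite !tnth_shift_site tnth_mktuple subrK.
rewrite /child opn_shift; split=> -[h1 h2 h3]; split => //.
- exact/(nearest_shift (opn x) a).
- move=> v'; rewrite -(sK v') => /(nearest_shift (opn x) a) nv nvu; apply: (h3 _ nv).
  by move=> E; apply: nvu; rewrite E.
- exact/(nearest_shift (opn x) a).
- move=> v' /(nearest_shift (opn x) a) nv nvu; apply: (h3 _ nv).
  by move/(can_inj (shift_siteK a)).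
Qed.

Lemma has_children_shift k a x u :
  has_children k (shift_field a x) u <-> has_children k x (shift_site a u).
Proof.
have sK v' : shift_site a (shift_site (neg_site a) v') = v'.
  by apply: eq_from_tnth => i; rewrite !tnth_shift_site tnth_mktuple subrK.
split=> -[F [Fk FP]].
- exists [fset shift_site a v | v in F]%fset; split.
    by rewrite card_imfset//; exact: (can_inj (shift_siteK a)).
  move=> v; split.
    by move=> /imfsetP[v' /= /FP/child_shift cv ->].
  move=> cv; apply/imfsetP; exists (shift_site (neg_site a) v); rewrite ?sK//=.
  by apply/FP/child_shift; rewrite sK.
- exists [fset shift_site (neg_site a) v | v in F]%fset; split.
    by rewrite card_imfset//; exact: (can_inj sK).
  move=> v; split.
    by move=> /imfsetP[v' /= /FP cv ->]; apply/child_shift; rewrite sK.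
  move=> cv; apply/imfsetP; exists (shift_site a v); rewrite ?shift_siteK//=.
  by apply/FP/child_shift.
Qed.

Lemma degree_ind_shift k a u x : degree_ind k (shift_site a u) x = degree_ind k u (shift_field a x).
Proof.
congr (_%:R); congr nat_of_bool; apply/asboolP/asboolP => -[h1 h2]; split => //.
  exact/has_children_shift.
exact/has_children_shift.
Qed.

Lemma length_ind_shift l a u x : length_ind l (shift_site a u) x = length_ind l u (shift_field a x).
Proof.
have sK v' : shift_site a (shift_site (neg_site a) v') = v'.
  by apply: eq_from_tnth => i; rewrite !tnth_shift_site tnth_mktuple subrK.
congr (_%:R); congr nat_of_bool; apply/asboolP/asboolP => -[h1 [v [nv lv]]]; split => //.
  exists (shift_site (neg_site a) v); split.
    by rewrite opn_shift; apply/(nearest_shift (opn x) a); rewrite sK.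
  by rewrite -lv -(l1dist_shift a) sK.
exists (shift_site a v); split; last by rewrite l1dist_shift.
by apply/(nearest_shift (opn x) a); rewrite -opn_shift.
Qed.

End field_graph.

(** * Measurability of the graph *)

Section measurable_predicates.
Context d (T : measurableType d).
Implicit Types A B : T -> Prop.

Definition mpred A := measurable [set t | A t].

Lemma mpred_ext A B : (forall t, A t <-> B t) -> mpred A -> mpred B.
Proof. by move=> AB; congr measurable; apply/seteqP; split=> t /AB. Qed.

Lemma mpred_cst (P : Prop) : mpred (fun=> P).
Proof.
rewrite /mpred; have [p|np] := pselect P.
  by rewrite (_ : [set _ | _] = setT)//; apply/seteqP; split.
by rewrite (_ : [set _ | _] = set0)//; apply/seteqP; split.
Qed.

Lemma mpred_and A B : mpred A -> mpred B -> mpred (fun t => A t /\ B t).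
Proof. exact: measurableI. Qed.

Lemma mpred_not A : mpred A -> mpred (fun t => ~ A t).
Proof. exact: measurableC. Qed.

Lemma mpred_or A B : mpred A -> mpred B -> mpred (fun t => A t \/ B t).
Proof. exact: measurableU. Qed.

Lemma mpred_imply A B : mpred A -> mpred B -> mpred (fun t => A t -> B t).
Proof.
move=> mA mB; apply: (@mpred_ext (fun t => ~ A t \/ B t)); last first.
  by apply: mpred_or => //; exact: mpred_not.
by move=> t; split=> [[nA /nA|]//|AB]; have [/AB|] := pselect (A t); [right|left].
Qed.

Lemma mpred_iff A B : mpred A -> mpred B -> mpred (fun t => A t <-> B t).
Proof. by move=> mA mB; apply: mpred_and; exact: mpred_imply. Qed.

Lemma mpred_exists (I : countType) (A : I -> T -> Prop) :
  (forall i, mpred (A i)) -> mpred (fun t => exists i, A i t).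
Proof.
move=> mA; rewrite /mpred.
have -> : [set t | exists i, A i t] = \bigcup_(i in [set: I]) [set t | A i t].
  by apply/seteqP; split => t; [move=> [i Ai]; exists i | move=> [i _ Ai]; exists i].
by apply: countable_bigcupT_measurable => //; exact: countableP.
Qed.

Lemma mpred_forall (I : countType) (A : I -> T -> Prop) :
  (forall i, mpred (A i)) -> mpred (fun t => forall i, A i t).
Proof.
move=> mA; apply: (@mpred_ext (fun t => ~ exists i, ~ A i t)).
  move=> t; split=> [H i|H [i nA]]; last exact: nA (H i).
  by apply: contrapT => nA; apply: H; exists i.
by apply: mpred_not; apply: mpred_exists => i; exact: mpred_not.
Qed.

Lemma bdm_asbool (R : realType) A : mpred A -> bdm (fun t => (`[< A t >])%:R : R).
Proof.
move=> mA; apply: (bdm_bool R (b := fun t => `[< A t >])).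
by congr measurable: mA; apply/seteqP; split=> t /= /asboolP.
Qed.

End measurable_predicates.

Section graph_measurability.
Context (R : realType) (d : nat) d' (T : measurableType d').
Context (w : T -> lattice d -> bool) (U : T -> lattice d * lattice d -> R).
Hypothesis mw : forall v, mpred (fun t => w t v).
Hypothesis mU : forall a, measurable_fun setT (fun t => U t a).

Lemma mpred_nearest u v : mpred (fun t => nearest (w t) u v).
Proof.
apply: mpred_and; first by apply: mpred_and => //; exact: mpred_cst.
apply: mpred_forall => v'; apply: mpred_imply; last exact: mpred_cst.
by apply: mpred_and => //; exact: mpred_cst.
Qed.

Lemma mpred_lt (f g : T -> R) : measurable_fun setT f -> measurable_fun setT g ->
  mpred (fun t => f t < g t).
Proof.
move=> mf mg; have := measurable_fun_ltr mf mg measurableT (Y := [set true]) I.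
by rewrite setTI; congr measurable; apply/seteqP; split.
Qed.

Lemma mpred_le (f g : T -> R) : measurable_fun setT f -> measurable_fun setT g ->
  mpred (fun t => f t <= g t).
Proof.
move=> mf mg; apply: (@mpred_ext _ _ (fun t => ~ (g t < f t))).
  by move=> t; rewrite ltNge; split => [/negP/negbNE|->].
by apply: mpred_not; exact: mpred_lt.
Qed.

End graph_measurability.

Section finiteness.
Context (d : nat).
Implicit Types (u v : lattice d) (w : lattice d -> bool).

Lemma finite_near u r : finite_set [set v | near r u v].
Proof.
pose F (f : {ffun 'I_d -> 'I_(2 * r).+1}) : lattice d := [tuple tnth u i - r%:Z + (f i)%:Z | i < d].
apply: (sub_finite_set (B := range F)); last exact: finite_image.
move=> v /nearP uv; exists [ffun i => inord `|(tnth v i - tnth u i + r%:Z)%R|] => //.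
apply: eq_from_tnth => i; rewrite tnth_mktuple ffunE inordK; have := uv i.
  by move: (tnth u i) (tnth v i) => a b; lia.
by move: (tnth u i) (tnth v i) => a b; lia.
Qed.

Lemma finite_nearest w u : finite_set (nearest w u).
Proof.
have [[v nv]|nn] := pselect (exists v, nearest w u v).
  apply: sub_finite_set (finite_near u (l1dist u v)) => v' nv'.
  apply: near_l1dist; case: nv' => _; apply; exact: nv.1.
rewrite (_ : nearest w u = set0)//.
by apply/seteqP; split => // v nv; apply: nn; exists v.
Qed.

End finiteness.

Section ancestor_measurability.
Context (R : realType) (d : nat) d' (T : measurableType d').
Context (w : T -> lattice d -> bool) (U : T -> lattice d * lattice d -> R).
Hypothesis mw : forall v, mpred (fun t => w t v).
Hypothesis mU : forall a, measurable_fun setT (fun t => U t a).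

(* The choice made by [xget] depends only on the finite set of minimizers,
   which takes countably many values. *)
Lemma mpred_ancestor u v : mpred (fun t => ancestor (w t) (U t) u = v).
Proof.
pose sel t : set (lattice d) := [set v | nearest (w t) u v /\
  forall v', nearest (w t) u v' -> U t (u, v) <= U t (u, v')].
have fsel t : finite_set (sel t).
  by apply: sub_finite_set (finite_nearest (w t) u) => v' [].
apply: (@mpred_ext _ _ (fun t => exists F : {fset lattice d},
    (forall v', sel t v' <-> v' \in F) /\ xget u [set` F] = v)).
  move=> t; split=> [[F [FP <-]]|<-].
    rewrite /ancestor; congr xget; apply/seteqP; split=> v' /FP //.
  exists (fset_set (sel t)); split; last by rewrite fset_setK.
  by move=> v'; rewrite in_fset_set//; split=> [/mem_set|/set_mem].
apply: mpred_exists => F; apply: mpred_and; last exact: mpred_cst.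
apply: mpred_forall => v'; apply: mpred_iff; last exact: mpred_cst.
apply: mpred_and; first exact: mpred_nearest.
apply: mpred_forall => v''; apply: mpred_imply; first exact: mpred_nearest.
exact: mpred_le.
Qed.

End ancestor_measurability.

Section field_measurability.
Context (R : realType) (d : nat).
Notation field := (field R (index d)).
Implicit Types (x : field) (u v : lattice d).

Lemma mpred_opn v : mpred (fun x : field => opn x v).
Proof.
have := @measurable_coord R (index d) (inl v) measurableT _ (measurableC (measurable_set1 (0 : R))).
rewrite setTI; congr measurable; apply/seteqP; split => x /=; rewrite /opn.
  by move/eqP.
by move=> /eqP.
Qed.

Lemma mpred_child u v : mpred (fun x : field => child x u v).
Proof.
apply: (@mpred_ext _ _ (fun x : field => opn x v /\ (nearest (opn x) v u /\
  forall v', nearest (opn x) v v' -> v' <> u -> x (inr (v, u)) < x (inr (v, v'))))).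
  by move=> x; split=> [[h1 [h2 h3]]|[h1 h2 h3]].
apply: mpred_and; first exact: mpred_opn.
apply: mpred_and; first exact: (mpred_nearest mpred_opn).
apply: mpred_forall => v'; apply: mpred_imply; first exact: (mpred_nearest mpred_opn).
apply: mpred_imply; first exact: mpred_cst.
by apply: mpred_lt; exact: measurable_coord.
Qed.

Lemma bdm_degree_ind k u : bdm (degree_ind k u : field -> R).
Proof.
apply: bdm_asbool; apply: mpred_and; first exact: mpred_opn.
apply: mpred_exists => F; apply: mpred_and; first exact: mpred_cst.
apply: mpred_forall => v; apply: mpred_iff; first exact: mpred_cst.
exact: mpred_child.
Qed.

Lemma bdm_length_ind l u : bdm (length_ind l u : field -> R).
Proof.
apply: bdm_asbool; apply: mpred_and; first exact: mpred_opn.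
apply: mpred_exists => v; apply: mpred_and; last exact: mpred_cst.
exact: (mpred_nearest mpred_opn).
Qed.

End field_measurability.

(** Induction on k with s = sqrt rho and rho^m = s^m s^m: one factor absorbs a power through (m+1)
    s^m <= 1 + s + ... + s^m <= 1 / (1 - s), the other is left to the induction hypothesis. *)
Lemma poly_geometric_bound (R : realType) (k : nat) (rho : R) : 0 <= rho < 1 ->
  exists2 C, 0 <= C & forall m : nat, m.+1%:R ^+ k * rho ^+ m <= C.
Proof.
elim: k rho => [|k IH] rho /andP[r0 r1].
  by exists 1 => // m; rewrite expr0 mul1r exprn_ile1// ltW.
have s0 : 0 <= Num.sqrt rho by exact: sqrtr_ge0.
have s1 : Num.sqrt rho < 1 by rewrite -[ltRHS]sqrtr1 ltr_sqrt.
have rs m : rho ^+ m = Num.sqrt rho ^+ m * Num.sqrt rho ^+ m.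
  by rewrite -exprMn -expr2 sqr_sqrtr.
have [|C C0 HC] := IH (Num.sqrt rho); first by rewrite s0.
exists (C * (1 - Num.sqrt rho)^-1).
  by rewrite mulr_ge0// invr_ge0 subr_ge0 ltW.
move=> m; rewrite exprSr rs.
have -> : forall a b c : R, a * b * (c * c) = (a * c) * (b * c) by move=> *; ring.
apply: ler_pM => //; try by rewrite mulr_ge0 ?exprn_ge0 ?ler0n.
rewrite -[leRHS]mul1r ler_pdivlMr ?subr_gt0//.
have -> : m.+1%:R * Num.sqrt rho ^+ m = \sum_(i < m.+1) Num.sqrt rho ^+ m.
  by rewrite sumr_const card_ord mulr_natl.
apply: (@le_trans _ _ ((\sum_(i < m.+1) Num.sqrt rho ^+ i) * (1 - Num.sqrt rho))).
  apply: ler_wpM2r; first by rewrite subr_ge0 ltW.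
  apply: ler_sum => i _; apply: ler_wiXn2l => //; first exact: ltW.
  by rewrite -ltnS.
rewrite mulrC.
have -> : (1 - Num.sqrt rho) * (\sum_(i < m.+1) Num.sqrt rho ^+ i) = 1 - Num.sqrt rho ^+ m.+1.
  by rewrite -[RHS]opprB subrX1 -mulNr opprB.
by rewrite gerBl exprn_ge0.
Qed.

(** * Quasi-locality of degrees and lengths *)

Section locality.
Context (R : realType) (d : nat).
Notation field := (field R (index d)).
Implicit Types (x : field) (u v : lattice d).

Definition step u (i : 'I_d) (c : int) : lattice d :=
  [tuple tnth u j + (if j == i then c else 0) | j < d].

Lemma tnth_step u i c j : tnth (step u i c) j = tnth u j + (if j == i then c else 0).
Proof. by rewrite tnth_mktuple. Qed.

Definition horizontal (i : 'I_d) : bool := i.+1 != d :> nat.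

Lemma height_step u i c : horizontal i -> height (step u i c) = height u.
Proof.
move=> hi; have dpos : (0 < d)%N by apply: leq_trans (ltn_ord i).
have di : (d.-1 < d)%N by rewrite prednK.
have H : (Ordinal di).+1 = d :> nat by rewrite /= prednK.
rewrite !(heightE _ H) tnth_step; case: eqP => [E|]; last by rewrite addr0.
by move: hi; rewrite /horizontal -E H eqxx.
Qed.

Definition toward (s : bool) (t : nat) : int := if s then t%:Z else - t%:Z.

Lemma l1dist_step u v i s (t : nat) : (0 < t)%N ->
  (t%:Z <= if s then tnth v i - tnth u i else tnth u i - tnth v i) ->
  (l1dist v (step u i (toward s t)) < l1dist v u)%N.
Proof.
move=> t0 tuv; rewrite /l1dist (bigD1 i)//= [X in (_ < X)%N](bigD1 i)//=.
rewrite -addSn; apply: leq_add.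
  rewrite tnth_step eqxx /toward; move: tuv.
  by move: (tnth u i) (tnth v i) => a b; case: s => h; lia.
by apply: leq_sum => j /negPf ji; rewrite tnth_step ji addr0.
Qed.

(* On this event no vertex at horizontal distance [m] or more from [u] can have
   [u] as a nearest vertex, since one of the open sites of the ray is closer. *)
Definition guarded (m : nat) u x : Prop :=
  forall i s, horizontal i -> exists t : 'I_m, opn x (step u i (toward s t.+1)).

Lemma guarded_far m u v x i : guarded m u x -> horizontal i ->
  (m <= `|(tnth v i - tnth u i)%R|)%N -> ~ nearest (opn x) v u.
Proof.
move=> g hi far [[_ hu] nu].
pose s := tnth u i <= tnth v i.
have [t ot] := g i s hi.
have tm := ltn_ord t.
suff L : (l1dist v (step u i (toward s t.+1)) < l1dist v u)%N.
  have ob : open_below (opn x) v (step u i (toward s t.+1)).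
    by split => //; rewrite height_step.
  by have := nu _ ob; rewrite leqNgt L.
apply: l1dist_step => //; move: far tm; rewrite /s; move: (nat_of_ord t) => t'.
by move: (tnth u i) (tnth v i) => a b; case: ifP => ab; lia.
Qed.

Lemma near_trans m n u v v' : near m u v -> near n v v' -> near (m + n) u v'.
Proof.
move=> /nearP h1 /nearP h2; apply/nearP => i; have := h1 i; have := h2 i.
by move: (tnth u i) (tnth v i) (tnth v' i) => a b c; lia.
Qed.

Lemma near_sym m u v : near m u v -> near m v u.
Proof. by move=> /nearP H; apply/nearP => i; have := H i; lia. Qed.

Lemma near_leq m n u v : (m <= n)%N -> near m u v -> near n u v.
Proof. by move=> mn /nearP H; apply/nearP => i; exact: leq_trans mn. Qed.

Lemma near_step u i c (m : nat) : (`|c| <= m)%N -> near m u (step u i c).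
Proof. by move=> cm; apply/nearP => j; rewrite tnth_step; case: eqP => _; lia. Qed.

(** The guard controls the horizontal coordinates; in the vertical one a child is at distance
    exactly 1, hence [0 < m]. *)
Lemma child_near m u v x : (0 < m)%N -> guarded m u x -> nearest (opn x) v u -> near m u v.
Proof.
move=> m0 g nv; apply/nearP => i; have [hi|hi] := boolP (horizontal i).
  rewrite leqNgt; apply/negP => far; apply: (guarded_far g hi _ nv).
  by move: far; move: (tnth u i) (tnth v i) => a b; lia.
have H : i.+1 = d :> nat by apply/eqP; rewrite -[_ == _]negbK.
by have := nearest_height nv; rewrite !(heightE _ H); move: (tnth u i) (tnth v i) => a b; lia.
Qed.

(** A child is within m of [u] in each coordinate, hence within L1 distance d m of it, and its
    nearest set is decided within that L1 distance: altogether within (d+1) m of [u]. *)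
Lemma child_local m u v x x' : (0 < m)%N ->
  (forall i, near (d.+1 * m) u (site i) -> x i = x' i) ->
  guarded m u x -> opn x u -> child x u v -> child x' u v.
Proof.
move=> m0 xx' g ou [ov nv cv]; have nuv := child_near m0 g nv.
have lvu : (l1dist v u <= d * m)%N by apply: l1dist_near; exact: near_sym.
have far v' : (l1dist v v' <= d * m)%N -> near (d.+1 * m) u v'.
  by move=> /near_l1dist; rewrite mulSn; exact: near_trans.
have nuv' : near (d.+1 * m) u v by apply: near_leq nuv; rewrite mulSn leq_addr.
have E : nearest (opn x) v = nearest (opn x') v.
  apply: (nearest_local _ nv.1 lvu) => v' /far nv'.
  by rewrite /opn xx'.
split.
- by rewrite /opn -xx'.
- by rewrite -E.
- by move=> v'; rewrite -E => nv' v'u; rewrite -!xx'//; exact: cv.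
Qed.

Lemma guarded_local m u x x' :
  (forall i, near (d.+1 * m) u (site i) -> x i = x' i) -> guarded m u x -> guarded m u x'.
Proof.
move=> xx' g i s hi; have [t ot] := g i s hi; exists t; rewrite /opn -xx'//=.
apply: near_step; rewrite mulSn; apply: leq_trans (leq_addr _ _).
by rewrite /toward; have := ltn_ord t; case: s ot => _; move: (nat_of_ord t) => t'; lia.
Qed.

Lemma degree_ind_local m k u x x' : (0 < m)%N ->
  (forall i, near (d.+1 * m) u (site i) -> x i = x' i) ->
  guarded m u x -> degree_ind k u x = degree_ind k u x'.
Proof.
move=> m0 xx' g; have g' := guarded_local xx' g.
have x'x i : near (d.+1 * m) u (site i) -> x' i = x i by move=> /xx' ->.
have ou : opn x u = opn x' u.
  by rewrite /opn xx'//=; apply/nearP => i; rewrite subrr.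
congr (_%:R); congr nat_of_bool; apply/asboolP/asboolP => -[oux [F [Fk FP]]].
  split; first by rewrite -ou.
  exists F; split => // v; split.
    by move/FP; apply: child_local m0 xx' g oux.
  by move=> c; apply/FP; apply: child_local m0 x'x g' _ c; rewrite -ou.
split; first by rewrite ou.
exists F; split => // v; split.
  by move/FP; apply: child_local m0 x'x g' oux.
by move=> c; apply/FP; apply: child_local m0 xx' g _ c; rewrite ou.
Qed.

Lemma length_ind_local l u x x' :
  (forall i, near l u (site i) -> x i = x' i) -> length_ind l u x = length_ind l u x'.
Proof.
have sub (y y' : field) : (forall i, near l u (site i) -> y i = y' i) ->
    opn y u /\ (exists v, nearest (opn y) u v /\ l1dist u v = l) ->
    opn y' u /\ (exists v, nearest (opn y') u v /\ l1dist u v = l).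
  move=> yy' [oy [v [nv uv]]]; split.
    by rewrite /opn -yy'//=; apply/nearP => i; rewrite subrr.
  exists v; split => //; rewrite -(nearest_local (r := l) _ nv.1)//; last by rewrite uv.
  by move=> v' uv'; rewrite /opn yy'//=; exact: near_l1dist.
move=> xx'; congr (_%:R); congr nat_of_bool; apply/asboolP/asboolP.
  exact: sub.
by apply: sub => i /xx'.
Qed.

Context (Q : probability field R) (iQ : independent_coordinates Q) (p : R).
Hypothesis p01 : 0 < p < 1.
Hypothesis Q_closed : forall u, Q [set x : field | x (inl u) = 0] = (1 - p)%:E.

Definition ray_closed (m : nat) u i s x : bool :=
  [forall t : 'I_m, ~~ opn x (step u i (toward s t.+1))].

Lemma step_inj u i s : injective (fun t : nat => step u i (toward s t.+1)).
Proof.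
move=> t t' /(congr1 (fun v => tnth v i)); rewrite !tnth_step eqxx /toward.
by case: s => h; lia.
Qed.

Lemma measurable_ray_closed m u i s : measurable [set x : field | ray_closed m u i s x].
Proof.
apply: (@mpred_ext _ _ (fun x : field => forall t : 'I_m, ~ opn x (step u i (toward s t.+1)))).
  by move=> x; split=> [H|/forallP H t]; [apply/forallP => t; apply/negP | apply/negP].
by apply: mpred_forall => t; apply: mpred_not; exact: mpred_opn.
Qed.

Lemma Ex_ray_closed m u i s : Ex Q (fun x => (ray_closed m u i s x)%:R) = (1 - p) ^+ m.
Proof.
rewrite Ex_bool; last exact: measurable_ray_closed.
pose J : {fset index d} := [fset inl (step u i (toward s (nat_of_ord t).+1)) | t in 'I_m]%fset.
have -> : [set x : field | ray_closed m u i s x] = box_event J (fun=> [set 0]).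
  apply/seteqP; split => x /=.
    move=> /forallP H _ /= /imfsetP[t _ ->] /=.
    by have := H t; rewrite /opn negbK => /eqP.
  move=> H; apply/forallP => t; rewrite /opn negbK; apply/eqP.
  by apply: (H (inl (step u i (toward s t.+1)))); apply/imfsetP; exists t.
rewrite iQ//.
rewrite big_imfset/=; last first.
  by move=> t t' _ _ /(congr1 (@site d)) /= /step_inj /val_inj.
under eq_bigr do rewrite Q_closed.
by rewrite prodEFin/= big_enum/= prodr_const card_ord.
Qed.

Lemma unguarded_ray m u x : ~ guarded m u x -> exists i s, ray_closed m u i s x.
Proof.
move=> ng; apply: contrapT => H; apply: ng => i s hi; apply: contrapT => nt; apply: H.
by exists i, s; apply/forallP => t; apply/negP => ot; apply: nt; exists t.
Qed.

(** Prepares a union bound: at least 1 whenever [u] is not guarded. All 2d half-axes are summed, the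
    vertical ones included, for a simpler formula. *)
Definition ray_count m u x : R := \sum_(i < d) \sum_(s : bool) (ray_closed m u i s x)%:R.

Lemma bdm_ray_count m u : bdm (ray_count m u).
Proof.
apply: bdm_sum => i; apply: bdm_sum => s; apply: bdm_bool.
exact: measurable_ray_closed.
Qed.

Lemma Ex_ray_count m u : Ex Q (ray_count m u) = 2 * d%:R * (1 - p) ^+ m.
Proof.
have b i s : bdm (fun x => (ray_closed m u i s x)%:R : R).
  by apply: bdm_bool; exact: measurable_ray_closed.
rewrite Ex_sum; last by move=> i; exact: bdm_sum.
under eq_bigr => i _.
  rewrite Ex_sum//; under eq_bigr do rewrite Ex_ray_closed.
  rewrite sumr_const card_bool; over.
by rewrite sumr_const card_ord -mulrnA -[LHS]mulr_natl natrM.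
Qed.

Lemma norm_boolB (b b' : bool) : `|b%:R - b'%:R : R| <= 1.
Proof. by case: b; case: b'; rewrite ?subrr ?subr0 ?sub0r ?normrN ?normr1 ?normr0. Qed.

Lemma degree_ind_error (m k r : nat) u : (0 < d)%N -> (d.+1 * m <= r)%N ->
  Ex Q (fun x : field => `|degree_ind k u x - degree_ind k u (trunc (inball u r) x)|) <=
  2 * d%:R * (1 - p) ^+ m.
Proof.
move=> d0 mr.
have b1 : bdm (fun x : field => `|degree_ind k u x - degree_ind k u (trunc (inball u r) x) : R|).
  by apply: bdm_norm; apply: bdmB; [|apply: bdm_trunc]; exact: bdm_degree_ind.
(* For m = 0 the right side is 2d, at least 1, and the bound is trivial. *)
have [m0|m0] := posnP m.
  rewrite m0 expr0 mulr1 -[leRHS](Ex_cst Q).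
  apply: le_Ex => //; first exact: bdm_cst.
  move=> x; apply: (le_trans (norm_boolB _ _)).
  by rewrite -natrM ler1n muln_gt0.
rewrite -(Ex_ray_count m u); apply: le_Ex => //; first exact: bdm_ray_count.
move=> x; have [g|/unguarded_ray[i [s rc]]] := pselect (guarded m u x).
  rewrite (@degree_ind_local m k u x (trunc (inball u r) x) m0 _ g) ?subrr ?normr0.
    by apply: sumr_ge0 => i _; apply: sumr_ge0 => s _; rewrite ler0n.
  by move=> i nu; rewrite /trunc /mix /inball (near_leq mr nu).
apply: (le_trans (norm_boolB _ _)); rewrite /ray_count (bigD1 i)//= (bigD1 s)//= rc.
rewrite -addrA lerDl addr_ge0// ?sumr_ge0// => *; rewrite ?ler0n//.
by apply: sumr_ge0 => *; rewrite ler0n.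
Qed.

Lemma degree_ind_quasi_local k : (0 < d)%N -> exists2 C : R, 1 <= C & forall u r,
  Ex Q (fun x : field => `|degree_ind k u x - degree_ind k u (trunc (inball u r) x)|) <=
  C / r.+1%:R ^+ (4 * d).
Proof.
move=> d0; have /andP[p0 p1] := p01.
have [|C C0 HC] := @poly_geometric_bound R (4 * d) (1 - p).
  by apply/andP; split; lra.
exists (1 + 2 * d%:R * (d.+1%:R ^+ (4 * d) * C)).
  by rewrite lerDl !mulr_ge0 ?exprn_ge0 ?ler0n.
(* The largest guard whose radius of dependence (d+1) m fits into r. *)
move=> u r; pose m := (r %/ d.+1)%N.
have mr : (d.+1 * m <= r)%N by rewrite mulnC leq_divM.
apply: (le_trans (degree_ind_error k u d0 mr)).
rewrite ler_pdivlMr ?exprn_gt0 ?ltr0n//.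
apply: (@le_trans _ _ (2 * d%:R * (d.+1%:R ^+ (4 * d) * C))); last by rewrite lerDr.
rewrite -[leLHS]mulrA; apply: (@ler_wpM2l R (2 * d%:R)); first by rewrite mulr_ge0 ?ler0n.
have rm : r.+1%:R ^+ (4 * d) <= d.+1%:R ^+ (4 * d) * m.+1%:R ^+ (4 * d) :> R.
  rewrite -exprMn; apply: lerXn2r; rewrite ?nnegrE ?mulr_ge0 ?ler0n//.
  by rewrite -natrM ler_nat mulnC; apply: ltn_ceil.
apply: (@le_trans _ _ ((1 - p) ^+ m * (d.+1%:R ^+ (4 * d) * m.+1%:R ^+ (4 * d)))).
  by apply: ler_wpM2l => //; rewrite exprn_ge0// subr_ge0 ltW.
rewrite mulrCA; apply: ler_wpM2l; first by rewrite exprn_ge0 ?ler0n.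
by rewrite mulrC; exact: HC.
Qed.

Lemma length_ind_quasi_local l : exists2 C : R, 1 <= C & forall u r,
  Ex Q (fun x : field => `|length_ind l u x - length_ind l u (trunc (inball u r) x)|) <=
  C / r.+1%:R ^+ (4 * d).
Proof.
(* Truncation is exact once r >= l; below, the error is at most 1 and the constant makes the bound
   trivial. *)
exists (l.+1%:R ^+ (4 * d)); first by apply: exprn_ege1; rewrite ler1n.
move=> u r; have [lr|rl] := leqP l r.
  rewrite (_ : Ex _ _ = 0) ?divr_ge0 ?exprn_ge0 ?ler0n//.
  rewrite -[RHS](Ex_cst Q 0); apply: eq_Ex => x.
  rewrite (@length_ind_local l u x (trunc (inball u r) x)) ?subrr ?normr0//.
  by move=> i nu; rewrite /trunc /mix /inball (near_leq lr nu).
apply: (@le_trans _ _ 1).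
  rewrite -[leRHS](Ex_cst Q); apply: le_Ex; [|exact: bdm_cst|by move=> x; exact: norm_boolB].
  by apply: bdm_norm; apply: bdmB; [|apply: bdm_trunc]; exact: bdm_length_ind.
rewrite ler_pdivlMr ?exprn_gt0 ?ltr0n// mul1r.
by apply: lerXn2r; rewrite ?nnegrE ?ler0n// ler_nat ltnS ltnW.
Qed.

End locality.

(** * A local pattern switching the counts by one *)

Section switch.
Context (R : realType) (d : nat).
Hypothesis d_ge2 : (2 <= d)%N.
Notation field := (field R (index d)).
Implicit Types (x : field) (u v y z : lattice d).

Lemma first_subproof : (0 < d)%N. Proof. exact: leq_trans d_ge2. Qed.
Lemma last_subproof : (d.-1 < d)%N. Proof. by rewrite prednK// first_subproof. Qed.
Definition first_coord : 'I_d := Ordinal first_subproof.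
Definition last_coord : 'I_d := Ordinal last_subproof.

Lemma last_coordS : last_coord.+1 = d :> nat.
Proof. by rewrite /= prednK// first_subproof. Qed.

Lemma first_neq_last : first_coord != last_coord.
Proof. by apply/eqP => /(congr1 val)/= E; move: d_ge2; rewrite -last_coordS /= -E. Qed.

Lemma horizontalE i : horizontal i = (i != last_coord).
Proof.
rewrite /horizontal -(inj_eq val_inj) /=; congr (~~ _).
by rewrite -[X in _ == X](prednK first_subproof) eqSS.
Qed.

Lemma height_last u : height u = tnth u last_coord.
Proof. exact: heightE last_coordS. Qed.

(** The origin, the row and the target lie in the plane of the first and last axes, which are
    distinct because d >= 2. *)
Definition planar (c h : int) : lattice d :=
  [tuple if i == first_coord then c else if i == last_coord then h else 0 | i < d].

Lemma planar_first c h : tnth (planar c h) first_coord = c.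
Proof. by rewrite tnth_mktuple eqxx. Qed.

Lemma planar_last c h : tnth (planar c h) last_coord = h.
Proof. by rewrite tnth_mktuple eq_sym (negbTE first_neq_last) eqxx. Qed.

Lemma height_planar c h : height (planar c h) = h.
Proof. by rewrite height_last planar_last. Qed.

Lemma planar_horizontal c h i : horizontal i -> (`|tnth (planar c h) i| <= `|c|)%N.
Proof. by rewrite horizontalE tnth_mktuple => /negbTE ->; case: ifP => _; rewrite ?normr0. Qed.

Lemma l1dist_planar c h c' h' : l1dist (planar c h) (planar c' h') = (`|(c - c')%R| + `|(h - h')%R|)%N.
Proof.
rewrite /l1dist (bigD1 first_coord)//= (bigD1 last_coord)/=; last first.
  by rewrite eq_sym first_neq_last.
rewrite !planar_first !planar_last big1 ?addn0// => i /andP[/negbTE i1 /negbTE i2].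
by rewrite !tnth_mktuple i1 i2 subrr.
Qed.

Lemma origin_planar : origin d = planar 0 0.
Proof. by apply: eq_from_tnth => i; rewrite !tnth_mktuple; case: ifP => // _; case: ifP. Qed.

Context (K k j : nat).
(** The margin makes the target closer than every wall site below to the origin and, when j = 0, to
    each of the k row sites. *)
Hypothesis K_gt : (2 * k + 3 * j + 3 <= K)%N.

(** At L1 distance j + 1 from the origin: j is set by the edge length for (b), and is 0 for (a). *)
Definition target : lattice d := planar j (- 1).

Definition wall y : bool := [exists i, horizontal i && (`|tnth y i| == K)%N].

Definition row y : bool := [exists t : 'I_k, y == planar t.+1 0].

(* Open wall sites at horizontal distance [K] keep the outside away from the
   middle of the box; the only open sites inside the wall are [k] sites of the
   axis at height 0 and, just below, the target, which is therefore the
   ancestor of these sites and of the origin. Height 1 is left closed so that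
   the origin has no child. *)
Definition pattern_value y : bool :=
  (height y != 1) && [|| wall y, row y | y == target].

Definition pattern x : Prop :=
  forall y, near K (origin d) y -> y <> origin d -> opn x y = pattern_value y.

Lemma near_originP y : reflect (forall i, `|tnth y i| <= K)%N (near K (origin d) y).
Proof.
apply: (iffP (nearP _ _ _)) => H i; have := H i; rewrite tnth_mktuple sub0r.
  by rewrite abszN.
by rewrite abszN.
Qed.

(** Move [z] along axis i until it meets the wall on the side of [v]. The height is unchanged, so
    the site reached competes with [z] and is closer to [v]; height 1 is excluded because the
    pattern closes it inside the box. *)
Lemma shield x z v i : pattern x -> horizontal i -> (K < `|tnth v i|)%N ->
  near K (origin d) z -> (`|tnth z i| < K)%N -> height z <> 1 ->
  exists y, [/\ y <> origin d, height y = height z, opn x y & (l1dist v y < l1dist v z)%N].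
Proof.
move=> px hi vK /near_originP zK ziK hz.
pose s := 0 <= tnth v i.
pose t := if s then absz (K%:Z - tnth z i)%R else absz (K%:Z + tnth z i)%R.
have yi : tnth (step z i (toward s t)) i = if s then K%:Z else - K%:Z.
  rewrite tnth_step eqxx /toward /t; move: ziK; case: (s); move: (tnth z i) => a; lia.
exists (step z i (toward s t)).
have hy := height_step z (toward s t) hi.
have K0 : (0 < K)%N by lia.
have ny : step z i (toward s t) <> origin d.
  by move/(congr1 (fun u => tnth u i)); rewrite yi tnth_mktuple; case: (s); lia.
split => //.
- rewrite px//.
    rewrite /pattern_value hy; apply/andP; split; first exact/eqP.
    by apply/orP; left; apply/existsP; exists i; rewrite hi yi; case: (s); lia.
  apply/near_originP => l; have [->|li] := eqVneq l i.
    by rewrite yi; case: (s); lia.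
  by rewrite tnth_step (negbTE li) addr0.
- apply: l1dist_step; rewrite /t /s; case: ifP; move: vK ziK.
  + by move: (tnth v i) (tnth z i) => a b; lia.
  + by move: (tnth v i) (tnth z i) => a b; lia.
  + by move: (tnth v i) (tnth z i) => a b; lia.
  + by move: (tnth v i) (tnth z i) => a b; lia.
Qed.

Lemma outside_box v : ~~ near K (origin d) v -> (`|height v| <= K)%N ->
  exists2 i, horizontal i & (K < `|tnth v i|)%N.
Proof.
move=> nv hv; have [i iK] : exists i, (K < `|tnth v i|)%N.
  apply: contrapT => H; move/negP: nv; apply; apply/near_originP => i.
  by rewrite leqNgt; apply/negP => iK; apply: H; exists i.
exists i => //; rewrite horizontalE; apply/eqP => E.
by move: iK; rewrite E -height_last ltnNge hv.
Qed.

(** Since height 1 is closed inside the box, [v] stands beyond the wall, where a wall site at height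
    0 is closer to it than the origin. *)
Lemma upper_shield x v : pattern x -> v <> origin d -> height v = 1 -> opn x v ->
  exists y, [/\ y <> origin d, height y = 0, opn x y & (l1dist v y < l1dist v (origin d))%N].
Proof.
move=> px vo hv ov.
have nv : ~~ near K (origin d) v.
  by apply/negP => nv; move: ov; rewrite px// /pattern_value hv eqxx.
have [|i hi iK] := outside_box nv; first by rewrite hv; lia.
have ho : height (origin d) = 0 by rewrite origin_planar height_planar.
have [|||y [h1 h2 h3 h4]] := shield (z := origin d) px hi iK.
- by apply/near_originP => l; rewrite tnth_mktuple.
- by rewrite tnth_mktuple; lia.
- by rewrite ho.
- by exists y; rewrite h2 ho.
Qed.

Definition close_at z x : field := fun i => if i == inl z then 0 else x i.

Notation cl := (close_at (origin d)).

Lemma opn_close x y : opn (cl x) y = (y != origin d) && opn x y.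
Proof.
rewrite /opn /close_at; have [->|yo] := eqVneq y (origin d); first by rewrite eqxx eqxx.
by case: (inl y =P inl (origin d)) => // -[] yo'; rewrite yo' eqxx in yo.
Qed.

Lemma nearest_layer (w w' : lattice d -> bool) u :
  (forall v, height v = height u - 1 -> w v = w' v) -> nearest w u = nearest w' u.
Proof.
have sub (w1 w2 : lattice d -> bool) : (forall v, height v = height u - 1 -> w1 v = w2 v) ->
    nearest w1 u `<=` nearest w2 u.
  move=> E v [[wv hv] m]; have wv2 : w2 v by rewrite -E.
  split; first exact: conj.
  by move=> v' [wv' hv']; apply: m; split=> //; rewrite E.
by move=> E; apply/seteqP; split; apply: sub => // v hv; rewrite E.
Qed.

(** Only a vertex at height 1 has the origin as a candidate, and by [upper_shield] it has a closer
    one. *)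
Lemma nearest_close x v : pattern x -> v <> origin d -> opn x v ->
  nearest (opn (cl x)) v = nearest (opn x) v.
Proof.
move=> px vo ov; have ho : height (origin d) = 0 by rewrite origin_planar height_planar.
have [h1|h1] := eqVneq (height v) 1.
  have [y [yo hy oy yv]] := upper_shield px vo h1 ov.
  apply/esym; apply: (nearest_local (r := l1dist v y) (v := y)) => //.
    move=> v' v'y; rewrite opn_close; case: eqP => // v'o.
    by move: v'y; rewrite v'o leqNgt yv.
  by split=> //; rewrite hy h1 subrr.
apply: nearest_layer => v' hv'; rewrite opn_close; case: eqP => // v'o.
by move: hv' h1; rewrite v'o ho; lia.
Qed.

Lemma below_target x v : pattern x -> opn x v -> height v = - 1 -> v <> target ->
  exists2 i, horizontal i & (K <= `|tnth v i|)%N.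
Proof.
move=> px ov hv vt; have [nv|nv] := boolP (near K (origin d) v); last first.
  have [|i hi iK] := outside_box nv; first by rewrite hv; lia.
  by exists i => //; exact: ltnW.
have vo : v <> origin d.
  by move=> E; move: hv; rewrite E origin_planar height_planar.
move: ov; rewrite px// /pattern_value => /andP[_ /or3P[|/existsP[t /eqP E]|/eqP//]].
  by move=> /existsP[i /andP[hi /eqP iK]]; exists i => //; rewrite iK.
by move: hv; rewrite E height_planar.
Qed.

Lemma opn_target x : pattern x -> opn x target.
Proof.
move=> px; rewrite px.
- by rewrite /pattern_value eqxx height_planar !orbT.
- apply/near_originP => i; have [hi|] := boolP (horizontal i).
    by apply: (leq_trans (planar_horizontal _ _ hi)); lia.
  by rewrite horizontalE negbK => /eqP ->; rewrite planar_last; lia.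
- by move/(congr1 (@height d)); rewrite origin_planar !height_planar.
Qed.

(** The target is at distance |c - j| + 1, every other open site of the layer below at distance at
    least K - |c|. *)
Lemma nearest_target x c : pattern x -> (2 * `|(c - j%:Z)%R| + j + 1 < K)%N ->
  nearest (opn x) (planar c 0) = [set target].
Proof.
move=> px cK; have ob : open_below (opn x) (planar c 0) target.
  by split; [exact: opn_target | rewrite !height_planar].
have far v : open_below (opn x) (planar c 0) v -> v <> target ->
    (l1dist (planar c 0) target < l1dist (planar c 0) v)%N.
  move=> [ov hv] vt; rewrite height_planar sub0r in hv.
  have [i hi iK] := below_target px ov hv vt.
  rewrite l1dist_planar; apply: leq_trans (l1dist_coord _ _ i).
  have := planar_horizontal c 0 hi; move: iK cK.
  by move: (tnth v i) (tnth (planar c 0) i) => a b; lia.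
apply/seteqP; split => [v [obv m]|_ ->] /=.
  apply: contrapT => vt; have := m _ ob; rewrite leqNgt; move/negP; apply.
  exact: far.
split=> // v obv; have [->//|vt] := eqVneq v target.
by apply: ltnW; apply: far => //; exact/eqP.
Qed.

Lemma pattern_close x : pattern x -> pattern (cl x).
Proof. by move=> px y ny yo; rewrite opn_close px//; move/eqP: yo => ->. Qed.

Lemma nearest_origin x : pattern x -> nearest (opn x) (origin d) = [set target].
Proof. by move=> px; rewrite origin_planar nearest_target//; lia. Qed.

(** The origin can only be a child of the target, and all other open vertices keep their nearest
    sets. *)
Lemma child_close x u v : pattern x -> u <> target -> child x u v <-> child (cl x) u v.
Proof.
move=> px ut.
have [->|/eqP vo] := eqVneq v (origin d).
  split=> -[ov nv _]; last by rewrite opn_close eqxx in ov.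
  by move: nv; rewrite nearest_origin// => /= E; case: ut.
split=> -[ov nv cv].
  have E := nearest_close px vo ov.
  split; first by rewrite opn_close ov andbT; exact/eqP.
    by rewrite E.
  by move=> v'; rewrite E; exact: cv.
have ovx : opn x v by move: ov; rewrite opn_close => /andP[].
have E := nearest_close px vo ovx.
split=> //; first by rewrite -E.
by move=> v'; rewrite -E; exact: cv.
Qed.

Lemma degree_ind_close n x u : pattern x -> u <> target -> u <> origin d ->
  degree_ind n u x = degree_ind n u (cl x).
Proof.
move=> px ut uo; congr (_%:R); congr nat_of_bool.
have ou : opn (cl x) u = opn x u by rewrite opn_close; move/eqP: uo => ->.
apply/asboolP/asboolP => -[ho [F [Fn FP]]].
  split; first by rewrite ou.
  by exists F; split => // v; apply: (iff_trans (FP v)); exact: child_close.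
split; first by rewrite -ou.
by exists F; split => // v; apply: (iff_trans (FP v)); apply: iff_sym; exact: child_close.
Qed.

Lemma degree_ind_origin n x : pattern x -> opn x (origin d) ->
  degree_ind n (origin d) x = (n == 0%N)%:R.
Proof.
move=> px oo; congr (_%:R); congr nat_of_bool; apply/asboolP/eqP.
  move=> [_ [F [Fn FP]]]; rewrite -Fn; apply/eqP; rewrite cardfs_eq0.
  apply/eqP/fsetP => v; rewrite in_fset0; apply/negP => /FP[ov nv _].
  have ho : height (origin d) = 0 by rewrite origin_planar height_planar.
  have hv : height v = 1 by have := nearest_height nv; rewrite ho; lia.
  have vo : v <> origin d by move=> E; move: hv; rewrite E ho.
  have [y [_ hy oy yv]] := upper_shield px vo hv ov.
  have ob : open_below (opn x) v y by split=> //; rewrite hy hv subrr.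
  by have := nv.2 _ ob; rewrite leqNgt yv.
move=> ->; split=> //; exists fset0; split; first exact: cardfs0.
move=> v; rewrite in_fset0; split=> // -[ov nv _].
have ho : height (origin d) = 0 by rewrite origin_planar height_planar.
have hv : height v = 1 by have := nearest_height nv; rewrite ho; lia.
have vo : v <> origin d by move=> E; move: hv; rewrite E ho.
have [y [_ hy oy yv]] := upper_shield px vo hv ov.
have ob : open_below (opn x) v y by split=> //; rewrite hy hv subrr.
by have := nv.2 _ ob; rewrite leqNgt yv.
Qed.

Lemma degree_ind_closed n x : degree_ind n (origin d) (cl x) = 0.
Proof.
rewrite /degree_ind; case: asboolP => // -[].
by rewrite opn_close eqxx.
Qed.

Lemma length_ind_close l x u : pattern x -> u <> origin d ->
  length_ind l u x = length_ind l u (cl x).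
Proof.
move=> px uo; congr (_%:R); congr nat_of_bool.
have ou : opn (cl x) u = opn x u by rewrite opn_close; move/eqP: uo => ->.
apply/asboolP/asboolP; rewrite ou => -[ho H]; split => //.
  by rewrite nearest_close.
by rewrite nearest_close in H.
Qed.

Lemma length_ind_closed l x : length_ind l (origin d) (cl x) = 0.
Proof.
rewrite /length_ind; case: asboolP => // -[].
by rewrite opn_close eqxx.
Qed.

Lemma length_ind_origin x : pattern x -> opn x (origin d) ->
  length_ind j.+1 (origin d) x = 1.
Proof.
move=> px oo; rewrite /length_ind; case: asboolP => // H; exfalso; apply: H; split=> //.
exists target; rewrite nearest_origin//; split=> //.
by rewrite origin_planar l1dist_planar; lia.
Qed.

Lemma origin_not_row t : planar t.+1%:Z 0 != origin d.
Proof. by apply/eqP => /(congr1 (fun u => tnth u first_coord)); rewrite planar_first tnth_mktuple. Qed.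

(** At height 0, a vertex outside the box is shielded from the target, and a wall site has an open
    wall site right below it; only the row and the origin remain. *)
Lemma child_target x v : pattern x -> j = 0%N ->
  child x target v <-> row v \/ (v = origin d /\ opn x (origin d)).
Proof.
move=> px j0; have ho : height (origin d) = 0 by rewrite origin_planar height_planar.
have near_target i : horizontal i -> (`|tnth target i| <= j)%N by move=> hi; exact: planar_horizontal.
have target_child v' : opn x v' -> nearest (opn x) v' = [set target] -> child x target v'.
  by move=> ov' nv'; split; rewrite ?nv'//= => v''; rewrite nv'.
split; last first.
  move=> [/existsP[t /eqP ->]|[-> oo]]; last by apply: target_child => //; exact: nearest_origin.
  apply: target_child; last by rewrite nearest_target//; have := ltn_ord t; lia.
  rewrite px; last exact/eqP/origin_not_row.
    by rewrite /pattern_value height_planar /=; apply/orP; right; apply/orP; left; apply/existsP; exists t.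
  apply/near_originP => i; rewrite tnth_mktuple; have := ltn_ord t.
  by case: ifP => _; [lia | case: ifP => _; lia].
move=> [ov nv _]; have hv : height v = 0.
  by have := nearest_height nv; rewrite height_planar; lia.
have [E|/eqP vo] := eqVneq v (origin d); first by right; rewrite -E.
have [near_v|nv'] := boolP (near K (origin d) v); last first.
  have [|i hi iK] := outside_box nv'; first by rewrite hv.
  have [|||y [_ hy oy yv]] := shield (z := target) px hi iK.
  - apply/near_originP => l; have [/near_target H|] := boolP (horizontal l).
      by apply: leq_trans H _; lia.
    by rewrite horizontalE negbK => /eqP ->; rewrite planar_last; lia.
  - by apply: leq_ltn_trans (near_target _ hi) _; lia.
  - by rewrite height_planar.
  - by have := nv.2 y; rewrite leqNgt yv => H; have := H (conj oy _); rewrite hy height_planar hv => /(_ erefl).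
move: (ov); rewrite px// /pattern_value => /andP[_ /or3P[/existsP[i /andP[hi /eqP iK]]|rv|/eqP vt]].
- pose y := step v last_coord (- 1).
  have yi : tnth y i = tnth v i.
    by rewrite tnth_step; move: hi; rewrite horizontalE => /negbTE ->; rewrite addr0.
  have hy : height y = - 1.
    by rewrite height_last tnth_step eqxx -height_last hv.
  have oy : opn x y.
    rewrite px.
    + rewrite /pattern_value hy /=; apply/orP; left; apply/existsP; exists i.
      by rewrite hi yi iK eqxx.
    + apply/near_originP => l; rewrite tnth_step; move/near_originP: near_v => /(_ l).
      by case: eqP => [->|_]; rewrite -?height_last ?hv ?addr0//; lia.
    + by move=> E; move: hy; rewrite E ho.
  have vy : l1dist v y = 1%N.
    rewrite /l1dist (bigD1 last_coord)//= big1 ?addn0.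
      by rewrite tnth_step eqxx; move: (tnth v _) => a; lia.
    by move=> l /negbTE E; rewrite tnth_step E addr0 subrr.
  have := nv.2 y (conj oy _); rewrite vy hy hv => /(_ erefl).
  have := l1dist_coord v target i; have := near_target i hi; move: iK.
  by move: (tnth v i) (tnth target i) (l1dist v target) => a b c; lia.
- by left.
- by move: hv; rewrite vt height_planar.
Qed.

Lemma degree_ind_target n x : pattern x -> j = 0%N ->
  degree_ind n target x = (n == k + opn x (origin d))%N%:R.
Proof.
move=> px j0.
pose F := ([fset planar (nat_of_ord t).+1%:Z 0 | t in 'I_k] `|`
  (if opn x (origin d) then [fset origin d] else fset0))%fset.
have FP v : v \in F <-> child x target v.
  apply: iff_trans (iff_sym (child_target v px j0)); rewrite inE; split.
    move=> /orP[/imfsetP[t _ ->]|]; first by left; apply/existsP; exists t.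
    by case: ifP => // oo; rewrite inE => /eqP ->; right.
  move=> [/existsP[t /eqP ->]|[-> ->]]; last by rewrite inE eqxx orbT.
  by apply/orP; left; apply/imfsetP; exists t.
have Fk : #|` F| = (k + opn x (origin d))%N.
  rewrite cardfsU (_ : (_ `&` _)%fset = fset0) ?cardfs0 ?subn0.
    rewrite card_imfset/=; last first.
      by move=> t t' /(congr1 (fun u => tnth u first_coord)); rewrite !planar_first => -[] /val_inj.
    by rewrite -cardE card_ord; case: ifP => _; rewrite ?cardfs1 ?cardfs0.
  apply/fsetP => v; rewrite !inE; apply/negP => /andP[/imfsetP[t _ ->]].
  by case: ifP => // _; rewrite inE (negbTE (origin_not_row _)).
rewrite -Fk; congr (_%:R); congr nat_of_bool; apply/asboolP/eqP.
  move=> [_ [G [Gn GP]]]; rewrite -Gn; congr (#|` _|); apply/fsetP => v.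
  by apply/idP/idP => [/GP/FP|/FP/GP].
by move=> ->; split; [exact: opn_target | exists F].
Qed.

End switch.

(** * Positivity of the limiting variance *)

Section nondegeneracy.
Context (R : realType) (d : nat).
Hypothesis d_ge2 : (2 <= d)%N.
Notation field := (field R (index d)).
Implicit Types (x : field) (u v y z : lattice d).
Context (Q : probability field R) (iQ : independent_coordinates Q).
Hypothesis Q_shift : forall a i (B : set R), measurable B ->
  Q [set x | B (x (shift_index a i))] = Q [set x | B (x i)].
Context (p : R).
Hypothesis p01 : 0 < p < 1.
Hypothesis Q_closed : forall u, Q [set x : field | x (inl u) = 0] = (1 - p)%:E.

Lemma Q_opn u : Q [set x : field | opn x u] = p%:E.
Proof.
have m0 : measurable [set x : field | x (inl u) = 0].
  by have := @measurable_coord R (index d) (inl u) measurableT _ (measurable_set1 (0 : R)); rewrite setTI.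
have -> : [set x : field | opn x u] = ~` [set x : field | x (inl u) = 0].
  by apply/seteqP; split => x /=; rewrite /opn => /eqP.
by rewrite probability_setC// Q_closed -EFinB; congr (_%:E); ring.
Qed.

Lemma bdm_opn u : bdm (fun x : field => (opn x u)%:R : R).
Proof. by apply: bdm_bool; exact: mpred_opn. Qed.

Lemma Ex_opn u : Ex Q (fun x : field => (opn x u)%:R) = p.
Proof. by rewrite Ex_bool ?Q_opn//; exact: mpred_opn. Qed.

(** Applies [var_sum_le] with an [a] so large that its decay hypothesis is automatic for r < K; for
    r >= K the truncation error is 0. *)
Lemma var_local_sum (K N : nat) (a : int) (P : pred {ffun 'I_d -> 'I_N})
    (D : lattice d -> field -> R) :
  (forall u, bdm (D u)) -> (forall u x, `|D u x| <= 1) ->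
  (forall u x x', (forall i, near K u (site i) -> x i = x' i) -> D u x = D u x') ->
  var Q (fun x => \sum_(f | P f) D (pt a f) x) <=
  4 * 36 ^+ d * (2 * K.+1%:R ^+ (2 * d)) * #|P|%:R.
Proof.
move=> bD D1 DK; apply: (@var_sum_le R d Q iQ N a P (fun f => D (pt a f))) => //.
  move=> f; apply: (@le_trans _ _ 1).
    by rewrite -[leRHS](Ex_cst Q); apply: le_Ex => //; [exact: bdm_norm | exact: bdm_cst].
  rewrite -[leLHS]mulr1; apply: ler_pM => //; first by rewrite ler1n.
  by apply: exprn_ege1; rewrite ler1n.
move=> f r; have [Kr|rK] := leqP K r.
  rewrite (_ : Ex _ _ = 0); first by rewrite divr_ge0 ?mulr_ge0 ?exprn_ge0 ?ler0n.
  rewrite -[RHS](Ex_cst Q 0); apply: eq_Ex => x.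
  rewrite (DK _ x (trunc (inball (pt a f) r) x)) ?subrr ?normr0//.
  by move=> i nu; rewrite /trunc /mix /inball (near_leq Kr nu).
apply: (@le_trans _ _ 2).
  rewrite -[leRHS](Ex_cst Q); apply: le_Ex; [|exact: bdm_cst|].
    by apply: bdm_norm; apply: bdmB => //; exact: bdm_trunc.
  by move=> x; apply: (le_trans (ler_normB _ _)); rewrite -[2]/(1 + 1) lerD.
rewrite ler_pdivlMr ?exprn_gt0 ?ltr0n//; apply: ler_wpM2l; first by rewrite ler0n.
by apply: lerXn2r; rewrite ?nnegrE ?ler0n// ler_nat ltnS ltnW.
Qed.

Context (K k j : nat).
Notation o := (origin d).
Notation t0 := (target d_ge2 j).
Notation pat := (pattern d_ge2 K k j).
Notation cl := (close_at o).
Hypothesis K_gt : (2 * k + 3 * j + 3 <= K)%N.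

Context (X : lattice d -> field -> R).
Hypothesis X_bdm : forall u, bdm (X u).
Hypothesis X_shift : forall a u x, X (shift_site a u) x = X u (shift_field a x).
Hypothesis X_off : forall x u, pat x -> u <> o -> u <> t0 -> X u x = X u (cl x).
Hypothesis X_jump : forall x, pat x ->
  X o x + X t0 x = X o (cl x) + X t0 (cl x) + (opn x o)%:R.

Definition pattern_ind z x : R := (`[< pat (shift_field z x) >])%:R.

Definition switch z x : R := pattern_ind z x * ((opn x z)%:R - p).

Lemma bdm_pattern_ind z : bdm (pattern_ind z).
Proof.
apply: bdm_asbool; apply: mpred_forall => y.
apply: mpred_imply; first exact: mpred_cst.
apply: mpred_imply; first exact: mpred_cst.
case: (pattern_value _ _ _ _ y).
  by apply: mpred_ext (mpred_opn (shift_site z y)).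
apply: mpred_ext (mpred_not (mpred_opn (shift_site z y))) => x.
by rewrite opn_shift; split=> [/negP/negbTE|->].
Qed.

Lemma bdm_switch z : bdm (switch z).
Proof.
apply: bdmM; first exact: bdm_pattern_ind.
by apply: bdmB; [exact: bdm_opn | exact: bdm_cst].
Qed.

Lemma pattern_ind_local z x x' :
  (forall y, near K z y -> y <> z -> x (inl y) = x' (inl y)) -> pattern_ind z x = pattern_ind z x'.
Proof.
move=> xx'; congr (_%:R); congr nat_of_bool.
have E y : near K o y -> y <> o -> opn (shift_field z x) y = opn (shift_field z x') y.
  move=> ny yo; rewrite !opn_shift /opn xx'//.
    by rewrite -[X in near _ X](shift_origin z) near_shift.
  by rewrite -[RHS](shift_origin z) => /(can_inj (shift_siteK z)).
by apply/asboolP/asboolP => px y ny yo; [rewrite -E | rewrite E] => //; exact: px.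
Qed.

Lemma switch_local z x x' :
  (forall i, near K z (site i) -> x i = x' i) -> switch z x = switch z x'.
Proof.
move=> xx'; rewrite /switch /opn xx'/=; last by apply/nearP => i; rewrite subrr.
by congr (_ * _); apply: pattern_ind_local => y ny _; exact: xx'.
Qed.

Lemma switch_norm z x : `|switch z x| <= 1.
Proof.
have /andP[p0 p1] := p01.
rewrite /switch normrM -[leRHS]mulr1; apply: ler_pM => //.
  by rewrite ger0_norm ?ler0n// /pattern_ind; case: asboolP.
by rewrite ler_norml; case: (opn x z); rewrite /= ?mulr1n ?mulr0n; apply/andP; split; lra.
Qed.

Definition pattern_prob : R := Ex Q (pattern_ind o).

Lemma Ex_pattern_ind z : Ex Q (pattern_ind z) = pattern_prob.
Proof.
rewrite /pattern_prob -(Ex_shift iQ Q_shift z (bdm_pattern_ind o)).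
apply: eq_Ex => x; congr (_%:R); congr nat_of_bool; congr asbool; congr pattern.
by apply/funext => i; rewrite /shift_field; congr x; case: i => [v|[v v']] /=;
  rewrite !shift_site_comp shift_origin.
Qed.

(** The pattern prescribes finitely many sites, so its probability is a finite product of factors p
    and 1 - p. The origin is removed from [S] because it stays free. *)
Lemma pattern_prob_gt0 : 0 < pattern_prob.
Proof.
have /andP[p0 p1] := p01.
pose S := (fset_set [set v | near K o v] `\ o)%fset.
pose J : {fset index d} := [fset inl v | v in S]%fset.
pose B (i : index d) : set R := [set r | (r != 0) = pattern_value d_ge2 K k j (site i)].
have mB i : measurable (B i).
  rewrite /B; case: (pattern_value _ _ _ _ _).
    have -> : [set r : R | (r != 0) = true] = ~` [set 0].
      by apply/seteqP; split => r /=; case: (r =P 0).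
    exact: (measurableC (measurable_set1 (0 : R))).
  have -> : [set r : R | (r != 0) = false] = [set 0].
    by apply/seteqP; split => r /=; case: (r =P 0).
  exact: (measurable_set1 (0 : R)).
have SP v : v \in S <-> near K o v /\ v <> o.
  rewrite in_fsetD1 in_fset_set; last exact: finite_near.
  by split=> [/andP[/eqP vo /set_mem nv]|[nv /eqP vo]]; [split | rewrite vo mem_set].
have E : [set x : field | `[< pat (shift_field o x) >]] = box_event J B.
  have so x : shift_field o x = x.
    have oK v : shift_site o v = v.
      by apply: eq_from_tnth => i; rewrite tnth_shift_site tnth_mktuple addr0.
    by apply/funext => i; rewrite /shift_field; congr x; case: i => [v|[v v']] /=; rewrite !oK.
  apply/seteqP; split => x /=.
    move=> /asboolP; rewrite so => px _ /imfsetP[v /= /SP[nv vo] ->].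
    exact: (px v).
  move=> H; apply/asboolP; rewrite so => y ny yo.
  by apply: (H (inl y)); apply/imfsetP; exists y => //; apply/SP.
pose q (v : lattice d) := if pattern_value d_ge2 K k j v then p else 1 - p.
rewrite /pattern_prob Ex_bool; last first.
  have [m _] := bdm_pattern_ind o.
  rewrite (_ : [set _ | _] = pattern_ind o @^-1` [set 1]).
    by rewrite -[X in measurable X]setTI; apply: m => //; exact: measurable_set1.
  apply/seteqP; split => x /=; rewrite /pattern_ind; case: asboolP => //.
  by move=> _ /eqP; rewrite eq_sym oner_eq0.
rewrite E iQ// big_imfset/=; last by move=> v v' _ _ [].
rewrite (eq_bigr (fun v => (q v)%:E)); last first.
  move=> v _; rewrite /B /q /=; case: (pattern_value _ _ _ _ _).
    by rewrite -(Q_opn v); congr (Q _); apply/seteqP; split => x /=.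
  rewrite -(Q_closed v); congr (Q _); apply/seteqP; split => x /=.
    by case: (_ =P 0).
  by case: (_ =P 0).
rewrite prodEFin/=; apply: prodr_gt0 => v _; rewrite /q.
by case: ifP => _ //; rewrite subr_gt0.
Qed.

Lemma close_shift z x : shift_field z (close_at z x) = cl (shift_field z x).
Proof.
apply/funext => i; rewrite /shift_field /close_at; congr (if _ then _ else _).
apply/eqP/eqP => [|->]/=; last by rewrite shift_origin.
case: i => //= v [] E; congr inl; apply: (can_inj (shift_siteK z)).
by rewrite E shift_origin.
Qed.

Lemma cube_pt n v : (forall i, 1 <= tnth v i <= n%:Z) ->
  exists f : {ffun 'I_d -> 'I_n}, pt 1 f = v.
Proof.
move=> vn; have H i : (absz (tnth v i - 1)%R < n)%N.
  by have := vn i; move: (tnth v i) => a; lia.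
exists [ffun i => Ordinal (H i)]; apply: eq_from_tnth => i; rewrite tnth_pt ffunE /=.
by have := vn i; move: (tnth v i) => a; lia.
Qed.

Lemma target_norm i : (`|tnth t0 i| <= j.+1)%N.
Proof.
rewrite tnth_mktuple; case: ifP => _; first by lia.
by case: ifP => _; lia.
Qed.

Lemma target_neq_origin : t0 <> o.
Proof. by move/(congr1 (@height d)); rewrite (origin_planar d_ge2) !height_planar. Qed.

(** The margin K keeps both [z] and its translated target inside the cube, so the jump is counted in
    full. *)
Lemma site_sum_jump n z x : (forall i, K%:Z < tnth z i <= n%:Z - K%:Z) ->
  pat (shift_field z x) ->
  site_sum X n x = site_sum X n (close_at z x) + (opn x z)%:R.
Proof.
move=> zn px; have K0 : (j.+1 <= K)%N by move: K_gt; clear; lia.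
have [|fz Ez] := @cube_pt n z.
  by move=> i; have := zn i; move: (tnth z i) => a; clear -K0; lia.
have [|ft Et] := @cube_pt n (shift_site z t0).
  move=> i; rewrite tnth_shift_site; have := zn i; have := target_norm i.
  by move: (tnth z i) (tnth t0 i) => a b; clear -K0; lia.
have ftz : ft != fz.
  apply/eqP => E; apply: target_neq_origin; apply: (can_inj (shift_siteK z)).
  by rewrite shift_origin -Et E.
have split_sum (y : field) : site_sum X n y = X o (shift_field z y) + X t0 (shift_field z y) +
    \sum_(f | (f != fz) && (f != ft)) X (pt 1 f) y.
  rewrite /site_sum (bigD1 fz)//= (bigD1 ft)//= Ez Et addrA; congr (_ + _ + _).
  - by rewrite -X_shift shift_origin.
  - by rewrite -X_shift.
rewrite !split_sum close_shift X_jump// opn_shift shift_origin -!addrA; congr (_ + (_ + _)).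
rewrite [RHS]addrC; congr (_ + _).
apply: eq_bigr => f /andP[fz' ft'].
have sK v : shift_site z (shift_site (neg_site z) v) = v.
  by apply: eq_from_tnth => i; rewrite !tnth_shift_site tnth_mktuple subrK.
rewrite -[in LHS](sK (pt 1 f)) -[in RHS](sK (pt 1 f)) !(X_shift z) close_shift; apply: X_off => // E.
- move/eqP: fz'; apply; apply: (@pt_inj d n 1); rewrite Ez -(sK (pt 1 f)) E.
  exact: shift_origin.
- by move/eqP: ft'; apply; apply: (@pt_inj d n 1); rewrite Et -(sK (pt 1 f)) E.
Qed.

(** On the pattern the sum is S' + omega(z), where neither S', the sum with [z] closed, nor the
    pattern reads omega(z). The centered factor removes S', and what is left gives p (1 - p) times
    the probability of the pattern. *)
Lemma cov_switch n z : (forall i, K%:Z < tnth z i <= n%:Z - K%:Z) ->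
  cov Q (site_sum X n) (switch z) = pattern_prob * (p * (1 - p)).
Proof.
move=> zn; have bS := bdm_site_sum X_bdm n.
have bA := bdm_pattern_ind z; have bo := bdm_opn z.
have boc := bdmB bo (@bdm_cst R _ field p).
pose S' (x : field) := site_sum X n (close_at z x).
have mcl : measurable_fun setT (fun x : field => close_at z x : field).
  apply: measurable_to_field => i; rewrite /close_at; case: (_ == _) => //.
  exact: measurable_coord.
have bS' : bdm S' by exact: (bdm_comp mcl bS).
have A_dep : depends_on (predC (pred1 (inl z : index d))) (pattern_ind z).
  move=> x x' xx'; apply: pattern_ind_local => y _ yz; apply: xx' => /=.
  by apply/eqP => -[].
have S_dep : depends_on (predC (pred1 (inl z : index d))) S'.
  move=> x x' xx'; congr site_sum; apply/funext => i; rewrite /close_at.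
  by case: eqP => // /eqP iz; apply: xx'.
have o_dep : depends_on (pred1 (inl z : index d)) (fun x : field => (opn x z)%:R : R).
  by move=> x x' xx'; rewrite /opn xx'//=.
have oc_dep : depends_on (pred1 (inl z : index d)) (fun x : field => (opn x z)%:R - p : R).
  by move=> x x' xx'; rewrite (o_dep x x').
have Eoc : Ex Q (fun x : field => (opn x z)%:R - p) = 0.
  by rewrite ExB ?Ex_opn ?Ex_cst ?subrr//; exact: bdm_cst.
have indep (f g : field -> R) : bdm f -> bdm g -> depends_on (predC (pred1 (inl z : index d))) f ->
    depends_on (pred1 (inl z : index d)) g -> Ex Q (fun x : field => f x * g x) = Ex Q f * Ex Q g.
  move=> bf bg df dg; apply: (Ex_indep iQ bf bg df) => x x' xx'; apply: dg => i iz.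
  by apply: xx'; rewrite /= negbK.
have E0 : Ex Q (switch z) = 0.
  by rewrite /switch indep// Eoc mulr0.
(* As omega(z) is 0 or 1, omega(z) (omega(z) - p) = (1 - p) omega(z). *)
have ES x : site_sum X n x * switch z x =
    S' x * pattern_ind z x * ((opn x z)%:R - p) + pattern_ind z x * ((1 - p) * (opn x z)%:R).
  rewrite /switch /pattern_ind; case: asboolP => [px|_]; last by rewrite !(mul0r, mulr0) addr0.
  by rewrite (site_sum_jump zn px) /S' /=; case: (opn x z); rewrite /= ?mulr1n ?mulr0n; ring.
rewrite /cov E0 mulr0 subr0 (eq_Ex Q ES) ExD; [|by do !apply: bdmM|by apply: bdmM => //; exact: bdmZ].
rewrite indep//; last 2 first.
- exact: bdmM.
- by move=> x x' xx'; rewrite (S_dep x x')// (A_dep x x').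
rewrite Eoc mulr0 add0r indep//; last 2 first.
- exact: bdmZ.
- by move=> x x' xx'; rewrite (o_dep x x').
by rewrite ExZ// Ex_opn Ex_pattern_ind; ring.
Qed.

Lemma site_sum_nondegenerate : exists2 c0 : R, 0 < c0 &
  exists N0, forall n, (N0 <= n)%N -> c0 * n%:R ^+ d <= var Q (site_sum X n).
Proof.
have /andP[p0 p1] := p01.
have kappa0 : 0 < pattern_prob * (p * (1 - p)).
  by rewrite mulr_gt0 ?pattern_prob_gt0// mulr_gt0// subr_gt0.
have V0 : 0 < 4 * 36 ^+ d * (2 * K.+1%:R ^+ (2 * d)) :> R.
  by rewrite !mulr_gt0 ?exprn_gt0 ?ltr0n.
exists ((pattern_prob * (p * (1 - p))) ^+ 2 / (4 * 36 ^+ d * (2 * K.+1%:R ^+ (2 * d))) / 2 ^+ d).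
  by rewrite !divr_gt0 ?exprn_gt0.
exists (4 * K + 1)%N => n nK.
apply: (@var_site_sum_ge R d Q X switch _ _ K X_bdm bdm_switch V0 kappa0).
- move=> N P; apply: var_local_sum; [exact: bdm_switch|exact: switch_norm|exact: switch_local].
- by move=> m z zm; rewrite cov_switch.
- by move: nK; clear; lia.
- by move: nK; clear; lia.
Qed.

End nondegeneracy.

(** * The law of the field *)

Section transfer.
Context (R : realType) (d : nat) (p : R) (Pp : probability (config d) R).
Hypothesis hPp : bernoulli_product p Pp.
Context (dXi : measure_display) (Xi : measurableType dXi) (mu : probability Xi R)
  (U : lattice d * lattice d -> {RV mu >-> R}).
Hypothesis hU : iid_uniform_arcs U.
Notation field := (field R (index d)).
Notation P := (Pp \x mu)%E.

(** Nothing is assumed about labels off [arcs]. Freezing them at 0 makes these coordinates constant,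
    hence independent of all others and translation invariant in law. *)
Definition arc_value (a : lattice d * lattice d) (y : Xi) : R :=
  if `[< arcs a >] then U a y else 0.

Definition encode (x : config d * Xi) : field := fun i =>
  match i with inl u => (x.1 u)%:R | inr a => arc_value a x.2 end.

Lemma measurable_config u : measurable_fun setT (fun w : config d => w u).
Proof. by move=> _ B mB; rewrite setTI; apply: sub_sigma_algebra; exists u, B. Qed.

Lemma measurable_arc_value a : measurable_fun setT (arc_value a).
Proof. by rewrite /arc_value; case: asboolP. Qed.

Lemma measurable_encode : measurable_fun setT encode.
Proof.
apply: measurable_to_field => -[u|a] /=; last first.
  exact: (measurableT_comp (measurable_arc_value a) measurable_snd).
apply: (@measurableT_comp _ _ _ _ _ _ (fun b : bool => b%:R : R) _ (fun x : config d * Xi => x.1 u)).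
  by [].
exact: (measurableT_comp (measurable_config u) measurable_fst).
Qed.

HB.instance Definition _ := isMeasurableFun.Build _ _ _ _ encode measurable_encode.

Definition law : probability field R := distribution P encode.

Lemma lawE A : law A = P (encode @^-1` A).
Proof. by []. Qed.

Lemma left_event (A : set (config d)) : measurable A -> P (A `*` setT) = Pp A.
Proof.
move=> mA; rewrite -[RHS]mule1 -(probability_setT mu).
by apply: product_measure1E => //; exact: measurableT.
Qed.

Lemma right_event (A : set Xi) : measurable A -> P (setT `*` A) = mu A.
Proof.
move=> mA; rewrite -[RHS]mul1e -(probability_setT Pp).
by apply: product_measure1E => //; exact: measurableT.
Qed.

Lemma coin_event (B : set R) u : Pp [set w : config d | B (w u)%:R] =
  ((`[< B 1 >]%:R * p + `[< B 0 >]%:R * (1 - p))%R)%:E.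
Proof.
have [_ hp] := hPp.
have m1 : measurable [set w : config d | w u].
  have := @measurable_config u measurableT [set true] I.
  by rewrite setTI; congr measurable; apply/seteqP; split.
have p0 : Pp (~` [set w : config d | w u]) = (1 - p)%:E.
  by rewrite probability_setC// hp.
case: (asboolP (B 1)) => B1; case: (asboolP (B 0)) => B0; rewrite ?mul1r ?mul0r ?addr0 ?add0r.
- rewrite (_ : [set _ | _] = setT); first by rewrite probability_setT; congr EFin; ring.
  by apply/seteqP; split => w //= _; case: (w u).
- rewrite -(hp u); congr (Pp _); apply/seteqP; split => w /=; case: (w u) => //.
- rewrite -p0; congr (Pp _); apply/seteqP; split => w /=; case: (w u) => //.
- rewrite (_ : [set _ | _] = set0) ?measure0//.
  by apply/seteqP; split => w //=; case: (w u).
Qed.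

(** The constant coordinates are split off first, each contributing a factor 0 or 1; the hypothesis
    on [U] handles the arcs. *)
Lemma arc_value_independent (J : {fset lattice d * lattice d}) (B : lattice d * lattice d -> set R) :
  (forall a, measurable (B a)) ->
  mu (\bigcap_(a in [set` J]) (arc_value a @^-1` B a)) =
  (\prod_(a <- J) mu (arc_value a @^-1` B a))%E.
Proof.
move=> mB; have [iU _] := hU.
have arcE a : arcs a -> arc_value a = U a.
  by rewrite /arc_value => aa; apply/funext => y; case: asboolP.
have H (s : seq (lattice d * lattice d)) (A : set Xi) :
    (forall a, a \in s -> ~ arcs a) ->
    mu (A `&` [set y | forall a, a \in s -> B a (arc_value a y)]) =
    (mu A * \prod_(a <- s) mu (arc_value a @^-1` B a))%E.
  elim: s => [|a s IH] na.
    rewrite big_nil mule1; congr (mu _).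
    by apply/seteqP; split => [y []//|y]; split.
  have {}IH := IH (fun b bs => na b (mem_behead (s := a :: s) bs)).
  have naa : ~ arcs a by apply: na; rewrite mem_head.
  have aE y : arc_value a y = 0 by rewrite /arc_value; case: asboolP.
  rewrite big_cons; have [B0|B0] := pselect (B a 0).
    have -> : arc_value a @^-1` B a = setT by apply/seteqP; split => y //= _; rewrite aE.
    rewrite probability_setT mul1e -IH; congr (mu (_ `&` _)).
    apply/seteqP; split => y H b; first by move=> bs; apply: H; rewrite inE bs orbT.
    by rewrite inE => /orP[/eqP ->|]; [rewrite aE | exact: H].
  have -> : arc_value a @^-1` B a = set0 by apply/seteqP; split => y //=; rewrite aE.
  rewrite measure0 mul0e mule0 -[RHS](measure0 mu); congr (mu _).
  apply/seteqP; split => y //= -[_ /(_ a)]; rewrite mem_head aE => H.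
  exact: B0 (H isT).
pose J' := [fset a in J | `[< arcs a >]]%fset.
have -> : \bigcap_(a in [set` J]) (arc_value a @^-1` B a) =
    (\bigcap_(a in [set` J']) (U a @^-1` B a)) `&`
    [set y | forall a, a \in [seq a <- J | ~~ `[< arcs a >]] -> B a (arc_value a y)].
  apply/seteqP; split => y.
    move=> H'; split.
      move=> a /=; rewrite !inE /= => /andP[aJ /asboolP aa].
      by have := H' a aJ; rewrite /= arcE.
    by move=> a; rewrite mem_filter => /andP[_ aJ]; exact: (H' a aJ).
  move=> [H1 H2] a aJ /=; have [aa|na] := pselect (arcs a).
    by rewrite arcE//; apply: (H1 a) => /=; rewrite !inE /= aJ; apply/asboolP.
  by apply: H2; rewrite mem_filter aJ andbT; apply/asboolP.
rewrite H; last by move=> a; rewrite mem_filter => /andP[/asboolP].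
rewrite iU//; last by move=> a /=; rewrite !inE /= => /andP[_ /asboolP].
rewrite [RHS](bigID (fun a => `[< arcs a >]))/= big_filter; congr (_ * _)%E.
rewrite [RHS]big_fset_condE; apply: eq_big_seq => a; rewrite !inE /= => /andP[_ /asboolP aa].
by rewrite arcE.
Qed.

Lemma law_independent : independent_coordinates law.
Proof.
move=> J B mB; have [iw _] := hPp.
have f1 : finite_set [set u : lattice d | (inl u : index d) \in J].
  by apply: (finite_preimage (B := [set` J]) (f := inl)) => // u v _ _ [].
have f2 : finite_set [set a : lattice d * lattice d | (inr a : index d) \in J].
  by apply: (finite_preimage (B := [set` J]) (f := inr)) => // u v _ _ [].
pose J1 := fset_set [set u : lattice d | (inl u : index d) \in J].
pose J2 := fset_set [set a : lattice d * lattice d | (inr a : index d) \in J].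
have J1P u : (u \in J1) = ((inl u : index d) \in J) by rewrite in_fset_set//; apply/idP/idP => [/set_mem|/mem_set].
have J2P a : (a \in J2) = ((inr a : index d) \in J) by rewrite in_fset_set//; apply/idP/idP => [/set_mem|/mem_set].
pose A1 := \bigcap_(u in [set` J1]) ((fun w : config d => w u) @^-1` [set b : bool | B (inl u) b%:R]).
pose A2 := \bigcap_(a in [set` J2]) (arc_value a @^-1` B (inr a)).
have mA1 : measurable A1.
  apply: fin_bigcap_measurable => // u _.
  by rewrite -[X in measurable X]setTI; apply: measurable_config.
have mA2 : measurable A2.
  apply: fin_bigcap_measurable => // a _.
  by rewrite -[X in measurable X]setTI; apply: measurable_arc_value.
have E1 : Pp A1 = (\prod_(u <- J1) Pp [set w : config d | B (inl u) (w u)%:R])%E.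
  exact: (iw J1 (fun u => [set b : bool | B (inl u) b%:R])).
have E2 : mu A2 = (\prod_(a <- J2) mu (arc_value a @^-1` B (inr a)))%E.
  by apply: (@arc_value_independent J2 (fun a => B (inr a))) => a; exact: mB.
(* Site and arc constraints live on different factors, so the box is a rectangle of the product
   space. *)
rewrite lawE (_ : _ @^-1` _ = A1 `*` A2); last first.
  apply/seteqP; split => x /=.
    move=> H; split => [u|a] /=; rewrite ?J1P ?J2P => iJ; first exact: (H (inl u)).
    exact: (H (inr a)).
  move=> [H1 H2] [u|a] /= iJ; first by apply: H1; rewrite /= J1P.
  by apply: H2; rewrite /= J2P.
have -> : P (A1 `*` A2) = (Pp A1 * mu A2)%E by exact: product_measure1E.
rewrite E1 E2.
have pJ : perm_eq (enum_fset J) ([seq (inl u : index d) | u <- J1] ++ [seq (inr a : index d) | a <- J2]).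
  apply: uniq_perm; first exact: fset_uniq.
    rewrite cat_uniq !map_inj_uniq ?fset_uniq//=; [|by move=> ? ? []|by move=> ? ? []].
    by rewrite andbT; apply/hasPn => i /mapP[a _ ->]; apply/mapP => -[].
  move=> i; rewrite mem_cat; apply/idP/orP.
    by case: i => [u|a] iJ; [left|right]; apply/mapP; [exists u | exists a]; rewrite ?J1P ?J2P.
  by move=> [] /mapP[v]; rewrite ?J1P ?J2P => vJ ->.
rewrite (perm_big _ pJ) big_cat !big_map /=; congr (_ * _)%E; apply: eq_bigr.
- move=> u _; rewrite -left_event; last first.
    rewrite -[X in measurable X]setTI.
    exact: (@measurable_config u measurableT [set b : bool | B (inl u) b%:R]).
  by congr (P _); apply/seteqP; split => x //= -[].
- move=> a _; rewrite -right_event; last first.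
    by rewrite -[X in measurable X]setTI; exact: measurable_arc_value.
  by congr (P _); apply/seteqP; split => x //= -[].
Qed.

Lemma law_site u (B : set R) :
  law [set x : field | B (x (inl u))] = ((`[< B 1 >]%:R * p + `[< B 0 >]%:R * (1 - p))%R)%:E.
Proof.
rewrite lawE -(coin_event B u) -left_event; last first.
  rewrite -[X in measurable X]setTI.
  exact: (@measurable_config u measurableT [set b : bool | B b%:R]).
by congr (P _); apply/seteqP; split => x //= -[].
Qed.

Lemma law_arc a (B : set R) : measurable B -> arcs a ->
  law [set x : field | B (x (inr a))] = lebesgue_measure (B `&` `]0, 1]).
Proof.
move=> mB aa; have [_ /(_ a aa B mB) <-] := hU.
rewrite lawE -[RHS]/(mu (U a @^-1` B)) -right_event; last by rewrite -[X in measurable X]setTI; exact: measurable_funPT.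
congr (P _); apply/seteqP; split => x; rewrite /= /arc_value; case: asboolP => //.
by move=> _ [].
Qed.

Lemma law_nonarc a (B : set R) : ~ arcs a ->
  law [set x : field | B (x (inr a))] = (`[< B 0 >]%:R)%:E.
Proof.
move=> na; rewrite lawE; case: asboolP => B0.
  rewrite (_ : _ @^-1` _ = setT); first exact: probability_setT.
  by apply/seteqP; split => x //= _; rewrite /arc_value; case: asboolP.
rewrite (_ : _ @^-1` _ = set0); first exact: measure0.
by apply/seteqP; split => x //=; rewrite /arc_value; case: asboolP.
Qed.

Lemma arcs_shift (z : lattice d) (a : lattice d * lattice d) : arcs (shift_site z a.1, shift_site z a.2) <-> arcs a.
Proof. by rewrite /arcs /= !height_shift; split => H; lia. Qed.

(** Translations preserve the three kinds of coordinates (sites, arcs, other pairs), and the law of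
    a coordinate depends on its kind only. *)
Lemma law_shift z i (B : set R) : measurable B ->
  law [set x : field | B (x (shift_index z i))] = law [set x : field | B (x i)].
Proof.
move=> mB; case: i => [u|a].
  exact: etrans (law_site (shift_site z u) B) (esym (law_site u B)).
pose a' := (shift_site z a.1, shift_site z a.2).
have [aa|na] := pselect (arcs a).
  have aa' : arcs a' by apply/arcs_shift.
  exact: etrans (law_arc mB aa') (esym (law_arc mB aa)).
have na' : ~ arcs a' by move/arcs_shift.
exact: etrans (law_nonarc B na') (esym (law_nonarc B na)).
Qed.

Lemma law_closed u : law [set x : field | x (inl u) = 0] = (1 - p)%:E.
Proof.
rewrite (law_site u [set 0]); case: asboolP => [/eqP|_]; first by rewrite oner_eq0.
by case: asboolP => [_|/(_ erefl)//]; rewrite mul0r add0r mul1r.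
Qed.

(* Given all other coordinates, the law of the coordinate [a] has no atom. *)
Lemma law_tie (a b : lattice d * lattice d) : arcs a -> a <> b -> law [set x : field | x (inr a) = x (inr b)] = 0%E.
Proof.
move=> aa ab; pose tie (x : field) := x (inr a) == x (inr b).
have mtie : measurable [set x : field | tie x].
  have := @measurable_fun_eqr _ _ R setT (fun x : field => x (inr a)) (fun x : field => x (inr b))
    (measurable_coord _) (measurable_coord _) measurableT [set true] I.
  by rewrite setTI; congr measurable; apply/seteqP; split.
have -> : [set x : field | x (inr a) = x (inr b)] = [set x : field | tie x].
  by apply/seteqP; split => x /eqP.
have E : Ex law (fun x : field => (tie x)%:R) = 0.
  rewrite (Ex_mix (pred1 (inr a : index d)) law_independent (bdm_bool R mtie)).2.
  rewrite -[RHS](Ex_cst law 0); apply: eq_Ex => y.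
  have tieE (x : field) : tie (mix (pred1 (inr a : index d)) x y) = (x (inr a) == y (inr b)).
    have nb : (inr b : index d) == inr a = false by apply/eqP => -[] /esym.
    by rewrite /tie /mix /= eqxx nb.
  rewrite Ex_bool.
    have -> : [set x : field | tie (mix (pred1 (inr a : index d)) x y)] =
        [set x : field | [set y (inr b)] (x (inr a))].
      by apply/seteqP; split => x /=; rewrite tieE => /eqP.
    have mc : measurable [set y (inr b)] by exact: (measurable_set1 (y (inr b))).
    rewrite law_arc// (_ : lebesgue_measure _ = 0%E)//.
    apply: (@subset_measure0 _ (measurableTypeR R) R lebesgue_measure _ [set y (inr b)]) => //.
      by apply: measurableI => //; exact: measurable_itv.
    exact: lebesgue_measure_set1.
  have := (bdm_comp (measurable_mixl (pred1 (inr a : index d)) y) (bdm_bool R mtie)).1.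
  move=> /(_ measurableT [set 1] (measurable_set1 (1 : R))); rewrite setTI.
  congr measurable; apply/seteqP; split => x /=; first by case: (tie _) => // /eqP; rewrite eq_sym oner_eq0.
  by move=> ->.
rewrite Ex_bool// in E; rewrite -[LHS]fineK ?E//; exact: fin_num_measure.
Qed.

End transfer.

(** * Vertex and edge counts as sums over sites *)

Section minimizer.
Context (R : realType) (T : choiceType).

Lemma finite_minimizer (A : set T) (f : T -> R) : finite_set A -> (exists v, A v) ->
  exists v, A v /\ forall v', A v' -> f v <= f v'.
Proof.
move=> /finite_seqP[s ->] [v0 /= v0s].
suff H : forall s : seq T, s != [::] -> exists2 v, v \in s & {in s, forall v', f v <= f v'}.
  by have [|v vs m] := H s; [case: (s) v0s | exists v].
elim=> // a [|b s'] IH _; first by exists a; rewrite ?mem_head// => v'; rewrite inE => /eqP ->.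
have [//|v vs m] := IH; have [av|va] := leP (f a) (f v).
  exists a; rewrite ?mem_head// => v'; rewrite inE => /orP[/eqP ->//|/m].
  exact: le_trans.
exists v; first by rewrite inE vs orbT.
by move=> v'; rewrite inE => /orP[/eqP ->|/m//]; exact: ltW.
Qed.

Lemma fset2_injl (u : T) : injective (fun v : T => [fset v; u]%fset).
Proof.
move=> v v' E; have : v \in [fset v'; u]%fset by rewrite -E !inE eqxx.
rewrite !inE => /orP[/eqP//|/eqP vu].
have : v' \in [fset v; u]%fset by rewrite E !inE eqxx.
by rewrite !inE vu orbb => /eqP.
Qed.

End minimizer.

Section graph_counts.
Context (R : realType) (d : nat) (w : lattice d -> bool) (U : lattice d * lattice d -> R).
Implicit Types (u v : lattice d).
Notation anc := (ancestor w U).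

Definition minimizers u : set (lattice d) :=
  [set v | nearest w u v /\ forall v', nearest w u v' -> U (u, v) <= U (u, v')].

Lemma ancestor_min u : anc u <> u -> minimizers u (anc u).
Proof.
move=> au; apply: xgetPex; apply: contrapT => H; apply: au.
by apply: xgetPN => v mv; apply: H; exists v.
Qed.

Lemma ancestor_height u : anc u <> u -> height (anc u) = height u - 1.
Proof. by move=> /ancestor_min[/nearest_height]. Qed.

Lemma nearest_neq u v : nearest w u v -> v <> u.
Proof. by move=> /nearest_height h E; move: h; rewrite E; lia. Qed.

Lemma ancestor_nearest u v : nearest w u v -> nearest w u (anc u).
Proof.
move=> nv; have [|v' mv'] := @finite_minimizer R _ (nearest w u) (fun v => U (u, v)) (finite_nearest w u).
  by exists v.
have : minimizers u (anc u) by apply: xgetPex; exists v'.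
by case.
Qed.

(** A positive length excludes the default value [u], and all nearest vertices are equidistant. *)
Lemma ancestor_l1dist u (l : nat) : (0 < l)%N ->
  l1dist u (anc u) = l <-> exists v, nearest w u v /\ l1dist u v = l.
Proof.
move=> l0; split=> [al|[v [nv vl]]].
  exists (anc u); split => //; have [] // := @ancestor_min u.
  by move=> E; move: al l0; rewrite E l1dist0 => <-.
have na := ancestor_nearest nv; apply/eqP; rewrite -vl eqn_leq.
by rewrite (na.2 _ nv.1) (nv.2 _ na.1).
Qed.

(** The clause [v <> u] excludes [u] itself, which is its own [ancestor] when nothing is open below
    it. *)
Definition children u : set (lattice d) := [set v | [/\ w v, v <> u & anc v = u]].

Lemma edges_at u (F : {fset lattice d}) : w u -> children u = [set` F] ->
  [set e | edges w U e /\ u \in e] =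
  [set` ([fset u; anc u] |` [fset [fset v; u] | v in F])%fset].
Proof.
move=> wu cF; apply/seteqP; split => e /=.
  move=> [[v wv ->] /=]; rewrite !inE => /orP[/eqP <-|/eqP uv]; first by rewrite eqxx.
  have [->|vu] := eqVneq v u; first by rewrite eqxx.
  apply/orP; right; apply/imfsetP; exists v; rewrite -?uv//=.
  have : children u v by split => //; exact/eqP.
  by rewrite cF.
rewrite !inE => /orP[/eqP ->|/imfsetP[v /= vF ->]].
  by split; [exists u | rewrite !inE eqxx].
have [wv _ av] : children u v by rewrite cF.
by split; [exists v; rewrite ?av | rewrite !inE eqxx orbT].
Qed.

(** Heights distinguish the edge below [u] from those to its children. If [u] is its own ancestor,
    that edge degenerates to a singleton and still counts once, so the identity holds for every
    configuration. *)
Lemma card_edges_at u (F : {fset lattice d}) : children u = [set` F] ->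
  #|` [fset u; anc u] |` [fset [fset v; u] | v in F]|%fset = (#|` F|).+1.
Proof.
move=> cF; rewrite cardfsU1 card_imfset /=; last exact: fset2_injl.
rewrite (_ : _ \notin _); first by [].
apply/imfsetP => -[v /= vF E].
have [wv vu av] : children u v by rewrite cF.
have : v \in [fset u; anc u]%fset by rewrite E !inE eqxx.
rewrite !inE => /orP[/eqP//|/eqP va].
have h1 : height u = height v - 1 by rewrite -av; apply: ancestor_height; rewrite av => /esym.
have h2 : height v = height u - 1 by rewrite va; apply: ancestor_height; rewrite -va.
by move: h1 h2; lia.
Qed.

Lemma has_degreeE (k : nat) u : w u -> has_degree w U k.+1 u <->
  exists F : {fset lattice d}, #|` F| = k /\ forall v, v \in F <-> children u v.
Proof.
move=> wu; split=> [H|[F [Fk FP]]]; last first.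
  have cF : children u = [set` F] by apply/seteqP; split => v /FP.
  rewrite /has_degree (edges_at wu cF); apply/card_eq_fsetP.
  by rewrite card_edges_at// Fk.
have fE : finite_set [set e | edges w U e /\ u \in e] by apply/finite_setP; exists k.+1.
have fC : finite_set (children u).
  apply: (@sub_finite_set _ _ ((fun v => [fset v; u]%fset) @^-1` [set e | edges w U e /\ u \in e])).
    by move=> v [wv _ av] /=; split; [exists v; rewrite ?av | rewrite !inE eqxx orbT].
  apply: finite_preimage => // v v' _ _; exact: fset2_injl.
have cF : children u = [set` fset_set (children u)] by rewrite fset_setK.
exists (fset_set (children u)); split.
  move: H; rewrite /has_degree (edges_at wu cF) => /card_eq_fsetP.
  by rewrite card_edges_at// => -[].
by move=> v; rewrite [X in _ <-> X v]cF.
Qed.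

Lemma finite_cube n : finite_set (@cube d n).
Proof.
apply: sub_finite_set (finite_near (origin d) n) => v vn; apply/nearP => i.
by have := vn i; rewrite tnth_mktuple; move: (tnth v i) => a; lia.
Qed.

(** An edge of positive length is counted at its upper end, which heights determine; the singleton
    edges have length 0. *)
Lemma length_countE (l n : nat) : (0 < l)%N -> length_count w U l n =
  #|` fset_set [set u | [/\ w u, l1dist u (anc u) = l & cube n u \/ cube n (anc u)]]|.
Proof.
move=> l0; set C := [set u | _].
have neq u : l1dist u (anc u) = l -> anc u <> u.
  by move=> al E; move: al l0; rewrite E l1dist0 => <-.
have fC : finite_set C.
  apply: (@sub_finite_set _ _ (\bigcup_(v in @cube d n) [set u | near l v u])).
    move=> u [_ al [un|an]]; first by exists u => //=; apply/nearP => i; rewrite subrr.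
    by exists (anc u) => //=; apply: near_l1dist; rewrite l1distC al.
  by apply: bigcup_finite; [exact: finite_cube | move=> v _; exact: finite_near].
rewrite /length_count (_ : [set e | _] = [set [fset u; anc u]%fset | u in C]); last first.
  apply/seteqP; split => e /=.
    move=> [[u wu ->] [a [b [E ab]]] [v [ve wv vn]]].
    have al : l1dist u (anc u) = l.
      have : a \in [fset u; anc u]%fset by rewrite E !inE eqxx.
      have : b \in [fset u; anc u]%fset by rewrite E !inE eqxx orbT.
      rewrite !inE => /orP[]/eqP eb /orP[]/eqP ea; rewrite -ab ea eb ?l1dist0//.
      - have : anc u \in [fset a; b]%fset by rewrite -E !inE eqxx orbT.
        by rewrite ea eb !inE orbb => /eqP ->; rewrite l1dist0.
      - by rewrite l1distC.
      - have : u \in [fset a; b]%fset by rewrite -E !inE eqxx.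
        by rewrite ea eb !inE orbb => /eqP <-; rewrite l1dist0.
    exists u => //; split=> //; move: ve; rewrite !inE => /orP[]/eqP <-; [left|right]; exact: vn.
  move=> [u [wu al un] <-]; split; first by exists u.
    by exists u, (anc u).
  case: un => un; first by exists u; rewrite !inE eqxx.
  exists (anc u); rewrite !inE eqxx orbT; split => //.
  by have [/nearest_open] := ancestor_min (neq _ al).
rewrite fset_set_image// card_in_imfset//= => u v.
rewrite !in_fset_set// => /set_mem[_ au _] /set_mem[_ av _] E.
have : u \in [fset v; anc v]%fset by rewrite -E !inE eqxx.
rewrite !inE => /orP[/eqP//|/eqP ua].
have : v \in [fset u; anc u]%fset by rewrite E !inE eqxx.
rewrite !inE => /orP[/eqP//|/eqP va].
have h1 : height u = height v - 1 by rewrite [in LHS]ua; apply: ancestor_height; exact: neq.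
have h2 : height v = height u - 1 by rewrite [in LHS]va; apply: ancestor_height; exact: neq.
by move: h1 h2; lia.
Qed.

Lemma ancestor_arcs (U' : lattice d * lattice d -> R) :
  (forall a, arcs a -> U a = U' a) -> anc = ancestor w U'.
Proof.
move=> UU'; apply/funext => u; congr xget; apply/seteqP.
have E v : nearest w u v -> U (u, v) = U' (u, v) by move=> /nearest_height h; apply: UU'.
by split=> v [nv m]; split => // v' nv'; have := m _ nv'; rewrite !E.
Qed.

End graph_counts.

Lemma card_lattice_set d (N : nat) (a : int) (A : set (lattice d)) :
  (forall u, A u -> forall i, a <= tnth u i < a + N%:Z) ->
  #|` fset_set A| = (\sum_(f : {ffun 'I_d -> 'I_N}) `[< A (pt a f) >])%N.
Proof.
move=> AN; pose S := [set f : {ffun 'I_d -> 'I_N} | `[< A (pt a f) >]]%SET.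
have E : A = [set` [fset pt a f | f in S]%fset].
  apply/seteqP; split => u /=.
    move=> Au; apply/imfsetP.
    have H i : (absz (tnth u i - a)%R < N)%N.
      by have := AN u Au i; move: (tnth u i) => b; lia.
    have uE : u = pt a [ffun i => Ordinal (H i)].
      apply: eq_from_tnth => i; rewrite tnth_pt ffunE /=.
      by have := AN u Au i; move: (tnth u i) => b; lia.
    by exists [ffun i => Ordinal (H i)] => //=; rewrite inE; apply/asboolP; rewrite -uE.
  by move=> /imfsetP[f /=]; rewrite inE => /asboolP Af ->.
rewrite [in LHS]E set_fsetK card_imfset/=; last exact: pt_inj.
rewrite -cardE -sum1_card big_mkcond/=; apply: eq_bigr => f _.
by rewrite inE; case: asboolP.
Qed.

Section field_totals.
Context (R : realType) (d : nat).
Notation field := (field R (index d)).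
Implicit Types (x : field) (u v : lattice d).

Definition weight x (a : lattice d * lattice d) : R := x (inr a).

Notation anc x := (ancestor (opn x) (weight x)).

Definition degree_total (k n : nat) x : R := (degree_count (opn x) (weight x) k n)%:R.

Definition length_total (l n : nat) x : R := (length_count (opn x) (weight x) l n)%:R.

Definition no_ties x : Prop :=
  forall a b : lattice d * lattice d, arcs a -> a <> b -> x (inr a) <> x (inr b).

Lemma mpred_field_ancestor u v : mpred (fun x : field => anc x u = v).
Proof. by apply: mpred_ancestor => [v'|a]; [exact: mpred_opn | exact: measurable_coord]. Qed.

Lemma childE x u v : no_ties x -> child x u v <-> children (opn x) (weight x) u v.
Proof.
move=> nt; split=> [[ov nv cv]|[ov vu av]].
  have nuv := nearest_neq nv; split => //; first exact/nesym.
  have nv' := ancestor_nearest (weight x) nv.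
  have [|_ m] := @ancestor_min R d (opn x) (weight x) v; first exact: nearest_neq nv'.
  apply: contrapT => au; have := cv _ nv' au.
  by rewrite ltNge => /negP; apply; exact: m.
have [|nv m] := @ancestor_min R d (opn x) (weight x) v; first by rewrite av => /esym.
rewrite av in nv m; split => // v' nv' v'u.
rewrite lt_neqAle m// andbT; apply/eqP; apply: nt.
  exact: nearest_height nv.
by case => /esym.
Qed.

Lemma degree_totalE k n x :
  degree_total k n x =
  \sum_(f : {ffun 'I_d -> 'I_n})
     (`[< opn x (pt 1 f) /\ has_degree (opn x) (weight x) k (pt 1 f) >])%:R.
Proof.
rewrite /degree_total /degree_count (@card_lattice_set d n 1).
  rewrite natr_sum; apply: eq_bigr => f _; congr (_%:R); congr nat_of_bool.
  apply/asboolP/asboolP => [[]|[of_ hf]] //; split => // i.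
  by rewrite tnth_pt; have := ltn_ord (f i); move: (nat_of_ord (f i)) => a; lia.
by move=> u [_ un _] i; have := un i; move: (tnth u i) => a; lia.
Qed.

Lemma bdm_degree_total k n : bdm (degree_total k.+1 n).
Proof.
have -> : degree_total k.+1 n = (fun x => \sum_(f : {ffun 'I_d -> 'I_n})
     (`[< opn x (pt 1 f) /\ has_degree (opn x) (weight x) k.+1 (pt 1 f) >])%:R).
  by apply/funext => x; exact: degree_totalE.
apply: bdm_sum => f; apply: bdm_asbool; set u := pt 1 f.
apply: (@mpred_ext _ _ (fun x : field => opn x u /\ exists F : {fset lattice d},
    #|` F| = k /\ forall v, v \in F <-> (opn x v /\ (v <> u /\ anc x v = u)))).
  move=> x; split=> -[ou H]; split => //.
    case: H => F [Fk FP]; apply/has_degreeE => //; exists F; split => // v.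
    by apply: (iff_trans (FP v)); split => [[? []]|[]].
  move/has_degreeE: H => /(_ ou)[F [Fk FP]]; exists F; split => // v.
  by apply: (iff_trans (FP v)); split => [[]|[? []]].
apply: mpred_and; first exact: mpred_opn.
apply: mpred_exists => F; apply: mpred_and; first exact: mpred_cst.
apply: mpred_forall => v; apply: mpred_iff; first exact: mpred_cst.
apply: mpred_and; first exact: mpred_opn.
apply: mpred_and; first exact: mpred_cst.
exact: mpred_field_ancestor.
Qed.

Lemma degree_total_site_sum k n x : no_ties x ->
  degree_total k.+1 n x = site_sum (degree_ind k) n x.
Proof.
move=> nt; rewrite degree_totalE; apply: eq_bigr => f _.
congr (_%:R); congr nat_of_bool; apply/asboolP/asboolP => -[ou H]; split => //.
  move/(has_degreeE _ _ ou): H => [F [Fk FP]]; exists F; split => // v.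
  by apply: (iff_trans (FP v)); apply: iff_sym; exact: childE.
case: H => F [Fk FP]; apply/(has_degreeE _ _ ou); exists F; split => // v.
by apply: (iff_trans (FP v)); exact: childE.
Qed.

Definition shell_ind (l n : nat) u x : R :=
  (`[< [/\ opn x u, l1dist u (anc x u) = l & cube n (anc x u)] >])%:R.

Definition in_shell (l n : nat) (f : {ffun 'I_d -> 'I_(n + 2 * l)}) : bool :=
  ~~ `[< cube n (pt (1 - l%:Z) f) >].

(** Collects the edges of which only the lower end is in the cube; their upper ends lie within l of
    it, hence the cube of side n + 2 l starting at 1 - l. *)
Definition shell_sum (l n : nat) x : R :=
  \sum_(f | @in_shell l n f) shell_ind l n (pt (1 - l%:Z) f) x.

(** Edges are sorted by whether their upper end is in the cube. The identity holds at ties as well: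
    the first part sees only distances, the second keeps the actual [ancestor]. *)
Lemma length_total_site_sum l n x : (0 < l)%N ->
  length_total l n x = site_sum (length_ind l) n x + shell_sum l n x.
Proof.
move=> l0; rewrite /length_total length_countE//.
pose A := [set u | [/\ opn x u, l1dist u (anc x u) = l & cube n u]].
pose B := [set u | ~ cube n u /\ [/\ opn x u, l1dist u (anc x u) = l & cube n (anc x u)]].
have An u : A u -> forall i, 1 <= tnth u i < 1 + n%:Z.
  by move=> [_ _ un] i; have := un i; move: (tnth u i) => a; lia.
have Bn u : B u -> forall i, 1 - l%:Z <= tnth u i < 1 - l%:Z + (n + 2 * l)%N%:Z.
  move=> [_ [_ al an]] i; have := an i; have := l1dist_coord u (anc x u) i.
  by rewrite al; move: (tnth u i) (tnth (anc x u) i) => a b; lia.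
have fA : finite_set A by apply: sub_finite_set (@finite_cube d n) => u [].
have fB : finite_set B.
  apply: sub_finite_set (finite_near (origin d) (n + 2 * l)) => u /Bn H.
  by apply/nearP => i; have := H i; rewrite tnth_mktuple; move: (tnth u i) => a; lia.
rewrite (_ : [set u | _] = A `|` B); last first.
  apply/seteqP; split => u.
    move=> [ou al c]; have [un|nn] := pselect (cube n u); first by left.
    by right; split => //; split => //; case: c.
  by move=> [[ou al un]|[_ [ou al an]]]; split => //; [left | right].
rewrite fset_setU// cardfsU (_ : (_ `&` _)%fset = fset0) ?cardfs0 ?subn0; last first.
  apply/fsetP => u; rewrite !inE !in_fset_set//; apply/negP => /andP[/set_mem[_ _ un] /set_mem[]].
  by [].
rewrite natrD (card_lattice_set An) (card_lattice_set Bn) !natr_sum; congr (_ + _).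
  apply: eq_bigr => f _; congr (_%:R); congr nat_of_bool.
  apply/asboolP/asboolP => [[of_ al _]|[of_ H]].
    by split => //; apply/(ancestor_l1dist (opn x) (weight x) _ l0).
  split => //; first exact/ancestor_l1dist.
  by move=> i; rewrite tnth_pt; have := ltn_ord (f i); move: (nat_of_ord (f i)) => a; lia.
rewrite /shell_sum [RHS]big_mkcond; apply: eq_bigr => f _; rewrite /in_shell /shell_ind.
case: asboolP => [[nc H]|nB]; case: asboolP => [c|nc'] //=.
  by case: asboolP.
by case: asboolP => // H; case: nB.
Qed.

Lemma bdm_shell_ind l n u : bdm (shell_ind l n u).
Proof.
apply: bdm_asbool; apply: (@mpred_ext _ _ (fun x : field => exists v,
  anc x u = v /\ (opn x u /\ (l1dist u v = l /\ cube n v)))).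
  by move=> x; split=> [[v [<- [? []]]]|[? ? ?]]; [|exists (anc x u)].
apply: mpred_exists => v; apply: mpred_and; first exact: mpred_field_ancestor.
by apply: mpred_and; [exact: mpred_opn | exact: mpred_cst].
Qed.

Lemma bdm_shell_sum l n : bdm (shell_sum l n).
Proof. by apply: bdm_sum => f; exact: bdm_shell_ind. Qed.

Lemma bdm_length_total l n : (0 < l)%N -> bdm (length_total l n).
Proof.
move=> l0.
rewrite (_ : length_total l n = fun x => site_sum (length_ind l) n x + shell_sum l n x).
  by apply: bdmD; [apply: bdm_site_sum; exact: bdm_length_ind | exact: bdm_shell_sum].
by apply/funext => x; exact: length_total_site_sum.
Qed.

Lemma shell_ind_local l n u x x' : (0 < l)%N ->
  (forall i, near l u (site i) -> x i = x' i) -> shell_ind l n u x = shell_ind l n u x'.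
Proof.
move=> l0.
have sub (y y' : field) : (forall i, near l u (site i) -> y i = y' i) ->
    [/\ opn y u, l1dist u (anc y u) = l & cube n (anc y u)] ->
    [/\ opn y' u, l1dist u (anc y' u) = l & cube n (anc y' u)].
  move=> yy' [oy al an].
  have au : anc y u <> u by move=> E; move: al l0; rewrite E l1dist0 => <-.
  have [na _] := ancestor_min au.
  have nn : nearest (opn y) u = nearest (opn y') u.
    apply: (nearest_local (r := l) _ na.1); last by rewrite al.
    by move=> v' uv'; rewrite /opn yy'//=; exact: near_l1dist.
  have uu : near l u u by apply/nearP => i; rewrite subrr.
  (* The two sets of minimizers are equal, so [xget] picks the same element in both. *)
  have E : anc y u = anc y' u.
    congr xget; apply/seteqP; split => v /=; rewrite /weight nn => -[nv m]; split => // v' nv'.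
      by rewrite -!yy'//; exact: m.
    by rewrite !yy'//; exact: m.
  by rewrite -E; split => //; rewrite /opn -yy'.
move=> xx'; congr (_%:R); congr nat_of_bool; apply/asboolP/asboolP; first exact: sub.
by apply: sub => i /xx'.
Qed.

End field_totals.

Lemma expr_sub_le (R : realFieldType) (x y : R) (k : nat) : 0 <= y <= x ->
  x ^+ k - y ^+ k <= (x - y) * (k%:R * x ^+ k.-1).
Proof.
move=> /andP[y0 yx]; have x0 := le_trans y0 yx.
rewrite subrXX; apply: ler_wpM2l; first by rewrite subr_ge0.
rewrite mulr_natl -[X in _ *+ X]card_ord -sumr_const; apply: ler_sum => i _.
have -> : k.-1 = (k.-1 - i + i)%N by have := ltn_ord i; lia.
rewrite addnK exprD; apply: ler_wpM2l; first exact: exprn_ge0.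
by apply: lerXn2r.
Qed.

Lemma card_shell (R : realType) (d l n : nat) : (0 < n)%N ->
  #|[pred f | @in_shell d l n f]|%:R <=
  (2 * l)%:R * (d%:R * (1 + 2 * l)%:R ^+ d.-1) * n%:R ^+ d.-1 :> R.
Proof.
move=> n0.
have H : (#|[pred f | @in_shell d l n f]| + n ^ d <= (n + 2 * l) ^ d)%N.
  have -> : ((n + 2 * l) ^ d = #|{ffun 'I_d -> 'I_(n + 2 * l)}|)%N by rewrite card_ffun !card_ord.
  rewrite -(cardC [pred f | @in_shell d l n f]) leq_add2l.
  have := card_inner d l (n + 2 * l); rewrite addnK => /leq_trans; apply.
  apply: subset_leq_card; apply/fintype.subsetP => f; rewrite !inE => /forallP fl.
  rewrite /in_shell negbK; apply/asboolP => i; rewrite tnth_pt; have := fl i.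
  by move: (nat_of_ord (f i)) => a; lia.
have {}H : #|[pred f | @in_shell d l n f]|%:R <= (n + 2 * l)%:R ^+ d - n%:R ^+ d :> R.
  by rewrite lerBrDr -!natrX -natrD ler_nat.
apply: (le_trans H); apply: (le_trans (expr_sub_le _ _)).
  by rewrite ler0n ler_nat leq_addr.
rewrite -natrB ?leq_addr// addKn -!mulrA; apply: ler_wpM2l; first by rewrite ler0n.
apply: ler_wpM2l; first by rewrite ler0n.
rewrite -exprMn; apply: lerXn2r; rewrite ?nnegrE ?mulr_ge0 ?ler0n//.
by rewrite -natrM ler_nat; nia.
Qed.

Lemma var_shell_sum (R : realType) (d l : nat) (Q : probability (field R (index d)) R) :
  independent_coordinates Q -> (0 < l)%N ->
  exists2 C : R, 0 <= C & forall n, (0 < n)%N -> var Q (shell_sum l n) <= C * n%:R ^+ d.-1.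
Proof.
move=> iQ l0; pose V : R := 4 * 36 ^+ d * (2 * l.+1%:R ^+ (2 * d)).
have V0 : 0 <= V by rewrite !mulr_ge0 ?exprn_ge0 ?ler0n.
exists (V * ((2 * l)%:R * (d%:R * (1 + 2 * l)%:R ^+ d.-1))).
  by rewrite !mulr_ge0 ?exprn_ge0 ?ler0n.
move=> n n0; rewrite -mulrA; apply: le_trans (ler_wpM2l V0 (@card_shell R d l n n0)).
apply: (@var_local_sum R d Q iQ l _ _ _ (shell_ind l n)).
- exact: bdm_shell_ind.
- by move=> u x; rewrite /shell_ind; case: asboolP; rewrite ?normr1 ?normr0.
- by move=> u x x' xx'; exact: shell_ind_local.
Qed.

(** * Weak limits *)

Lemma switch_count (R : pzRingType) (nu : nat) (b : bool) (k := if nu == 0%N then 1%N else nu.-1) :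
  (b && (nu == 0%N))%:R + (nu == k + b)%N%:R = (nu == k)%:R + b%:R :> R.
Proof.
rewrite /k; case: b; case: nu {k} => [|m] /=.
- by rewrite addr0 add0r.
- by rewrite addn1 eqxx add0r (gtn_eqF (ltnSn m)) add0r.
- by rewrite addr0.
- by rewrite addn0 addr0 add0r.
Qed.

Section switches.
Context (R : realType) (d : nat).
Hypothesis d_ge2 : (2 <= d)%N.
Notation field := (field R (index d)).
Context (Q : probability field R) (iQ : independent_coordinates Q).
Hypothesis Q_shift : forall a i (B : set R), measurable B ->
  Q [set x | B (x (shift_index a i))] = Q [set x | B (x i)].
Context (p : R).
Hypothesis p01 : 0 < p < 1.
Hypothesis Q_closed : forall u, Q [set x : field | x (inl u) = 0] = (1 - p)%:E.

(* A target with one child fewer than required gains the origin as a child;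
   for [nu = 0] the origin itself is the vertex that appears. *)
Lemma degree_nondegenerate (nu : nat) : exists2 c0 : R, 0 < c0 &
  exists N0, forall n, (N0 <= n)%N -> c0 * n%:R ^+ d <= var Q (site_sum (degree_ind nu) n).
Proof.
pose k := if nu == 0%N then 1%N else nu.-1.
have K_gt : (2 * k + 3 * 0 + 3 <= 2 * k + 3)%N by rewrite muln0 addn0.
apply: (@site_sum_nondegenerate R d d_ge2 Q iQ Q_shift p p01 Q_closed _ _ _ K_gt).
- exact: bdm_degree_ind.
- by move=> a u x; exact: degree_ind_shift.
- by move=> x u px uo ut; exact: (degree_ind_close K_gt).
move=> x px; have pcl := pattern_close px.
rewrite !(degree_ind_target K_gt)// degree_ind_closed opn_close eqxx /= add0r addn0.
have oE : degree_ind nu (origin d) x = (opn x (origin d) && (nu == 0%N))%:R :> R.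
  have [oo|no] := boolP (opn x (origin d)); first exact: (degree_ind_origin K_gt).
  by rewrite /degree_ind; case: asboolP => // -[oo]; rewrite oo in no.
by rewrite oE switch_count.
Qed.

(** With an empty row, opening the origin only adds its own edge, of length j + 1; hence j = l -
    1. *)
Lemma length_nondegenerate (l : nat) : (0 < l)%N -> exists2 c0 : R, 0 < c0 &
  exists N0, forall n, (N0 <= n)%N -> c0 * n%:R ^+ d <= var Q (site_sum (length_ind l) n).
Proof.
case: l => // l _.
have K_gt : (2 * 0 + 3 * l + 3 <= 3 * l + 3)%N by [].
apply: (@site_sum_nondegenerate R d d_ge2 Q iQ Q_shift p p01 Q_closed _ _ _ K_gt).
- exact: bdm_length_ind.
- by move=> a u x; exact: length_ind_shift.
- by move=> x u px uo _; exact: (length_ind_close K_gt).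
move=> x px; rewrite length_ind_closed (length_ind_close K_gt _ px (@target_neq_origin d d_ge2 l)).
have -> : length_ind l.+1 (origin d) x = (opn x (origin d))%:R :> R.
  have [oo|no] := boolP (opn x (origin d)); first exact: (length_ind_origin K_gt).
  by rewrite /length_ind; case: asboolP => // -[oo]; rewrite oo in no.
by rewrite add0r addrC.
Qed.

End switches.

(* The library equips the real line with two measurable structures that have
   the same measurable sets but distinct displays: [normal_prob] is built over
   one of them while [\int[nu]] uses the other. *)
Lemma integral_normal (R : realType) (s : R) (f : R -> R) (nu : set R -> \bar R) :
  nu = normal_prob 0 s -> bdm f ->
  (\int[nu]_y (f y)%:E)%E = (Ex (normal_prob 0 s) f)%:E.
Proof.
move=> -> bf.
have mid : measurable_fun setT (fun y : measurableTypeR R => y : R) by move=> _ B mB; rewrite setTI.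
pose N := distribution (normal_prob 0 s) (HB.pack (fun y : measurableTypeR R => y : R)
  (isMeasurableFun.Build _ _ _ _ _ mid)).
have E : Ex N f = Ex (normal_prob 0 s) f by exact: (Ex_transfer mid).
by rewrite -E; exact: (Ex_fin N bf).
Qed.

Section weak_limits.
Context (R : realType) (d : nat) (p : R) (Pp : probability (config d) R).
Hypothesis hPp : bernoulli_product p Pp.
Context (dXi : measure_display) (Xi : measurableType dXi) (mu : probability Xi R)
  (U : lattice d * lattice d -> {RV mu >-> R}).
Hypothesis hU : iid_uniform_arcs U.
Notation field := (field R (index d)).
Notation Q := (law Pp U).
Notation P := ((Pp \x mu)%E : probability (config d * Xi)%type R).

Lemma negligible_ties : Q.-negligible [set x : field | ~ no_ties x].
Proof.
pose F (n : nat) : set field := match (choice.unpickle n : option ((lattice d * lattice d) * (lattice d * lattice d))) with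
  | Some ab => [set x : field | [/\ arcs ab.1, ab.1 <> ab.2 & x (inr ab.1) = x (inr ab.2)]]
  | None => set0 end.
apply: (@negligibleS _ _ _ _ (\bigcup_n F n)).
  move=> x /= nt; apply: contrapT => H; apply: nt => a b aa ab E; apply: H.
  by exists (choice.pickle (a, b)) => //; rewrite /F choice.pickleK.
apply: negligible_bigcup => n; rewrite /F; case: choice.unpickle => [[a b]|]; last exact: negligible_set0.
have [[aa ab]|H] := pselect (arcs a /\ a <> b); last first.
  apply: negligibleS (negligible_set0 _) => x /= [aa ab _]; exact: H.
apply: (@negligibleS _ _ _ _ [set x : field | x (inr a) = x (inr b)]); first by move=> x [].
exists [set x : field | x (inr a) = x (inr b)]; split => //; last exact: (law_tie hPp hU).
have := @measurable_fun_eqr _ _ R setT (fun x : field => x (inr a)) (fun x : field => x (inr b))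
  (measurable_coord _) (measurable_coord _) measurableT [set true] I.
by rewrite setTI; congr measurable; apply/seteqP; split => x /eqP.
Qed.

Lemma sqrt_powR (n : nat) : n%:R `^ (d%:R / 2) = Num.sqrt (n%:R ^+ d) :> R.
Proof. by rewrite powRrM powR_mulrn// powR12_sqrt// exprn_ge0. Qed.

Context (X : lattice d -> field -> R) (Y Z : nat -> field -> R).
Hypothesis X_bdm : forall u, bdm (X u).
Hypothesis Y_bdm : forall n, bdm (Y n).
Hypothesis Z_bdm : forall n, bdm (Z n).
Hypothesis Z_total : forall n x, no_ties x -> Z n x = total X Y n x.

Lemma law_transfer (f : field -> R) : bdm f -> Ex Q f = Ex P (f \o encode U).
Proof. by move=> bf; apply: (Ex_transfer (measurable_encode U)). Qed.

(** Ties form a null event, so both the mean and the normalized variable may be replaced by those of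
    [total]; the image law then carries expectations back to the original space. *)
Lemma weak_limit : (exists2 s : R, 0 < s &
    forall f : R -> R, continuous f -> (exists M : R, forall y, `|f y| <= M) ->
    forall e, 0 < e -> exists N, forall n, (N <= n)%N ->
    `|Ex Q (fun x : field => f (normalized Q X Y n.+1 x)) - Ex (normal_prob 0 s) f| <= e) ->
  asymptotically_normal P (fun n y => (Z n (encode U y) -
    fine (expectation P (fun y => Z n (encode U y)))) / n%:R `^ (d%:R / 2)).
Proof.
move=> [s s0 clt]; exists 0, s; split => //.
have EZ n : fine (expectation P (fun y => Z n (encode U y))) = Ex Q (Z n).
  by rewrite law_transfer// unlock.
pose W n (x : field) := (Z n x - Ex Q (Z n)) / n%:R `^ (d%:R / 2).
have bW n : bdm (W n).
  by apply: bdmM; [exact: bdm_center | exact: bdm_cst].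
have WE n : (fun y => (Z n (encode U y) -
    fine (expectation P (fun y => Z n (encode U y)))) / n%:R `^ (d%:R / 2)) = W n \o encode U.
  by apply/funext => y; rewrite EZ.
split=> [n|f cf [M fM]].
  rewrite WE; exact: (measurableT_comp (bW n).1 (measurable_encode U)).
have bf := continuous_bdm cf fM.
have bfW n : bdm (fun x => f (W n x)) by apply: (bdm_comp (bW n).1 bf).
have -> : (fun n => \int[P]_y (f ((Z n (encode U y) -
    fine (expectation P (fun y => Z n (encode U y)))) / n%:R `^ (d%:R / 2)))%:E)%E =
    (fun n => (Ex Q (fun x : field => f (W n x)))%:E).
  apply/funext => n; rewrite law_transfer//.
  rewrite -Ex_fin; last exact: (bdm_comp (measurable_encode U) (bfW n)).
  by apply: eq_integral => y _; rewrite EZ.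
suff H : (Ex Q (fun x : field => f (W n x)))%:E @[n --> \oo] --> (Ex (normal_prob 0 s) f)%:E.
  by rewrite (integral_normal (s := s)).
apply: cvg_EFin; first by near=> n.
apply/cvgrPdist_le => e e0; have [N HN] := clt f cf (ex_intro _ M fM) e e0.
(* The limit theorem is stated at size n + 1, so the threshold is raised by one and the size 0
   discarded. *)
exists N.+1 => // -[//|n] /= Nn; rewrite distrC /=.
have tieW : Q.-negligible [set x : field | f (W n.+1 x) <> f (normalized Q X Y n.+1 x)].
  apply: negligibleS negligible_ties => x /= H nt; apply: H; congr f.
  rewrite /W /normalized sqrt_powR mulrC Z_total//; congr (_ * (_ - _)).
  apply: ae_eq_Ex => //; first exact: bdm_total.
  by apply: negligibleS negligible_ties => x' /= H nt'; apply: H; exact: Z_total.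
rewrite (ae_eq_Ex (bfW n.+1) _ tieW); first exact: HN.
exact: (bdm_comp (bdm_normalized Q X_bdm Y_bdm n.+1).1 bf).
Unshelve. all: by end_near.
Qed.

End weak_limits.

Theorem theorem2p3 (R : realType) (d : nat) (hd : (2 <= d)%N)
    (p : R) (hp : 0 < p < 1)
    (Pp : probability (config d) R) (hPp : bernoulli_product p Pp)
    (dXi : measure_display) (Xi : measurableType dXi)
    (mu : probability Xi R) (U : lattice d * lattice d -> {RV mu >-> R})
    (hU : iid_uniform_arcs U)
    (nu l : nat) (hl : (1 <= l)%N) :
  let P := (Pp \x mu)%E : probability (config d * Xi)%type R in
  let S n (x : config d * Xi) : R :=
    (degree_count x.1 (fun a => U a x.2) nu.+1 n)%:R in
  let L n (x : config d * Xi) : R :=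
    (length_count x.1 (fun a => U a x.2) l n)%:R in
  asymptotically_normal P
    (fun n x => (S n x - fine ('E_P[S n])%E) / n%:R `^ (d%:R / 2)) /\
  asymptotically_normal P
    (fun n x => (L n x - fine ('E_P[L n])%E) / n%:R `^ (d%:R / 2)).
Proof.
move=> P S L.
have d0 : (0 < d)%N by exact: leq_trans hd.
have iQ := law_independent hPp hU.
have Q_shift := law_shift hPp hU.
have Q_closed := law_closed hPp U.
have opnE x : opn (encode U x) = x.1.
  by apply/funext => u; rewrite /opn /=; case: (x.1 u); rewrite ?oner_eq0 ?eqxx.
(* The encoding replaced the labels off [arcs] by 0, which [ancestor] never reads when comparing
   nearest vertices. *)
have ancE (x : config d * Xi) : ancestor x.1 (fun a => U a x.2) =
    ancestor (opn (encode U x)) (weight (encode U x)).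
  rewrite opnE; apply: ancestor_arcs => a aa.
  by rewrite /weight /= /arc_value; case: asboolP.
have SE : S = fun n x => degree_total nu.+1 n (encode U x).
  apply/funext => n; apply/funext => x.
  by rewrite /S /degree_total /degree_count /has_degree /edges ancE opnE.
have LE : L = fun n x => length_total l n (encode U x).
  apply/funext => n; apply/funext => x.
  by rewrite /L /length_total /length_count /edges ancE opnE.
split.
(* Degrees are attached to vertices of the cube, so the boundary term is 0. *)
- rewrite SE; apply: (weak_limit hPp hU (bdm_degree_ind R nu) (Y := fun _ _ => 0)).
  + by move=> n; exact: bdm_cst.
  + by move=> n; exact: bdm_degree_total.
  + by move=> n x nt; rewrite /total addr0; exact: degree_total_site_sum.
  have [C C1 HC] := degree_ind_quasi_local iQ hp Q_closed nu d0.
  have [c0 c00 [N0 HN]] := degree_nondegenerate hd iQ Q_shift hp Q_closed nu.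
  have var0 n : (0 < n)%N -> var (law Pp U) (fun=> 0 : R) <= 0 * n%:R ^+ d.-1.
    by move=> _; rewrite mul0r var_cst.
  exact: (@central_limit_theorem R d (law Pp U) iQ Q_shift (degree_ind nu) C d0
    (bdm_degree_ind R nu) (fun u x => natr_bool01 R _) (degree_ind_shift nu) C1 HC
    (fun _ _ => 0) 0 (fun=> bdm_cst _ 0) var0 (lexx 0) c0 N0 c00 HN).
rewrite LE; apply: (weak_limit hPp hU (bdm_length_ind R l) (Y := shell_sum l)).
- by move=> n; exact: bdm_shell_sum.
- by move=> n; exact: bdm_length_total.
- by move=> n x _; exact: length_total_site_sum.
have [C C1 HC] := length_ind_quasi_local (law Pp U) l.
have [c0 c00 [N0 HN]] := length_nondegenerate hd iQ Q_shift hp Q_closed hl.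
have [C' C'0 HC'] := var_shell_sum iQ hl.
exact: (@central_limit_theorem R d (law Pp U) iQ Q_shift (length_ind l) C d0
  (bdm_length_ind R l) (fun u x => natr_bool01 R _) (length_ind_shift l) C1 HC
  (shell_sum l) C' (@bdm_shell_sum R d l) HC' C'0 c0 N0 c00 HN).
Qed.
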